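(* Let $\lambda>0$ and let $g\in APW$ be written as $g=g_-+g_+$ with $g_\pm\in AP^\pm$, $0\notin\Omega(g_\pm)$, and be such that $g\in S_{\lambda,N}$ with $N>1$. Let $\eta_{1-}=-\sup\Omega(g_-)$, $\eta_{2-}=-\inf\Omega(g_-)$, $\eta_{1+}=\inf\Omega(g_+)$, $\eta_{2+}=\sup\Omega(g_+)$. Suppose that $$\inf_S(|g_+|+|g_-|)>0\quad\text{for any strip } S=\{\xi\in\mathbb{C}:-\varepsilon_2<\mathrm{Im}\,\xi<\varepsilon_1\},\ \varepsilon_1,\varepsilon_2\in[0,+\infty).$$ Then the matrix function $$G=\begin{bmatrix}e_{-\lambda}&0\\ g&e_\lambda\end{bmatrix}$$ admits an $APW$ factorization with partial $AP$ indices $\pm\mu$ where: (i) $\mu=N(\eta_{1+}+\eta_{1-})-\lambda$ if $\eta_{1+}\in\Omega(g_+)$, $-\eta_{1-}\in\Omega(g_-)$ and $$\lambda\ge\max\{N\eta_{1+}+(N-1)\eta_{2-},\ N\eta_{1-}+(N-1)\eta_{2+}\};$$ (ii) $\mu=N\eta_{1+}-(N-1)\eta_{2+}$ if $\eta_{1+},\eta_{2+}\in\Omega(g_+)$ and $$N\eta_{1+}+(N-1)\eta_{2-}\le\lambda\le N\eta_{1-}+(N-1)\eta_{2+};$$ (iii) $\mu=N\eta_{1-}-(N-1)\eta_{2-}$ if $-\eta_{1-},-\eta_{2-}\in\Omega(g_-)$ and $$N\eta_{1-}+(N-1)\eta_{2+}\le\lambda\le N\eta_{1+}+(N-1)\eta_{2-};$$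 (iv) $\mu=\lambda-(N-1)(\eta_{2+}+\eta_{2-})$ if $\eta_{2+}\in\Omega(g_+)$, $-\eta_{2-}\in\Omega(g_-)$ and $$\lambda\le\min\{N\eta_{1+}+(N-1)\eta_{2-},\ N\eta_{1-}+(N-1)\eta_{2+}\}.$$
   Context: $e_\lambda(x)=e^{i\lambda x}$. $H_\infty^\pm$ is the Hardy class of bounded analytic functions in $\mathbb{C}^\pm=\{z:\pm\mathrm{Im}\, z>0\}$, identified with boundary values on $\mathbb{R}$. $AP$ is the uniform closure of the set of finite linear combinations of the $e_\alpha$, $\alpha\in\mathbb{R}$; for $f\in AP$, $M(f)=\lim_{T\to\infty}\frac1{2T}\int_{-T}^Tf(t)\,dt$, $\widehat f(\alpha)=M(e_{-\alpha}f)$, $\Omega(f)=\{\alpha\in\mathbb{R}:\widehat f(\alpha)\ne0\}$. $APW$ is the set of $f\in AP$ with absolutely convergent Bohr-Fourier series $\sum_{\alpha\in\Omega(f)}\widehat f(\alpha)e_\alpha$. $AP^\pm=\{f\in AP:\Omega(f)\subset\mathbb{R}_\pm\}$, $\mathbb{R}_\pm=\{x:\pm x\ge0\}$, $APW^\pm=AP^\pm\cap APW$. The functions $g_\pm$ are uniquely determined by $g$. An $APW$ factorization of $G$ is $G=G_-DG_+^{-1}$ with $G_+^{\pm1}\in(APW^+)^{2\times2}$, $G_-^{\pm1}\in(APW^-)^{2\times2}$, $D=\mathrm{diag}[e_{\delta_1},e_{\delta_2}]$, $\delta_j\in\mathbb{R}$; the $\delta_j$ are the partial $AP$ indices. Class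 $S_{\lambda,N}$: consider representations $g=a_-e_{-\beta}+a_+e_\nu$ with $a_\pm\in H_\infty^\pm$, $0\le\nu,\beta\le\lambda$, $\nu+\beta>0$. Only those for which $N=\lceil\lambda/(\nu+\beta)\rceil$ is the smallest possible (over all such representations of $g$) are considered and, decreasing $\beta,\nu$ if needed, among them those with $\lambda/(\nu+\beta)=N$ exactly. Then $g\in S_{\lambda,N}$ means that $N$ is this minimal value and $g$ has such a representation (with $\lambda/(\nu+\beta)=N$) satisfying in addition, if $N>1$, $e_{\frac{\beta}{N-1}}a_-\in H_\infty^+$ and $e_{-\frac{\nu}{N-1}}a_+\in H_\infty^-$. For $N>1$ the functions $g_\pm$ extend to entire functions, and the infimum over $S$ is understood for these extensions. *)

(* Defs.v *)
From HB Require Import structures.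
From mathcomp Require Import all_boot all_order all_algebra.
From mathcomp Require Import complex.
From mathcomp Require Import all_classical all_reals all_analysis.
Import Order.TTheory GRing.Theory Num.Theory.
Import numFieldNormedType.Exports.

Set Implicit Arguments.
Unset Strict Implicit.
Unset Printing Implicit Defensive.

Local Open Scope classical_set_scope.
Local Open Scope complex_scope.
Local Open Scope ring_scope.

(* [R[i]] itself carries no topology in the library; that of its modulus is
   found on the alias [R[i]^o]. *)

Section AlmostPeriodic.
Variable R : realType.
Implicit Types (f : R -> R[i]) (a : R).

(* The modulus as an element of [R] (the norm [`|z|] lives in [R[i]]). *)
Definition cabs (z : R[i]) : R := ComplexField.Normc.normc z.

Definition e a : R -> R[i] := fun x => cos (a * x) +i* sin (a * x).

Definition trig_poly f :=
  exists (n : nat) (c : 'I_n -> R[i]) (a : 'I_n -> R),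
    f = fun x => \sum_(k < n) c k * e (a k) x.

Definition AP f := forall eps : R, 0 < eps ->
  exists2 p, trig_poly p & forall x, cabs (f x - p x) <= eps.

Definition real_mean (u : R -> R) : R :=
  lim ((fun T : R => (2 * T)^-1 * \int[lebesgue_measure]_(t in `[- T, T]) u t)
         @ +oo).

Definition bohr_mean f : R[i] :=
  real_mean (fun t => complex.Re (f t)) +i* real_mean (fun t => complex.Im (f t)).

Definition bohr_coef f a : R[i] := bohr_mean (fun t => e (- a) t * f t).

Definition Omega f : set R := [set a | bohr_coef f a != 0].

Definition AP_plus f := AP f /\ (forall a, Omega f a -> 0 <= a).
Definition AP_minus f := AP f /\ (forall a, Omega f a -> a <= 0).

Definition APW f :=
  AP f /\ (\esum_(a in Omega f) (cabs (bohr_coef f a))%:E < +oo)%E.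

Definition APW_plus f := AP_plus f /\ APW f.
Definition APW_minus f := AP_minus f /\ APW f.

End AlmostPeriodic.

Section Hardy.
Variable R : realType.

Definition upper : set R[i] := [set z | 0 < complex.Im z].
Definition lower : set R[i] := [set z | complex.Im z < 0].

(* [derivable F z 1] over the scalar field [R[i]] is complex
   differentiability of [F] at [z]. *)
Definition holomorphic_on (U : set R[i]) (F : R[i]^o -> R[i]^o) :=
  forall z, U z -> derivable F z 1.

(* The Stolz angle at the boundary point [x] of the half-plane [U]. *)
Definition stolz (U : set R[i]) (x k : R) : set R[i]^o :=
  [set z | U z /\ `|complex.Re z - x| <= k * `|complex.Im z|].

(* [a] is a.e. the nontangential boundary value of a bounded analytic function
   on [U], where [U] is [upper] or [lower]. *)
Definition Hinf (U : set R[i]) (a : R -> R[i]) :=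
  exists F : R[i]^o -> R[i]^o,
    [/\ holomorphic_on U F,
        exists M : R, forall z, U z -> cabs (F z) <= M &
        {ae lebesgue_measure, forall x : R, forall k : R,
           F z @[z --> within (stolz U x k) (nbhs (x%:C : R[i]^o))]
             --> (a x : R[i]^o)}].

Definition Hinf_plus := Hinf upper.
Definition Hinf_minus := Hinf lower.

Definition S_repr (lam : R) (g am ap : R -> R[i]) (beta nu : R) :=
  [/\ Hinf_minus am, Hinf_plus ap,
      (0 <= nu <= lam) && (0 <= beta <= lam),
      0 < nu + beta &
      {ae lebesgue_measure, forall x : R,
         g x = am x * e (- beta) x + ap x * e nu x}].

(* [N] is the least value of [ceil (lam / (nu + beta))] over all representations
   of [g]: the first clause is the bound, the second one attains it. *)
Definition S_class (lam : R) (N : nat) (g : R -> R[i]) :=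
  (forall am ap beta nu, S_repr lam g am ap beta nu ->
     (N%:Z <= Num.ceil (lam / (nu + beta)))%R) /\
  (exists am ap beta nu,
     [/\ S_repr lam g am ap beta nu,
         lam / (nu + beta) = N%:R &
         (1 < N)%N ->
           Hinf_plus (fun x => e (beta / (N%:R - 1)) x * am x) /\
           Hinf_minus (fun x => e (- (nu / (N%:R - 1))) x * ap x)]).

Definition entire_extension (f : R -> R[i]) (F : R[i]^o -> R[i]^o) :=
  holomorphic_on setT F /\ (forall x : R, F x%:C = f x).

Definition strip (eps1 eps2 : R) : set R[i] :=
  [set z | - eps2 < complex.Im z < eps1].

End Hardy.

Section Factorization.
Variable R : realType.

Definition mx2 (a b c d : R[i]) : 'M[R[i]]_2 :=
  \matrix_(i, j) if i == 0 then (if j == 0 then a else b)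
                 else (if j == 0 then c else d).

Definition Gmx (lam : R) (g : R -> R[i]) : R -> 'M[R[i]]_2 :=
  fun x => mx2 (e (- lam) x) 0 (g x) (e lam x).

(* [A] and its pointwise inverse both have all their entries in [X]. *)
Definition mx_unit_over (X : (R -> R[i]) -> Prop) (A : R -> 'M[R[i]]_2) :=
  [/\ forall x, A x \in unitmx,
      forall i j, X (fun x => A x i j) &
      forall i j, X (fun x => invmx (A x) i j)].

Definition APW_factorization (G : R -> 'M[R[i]]_2) (d1 d2 : R) :=
  exists Gm Gp : R -> 'M[R[i]]_2,
    [/\ mx_unit_over (@APW_minus R) Gm,
        mx_unit_over (@APW_plus R) Gp &
        forall x, G x = Gm x *m mx2 (e d1 x) 0 0 (e d2 x) *m invmx (Gp x)].

End Factorization.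

(* Main.v *)
(* With [S = \sum_i g_-^(N-1-i) (- g_+)^i] one has [(g_- + g_+) S = g_-^N - (- g_+)^N], so that
   [phi_+ = (e_s S, (-1)^N e_(s-lam) g_+^N)] satisfies [G phi_+ = e_(-mu) phi_-] with
   [phi_- = (e_(s-lam+mu) S, e_(s+mu) g_-^N)].  In each of the four cases a value of [s] makes
   the spectra of [phi_+] and [phi_-] lie in the right half-lines and makes one entry of each
   tend to a nonzero constant at infinity in its half-plane.  The strip hypothesis keeps
   [phi_+] and [phi_-] away from 0 on every horizontal line, hence both satisfy a Bezout
   identity in [APW^+], respectively [APW^-].  Completing them to matrices of determinant 1
   reduces [G] to a triangular matrix with diagonal [e_mu, e_(-mu)]; as [mu >= 0], the corner
   entry is absorbed in the factors after splitting its series at 0.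

   The Bezout identity is solved for sequences of exponential polynomials approximating the
   entries.  Adjoints solve it with arbitrary frequencies on each line, hence on a thin strip,
   and the constant term solves it with nonnegative frequencies high up; subtracting the
   nonnegative part of the difference of two solutions glues them, so the set of heights
   above which it is solvable with nonnegative frequencies reaches 0.

   That [mu >= 0] follows from the class [S_(lam,N)]: by Cauchy's theorem the mean of
   [e_k a] is 0 for [a] in a Hardy class of the half-plane where [e_k] decays, which confines
   the spectra of [g_-] and [g_+] to [[-beta N/(N-1), -beta]] and [[nu, nu N/(N-1)]]. *)

Require Import Defs.
From HB Require Import structures.
From mathcomp Require Import all_boot all_order all_algebra.
From mathcomp Require Import complex ring lra.
From mathcomp Require Import all_classical all_reals all_analysis.
Import Order.TTheory GRing.Theory Num.Theory.
Import numFieldNormedType.Exports.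

Set Implicit Arguments.
Unset Strict Implicit.
Unset Printing Implicit Defensive.

Local Open Scope classical_set_scope.
Local Open Scope ring_scope.

(** * Modulus and exponential polynomials *)

(** The Bezout equation is solved for finite exponential sums because one sum carries many norms at
    once: the weights [sw y0 y1] measure it on any line or strip. Its coefficients are recovered
    from its values on the real line, so a norm bound read off one expression and a frequency
    restriction read off another hold together ([ep_cap]); gluing rests on this.

    Finite sums meet the equation only approximately, with errors to be controlled along the whole
    sequence. A residual of norm below 1 is enough: a Neumann series then makes it arbitrarily
    small, with multipliers bounded independently of the precision.

    The strip hypothesis speaks of entire extensions that are given abstractly. It reaches the
    approximants only once the extension is known to be the sum of the series. That uniqueness, the
    means of exponentials and the spectral bounds from the Hardy classes all rest on Cauchy's
    theorem for rectangles. The column analytic in the lower half-plane is reduced to the other one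
    by the reflection of [z] into [- z], which exchanges the roles of [gm] and [gp]. *)

Section ComplexModulus.
Variable R : realType.
Implicit Types (z w : R[i]) (a x y : R).
Local Open Scope complex_scope.

Lemma cabs0 : cabs (0 : R[i]) = 0. Proof. exact: ComplexField.Normc.normc0. Qed.
Lemma cabs1 : cabs (1 : R[i]) = 1. Proof. exact: ComplexField.Normc.normc1. Qed.
Lemma cabsM z w : cabs (z * w) = cabs z * cabs w.
Proof. exact: ComplexField.Normc.normcM. Qed.
Lemma cabsV z : cabs z^-1 = (cabs z)^-1.
Proof. exact: ComplexField.Normc.normcV. Qed.
Lemma cabsN z : cabs (- z) = cabs z. Proof. exact: normcN. Qed.
Lemma cabsD z w : cabs (z + w) <= cabs z + cabs w. Proof. exact: le_normcD. Qed.
Lemma cabsB z w : cabs (z - w) <= cabs z + cabs w.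
Proof. by rewrite (le_trans (cabsD _ _)) ?cabsN. Qed.
Lemma cabsC z w : cabs (z - w) = cabs (w - z).
Proof. by rewrite -cabsN opprB. Qed.

Lemma cabsE (x y : R) : cabs (x +i* y) = Num.sqrt (x ^+ 2 + y ^+ 2).
Proof. by []. Qed.

Lemma cabs_ge0 z : 0 <= cabs z.
Proof. by case: z => x y; rewrite cabsE sqrtr_ge0. Qed.
Hint Resolve cabs_ge0 : core.

Lemma cabs_eq0 z : (cabs z == 0) = (z == 0).
Proof.
apply/eqP/eqP => [/ComplexField.Normc.eq0_normc //|->]; exact: cabs0.
Qed.

Lemma cabs_gt0 z : (0 < cabs z) = (z != 0).
Proof. by rewrite lt_def cabs_eq0 cabs_ge0 andbT. Qed.

Lemma cabsX z n : cabs (z ^+ n) = cabs z ^+ n.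
Proof. by elim: n => [|n IH]; rewrite ?expr0 ?cabs1 // !exprS cabsM IH. Qed.

Lemma cabs_sum (I : Type) (r : seq I) (P : pred I) (F : I -> R[i]) :
  cabs (\sum_(i <- r | P i) F i) <= \sum_(i <- r | P i) cabs (F i).
Proof.
elim/big_rec2: _ => [|i x y _ IH]; first by rewrite cabs0.
by rewrite (le_trans (cabsD _ _)) // lerD2l.
Qed.

Lemma cabsR x : cabs (x%:C) = `|x|.
Proof. by rewrite -[x%:C]/(x +i* 0) cabsE expr0n /= addr0 sqrtr_sqr. Qed.

Lemma cabs_conj z : cabs (conjc z) = cabs z.
Proof. by case: z => x y; rewrite -[conjc _]/(x -i* y) !cabsE sqrrN. Qed.

Lemma conjM z w : conjc (z * w) = conjc z * conjc w.
Proof. exact: (rmorphM (@conjc R)). Qed.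

Lemma conj_sum (I : Type) (r : seq I) (F : I -> R[i]) :
  conjc (\sum_(i <- r) F i) = \sum_(i <- r) conjc (F i).
Proof. exact: (rmorph_sum (@conjc R)). Qed.

Lemma sqr_cabs z : (cabs z ^+ 2)%:C = z * conjc z.
Proof.
case: z => x y; rewrite cabsE sqr_sqrtr ?addr_ge0 ?sqr_ge0 //.
by rewrite /real_complex_def; simpc; congr (_ +i* _); ring.
Qed.

Lemma Re_cabs z : `|complex.Re z| <= cabs z.
Proof.
case: z => x y; rewrite cabsE /= -sqrtr_sqr ler_wsqrtr //.
by rewrite lerDl sqr_ge0.
Qed.

Lemma Im_cabs z : `|complex.Im z| <= cabs z.
Proof.
case: z => x y; rewrite cabsE /= -sqrtr_sqr ler_wsqrtr //.
by rewrite lerDr sqr_ge0.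
Qed.

Lemma cabs_ReIm z : cabs z <= `|complex.Re z| + `|complex.Im z|.
Proof.
case: z => x y; rewrite cabsE /=.
rewrite -[leRHS]ger0_norm ?addr_ge0 // -sqrtr_sqr ler_wsqrtr //.
rewrite -(real_normK (num_real x)) -(real_normK (num_real y)).
have := normr_ge0 x; have := normr_ge0 y; nra.
Qed.

Lemma cabs_le_dist z w : cabs z - cabs w <= cabs (z - w).
Proof. by rewrite lerBlDr (le_trans _ (cabsD _ _)) // subrK. Qed.

End ComplexModulus.
Arguments cabs : simpl never.
#[export] Hint Extern 0 (is_true (0 <= cabs _)) => exact: cabs_ge0 : core.

Section Exponentials.
Variable R : realType.
Implicit Types (z w : R[i]) (a b x y : R).
Local Open Scope complex_scope.

Definition cexp z : R[i] :=
  (expR (complex.Re z))%:C * (cos (complex.Im z) +i* sin (complex.Im z)).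

(* [E a] is the entire extension of [e a]. *)
Definition E a z : R[i] :=
  (expR (- a * complex.Im z))%:C * (cos (a * complex.Re z) +i* sin (a * complex.Re z)).

Lemma cexpD z w : cexp (z + w) = cexp z * cexp w.
Proof.
case: z w => [x y] [u v]; rewrite /cexp /= /real_complex_def.
by simpc; rewrite expRD cosD sinD; congr (_ +i* _); ring.
Qed.

Lemma cexp0 : cexp 0 = 1.
Proof. by rewrite /cexp /= expR0 cos0 sin0 mul1r. Qed.

Lemma cabs_cexp z : cabs (cexp z) = expR (complex.Re z).
Proof.
rewrite /cexp cabsM cabsR ger0_norm ?expR_ge0 // cabsE.
by rewrite cos2Dsin2 sqrtr1 mulr1.
Qed.

Lemma E_cexp a z : E a z = cexp ('i * a%:C * z).
Proof.
case: z => x y; rewrite /E.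
have -> : 'i * a%:C * (x +i* y) = (- (a * y)) +i* (a * x).
  by rewrite /real_complex_def; simpc; congr (_ +i* _); ring.
by rewrite /cexp /= mulNr.
Qed.

Lemma E_add a b z : E (a + b) z = E a z * E b z.
Proof. by rewrite !E_cexp -cexpD -!mulrDl -mulrDr -rmorphD. Qed.

Lemma E_addz a z w : E a (z + w) = E a z * E a w.
Proof. by rewrite !E_cexp -cexpD -mulrDr. Qed.

Lemma E0 z : E 0 z = 1.
Proof. by rewrite E_cexp mulr0 mul0r cexp0. Qed.

Lemma E_oppz a z : E a (- z) = E (- a) z.
Proof. by rewrite !E_cexp mulrN rmorphN mulrN mulNr. Qed.

Lemma E_natmul a n z : E (a *+ n) z = E a z ^+ n.
Proof. by elim: n => [|n IH]; rewrite ?mulr0n ?E0 // mulrS E_add IH exprS. Qed.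

Lemma cabs_E a z : cabs (E a z) = expR (- a * complex.Im z).
Proof.
rewrite /E cabsM cabsR ger0_norm ?expR_ge0 // cabsE.
by rewrite cos2Dsin2 sqrtr1 mulr1.
Qed.

Lemma E_real a x : E a (x%:C) = e a x.
Proof. by rewrite /E /= mulr0 expR0 mul1r. Qed.

Lemma cabs_e a x : cabs (e a x) = 1.
Proof. by rewrite -E_real cabs_E /= mulr0 expR0. Qed.

Lemma conj_E a z : conjc (E a z) = E (- a) (conjc z).
Proof.
case: z => x y; rewrite /E /= /real_complex_def.
by simpc; rewrite cosN sinN mulrN.
Qed.

Lemma e_add a b x : e (a + b) x = e a x * e b x.
Proof. by rewrite -!E_real E_add. Qed.

Lemma e0 x : e 0 x = 1. Proof. by rewrite -E_real E0. Qed.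

Lemma e_mulN a x : e a x * e (- a) x = 1.
Proof. by rewrite -e_add subrr e0. Qed.

Lemma e_oppx a x : e a (- x) = e (- a) x.
Proof. by rewrite /e mulrN mulNr. Qed.

End Exponentials.

Section ExponentialSums.
Variable R : realType.
Implicit Types (z : R[i]) (a b x y M : R) (s r : seq (R[i] * R)).
Implicit Types (S : pred R) (w : R -> R) (P Q : R[i] -> R[i]).
Local Open Scope complex_scope.

Definition ev s z : R[i] := \sum_(t <- s) t.1 * E t.2 z.
Definition wn w s : R := \sum_(t <- s) cabs t.1 * w t.2.

Lemma ev_cat s r z : ev (s ++ r) z = ev s z + ev r z.
Proof. by rewrite /ev big_cat. Qed.

Lemma wn_cat w s r : wn w (s ++ r) = wn w s + wn w r.
Proof. by rewrite /wn big_cat. Qed.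

(** A ball of radius [M] in the algebra of exponential sums under the weighted coefficient norm. The
    list may repeat a frequency, so sums and products need no collecting of terms, and [M] only
    bounds the norm from above. *)
Definition ep S w M P :=
  exists s, [/\ all (fun t => S t.2) s, wn w s <= M & forall z, P z = ev s z].

(** What makes the weighted norm submultiplicative, with the constant 1 of norm 1: [S] is a monoid
    and [w] a submultiplicative weight on it. *)
Definition weight S w :=
  [/\ S 0, forall a b, S a -> S b -> S (a + b),
      forall a, 0 <= w a, forall a b, w (a + b) <= w a * w b & w 0 = 1].

Lemma wn_ge0 w s : (forall a, 0 <= w a) -> 0 <= wn w s.
Proof. move=> w0; rewrite /wn; apply: sumr_ge0 => t _. apply: mulr_ge0; [exact: cabs_ge0|exact: w0]. Qed.

Lemma ep_ge0 S w M P : (forall a, 0 <= w a) -> ep S w M P -> 0 <= M.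
Proof. by move=> w0 [s [_ h _]]; exact: le_trans (wn_ge0 _ w0) h. Qed.

Lemma ep_ext S w M P Q : P =1 Q -> ep S w M P -> ep S w M Q.
Proof. by move=> PQ [s [h1 h2 h3]]; exists s; split=> // z; rewrite -PQ. Qed.

Lemma ep_mono S S' w w' M M' P : (forall a, S a -> S' a) ->
  (forall a, S a -> w' a <= w a) -> M <= M' -> ep S w M P -> ep S' w' M' P.
Proof.
move=> SS ww MM [s [h1 h2 h3]]; exists s; split=> //.
  by apply: sub_all h1 => t; exact: SS.
apply: le_trans MM; apply: le_trans h2.
rewrite /wn big_seq [leRHS]big_seq ler_sum // => t ts.
by rewrite ler_wpM2l ?ww //; move/allP: h1 => /(_ _ ts).
Qed.

Lemma ep_le S w M M' P : M <= M' -> ep S w M P -> ep S w M' P.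
Proof. by apply: ep_mono. Qed.

Lemma ep_add S w M N P Q : ep S w M P -> ep S w N Q ->
  ep S w (M + N) (fun z => P z + Q z).
Proof.
move=> [s [h1 h2 h3]] [r [k1 k2 k3]]; exists (s ++ r); split.
- by rewrite all_cat h1 k1.
- by rewrite wn_cat lerD.
- by move=> z; rewrite ev_cat h3 k3.
Qed.

Lemma ep_scale S w M P (c : R[i]) : ep S w M P ->
  ep S w (cabs c * M) (fun z => c * P z).
Proof.
move=> [s [h1 h2 h3]]; exists [seq (c * t.1, t.2) | t <- s]; split.
- by rewrite all_map.
- rewrite /wn big_map (le_trans _ (ler_wpM2l (cabs_ge0 c) h2)) //.
  by rewrite /wn mulr_sumr ler_sum // => t _; rewrite cabsM mulrA.
- by move=> z; rewrite h3 /ev big_map mulr_sumr; apply: eq_bigr => t _; rewrite mulrA.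
Qed.

Lemma ep_opp S w M P : ep S w M P -> ep S w M (fun z => - P z).
Proof.
move=> /(@ep_scale _ _ _ _ (-1)); rewrite cabsN cabs1 mul1r.
by apply: ep_ext => z; rewrite mulN1r.
Qed.

Lemma ep_sub S w M N P Q : ep S w M P -> ep S w N Q ->
  ep S w (M + N) (fun z => P z - Q z).
Proof. by move=> hP /ep_opp; exact: ep_add. Qed.

Lemma ep_E S w a (c : R[i]) : S a -> ep S w (cabs c * w a) (fun z => c * E a z).
Proof.
move=> Sa; exists [:: (c, a)]; split=> [|| z]; first by rewrite /= Sa.
- by rewrite /wn big_seq1.
- by rewrite /ev big_seq1.
Qed.

Lemma ep_zero S w : ep S w 0 (fun=> 0).
Proof. by exists [::]; split => // [|z]; rewrite /wn /ev ?big_nil. Qed.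

Lemma ep_ev S w s : all (fun t => S t.2) s -> ep S w (wn w s) (ev s).
Proof. by move=> h; exists s. Qed.

Lemma ep_sum (I : Type) (l : seq I) S w (M : I -> R) (P : I -> R[i] -> R[i]) :
  (forall i, ep S w (M i) (P i)) ->
  ep S w (\sum_(i <- l) M i) (fun z => \sum_(i <- l) P i z).
Proof.
move=> h; elim: l => [|i l IH].
  rewrite big_nil; apply: ep_ext (ep_zero _ _) => z.
  by rewrite big_nil.
rewrite big_cons; apply: ep_ext (ep_add (h i) IH) => z.
by rewrite big_cons.
Qed.

Section Weight.
Variables (S : pred R) (w : R -> R).
Hypothesis hw : weight S w.

Lemma ep_cst (c : R[i]) : ep S w (cabs c) (fun=> c).
Proof.
have [S0 _ _ _ w0] := hw.
have := ep_E w c S0; rewrite w0 mulr1; apply: ep_ext => z.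
by rewrite E0 mulr1.
Qed.

Lemma ep_mul M N P Q : ep S w M P -> ep S w N Q ->
  ep S w (M * N) (fun z => P z * Q z).
Proof.
have [S0 SD w_ge0 wD w0] := hw.
move=> [s [h1 h2 h3]] [r [k1 k2 k3]].
exists [seq (t.1 * u.1, t.2 + u.2) | t <- s, u <- r]; split.
- apply/allP => _ /allpairsP[[t u] /= [ts ur ->]] /=.
  by apply: SD; [move/allP: h1; apply | move/allP: k1; apply].
- rewrite /wn big_allpairs_dep /=.
  have: wn w s * wn w r <= M * N by rewrite ler_pM ?wn_ge0.
  apply: le_trans; rewrite /wn mulr_suml ler_sum // => t _.
  rewrite mulr_sumr ler_sum // => u _.
  by rewrite cabsM mulrACA ler_wpM2l ?mulr_ge0.
- move=> z; rewrite h3 k3 /ev big_allpairs_dep /= mulr_suml.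
  apply: eq_bigr => t _; rewrite mulr_sumr; apply: eq_bigr => u _.
  by rewrite E_add mulrACA.
Qed.

Lemma ep_exp M P n : ep S w M P -> ep S w (M ^+ n) (fun z => P z ^+ n).
Proof.
move=> h; elim: n => [|n IH].
  by have := ep_cst 1; rewrite cabs1.
rewrite exprS; apply: ep_ext (ep_mul h IH) => z.
by rewrite exprS.
Qed.

(** The bound is that of the full geometric series, uniform in the number of terms: refining an
    approximate inverse does not enlarge it. *)
Lemma ep_geom M P n : ep S w M P -> 0 <= M < 1 ->
  ep S w (1 - M)^-1 (fun z => \sum_(j < n) P z ^+ j).
Proof.
move=> h /andP[M0 M1].
apply: (@ep_le _ _ (\sum_(j <- index_enum 'I_n) M ^+ j)).
  have p : 0 < 1 - M by rewrite subr_gt0.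
  rewrite -(ler_pM2l p) divff ?gt_eqF //.
  rewrite -opprB mulNr -subrX1 opprB.
  by rewrite gerBl exprn_ge0.
by apply: ep_sum => j; exact: ep_exp.
Qed.

End Weight.

(* The supremum of [|E a z|] over the strip between the heights [y0] and [y1]. *)
Definition sw y0 y1 a : R := Num.max (expR (- a * y0)) (expR (- a * y1)).

Lemma sw_weightT y0 y1 : weight predT (sw y0 y1).
Proof.
split=> // [a|a b|].
- by rewrite le_max expR_ge0.
- rewrite /sw ge_max !opprD !mulrDl !expRD; apply/andP; split;
    by rewrite ler_pM ?expR_ge0 // le_max lexx ?orbT.
- by rewrite /sw oppr0 !mul0r expR0 maxxx.
Qed.

Definition nneg : pred R := fun a => 0 <= a.

Lemma weight_sub S S' w : (forall a, S' a -> S a) -> S' 0 ->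
  (forall a b, S' a -> S' b -> S' (a + b)) -> weight S w -> weight S' w.
Proof. by move=> SS S0 SD [_ _ h1 h2 h3]; split. Qed.

Lemma sw_weight y0 y1 : weight nneg (sw y0 y1).
Proof.
apply: weight_sub (sw_weightT y0 y1) => //; first exact: lexx.
by move=> a b; exact: addr_ge0.
Qed.

Lemma sw0 a : sw 0 0 a = 1.
Proof. by rewrite /sw mulr0 expR0 maxxx. Qed.

Lemma sw_ge0 y0 y1 a : 0 <= sw y0 y1 a.
Proof. by rewrite /sw le_max expR_ge0. Qed.

(** For nonnegative frequencies the lower edge of a strip carries the norm, for negative ones
    ([sw_neg]) the upper edge. Hence a nonnegative part extends upwards, and a negative part
    downwards, at no cost. *)
Lemma sw_nneg y0 y1 a : y0 <= y1 -> 0 <= a -> sw y0 y1 a = expR (- a * y0).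
Proof.
move=> y01 a0; rewrite /sw max_l // ler_expR; rewrite !mulNr lerN2.
by rewrite ler_wpM2l.
Qed.

Lemma sw_neg y0 y1 a : y0 <= y1 -> a <= 0 -> sw y0 y1 a = expR (- a * y1).
Proof.
move=> y01 a0; rewrite /sw max_r // ler_expR.
by rewrite ler_wpM2l ?oppr_ge0.
Qed.

Lemma ep_bound S w M P z : ep S w M P ->
  (forall a, S a -> expR (- a * complex.Im z) <= w a) -> cabs (P z) <= M.
Proof.
move=> [s [h1 h2 h3]] hw; rewrite h3; apply: le_trans h2.
apply: le_trans (cabs_sum _ _ _) _.
rewrite /wn big_seq [leRHS]big_seq ler_sum // => t ts.
rewrite cabsM cabs_E ler_wpM2l //; apply: hw.
by move/allP: h1; apply.
Qed.

(* The adjoint of [P] on the horizontal line of height [y]. *)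
Definition star y P z := conjc (P (conjc z + (y *+ 2) *i)).

Lemma ep_star y M P : ep predT (sw y y) M P -> ep predT (sw y y) M (star y P).
Proof.
move=> [s [h1 h2 h3]].
exists [seq (conjc t.1 * (expR (- t.2 * (y *+ 2)))%:C, - t.2) | t <- s]; split.
- by rewrite all_map; apply/allP.
- apply: le_trans h2; rewrite /wn big_map /= ler_sum // => t _.
  rewrite cabsM cabs_conj cabsR ger0_norm ?expR_ge0 // -mulrA.
  rewrite ler_wpM2l // /sw !maxxx -expRD ler_expR le_eqVlt; apply/orP; left.
  by apply/eqP; ring.
- move=> z; rewrite /star h3 /ev conj_sum big_map; apply: eq_bigr => t _.
  rewrite conjM -mulrA; congr (_ * _).
  rewrite E_addz conjM conj_E conjcK mulrC; congr (_ * _).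
  by rewrite /E /= mulr0 cos0 sin0 /real_complex_def; simpc.
Qed.

Lemma star_line y P x : star y P (x +i* y) = conjc (P (x +i* y)).
Proof.
rewrite /star; congr (conjc (P _)).
by simpc; congr (_ +i* _); rewrite mulr2n addrA addNr add0r.
Qed.

End ExponentialSums.
Arguments nneg {R}.

(** * Cauchy's theorem for rectangles *)

Lemma derivable_eps (K : numFieldType) (f : K^o -> K^o) (z : K) :
  derivable f z 1 -> forall eps : K, 0 < eps ->
  exists2 d : K, 0 < d & forall h, `|h| < d ->
    `|f (z + h) - f z - 'D_1 f z * h| <= eps * `|h|.
Proof.
move=> /cvg_ex[l hl]; have -> : 'D_1 f z = l by exact/cvg_lim.
move=> eps eps0; move/cvgrPdist_le : hl => /(_ _ eps0).
move=> /nbhs_ballP[d /= d0 hd]; exists d => // h hhd.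
have [->|h0] := eqVneq h 0.
  by rewrite addr0 subrr mulr0 subrr normr0 mulr0.
have := hd h; rewrite /ball /= sub0r normrN => /(_ hhd h0).
rewrite -(ler_pM2r (x := `|h|)) ?normr_gt0 // -normrM.
rewrite distrC; congr (_ <= _); congr `|_|.
rewrite mulrBl [h%:A + z]addrC [h%:A]mulr1; congr (_ - _).
by rewrite [_ *: _]mulrC -mulrA mulVf // mulr1.
Qed.

Section ComplexDerivative.
Variable R : realType.
Implicit Types (z h : R[i]) (F G : R[i] -> R[i]).
Local Open Scope complex_scope.

(** Real tolerances and the real-valued modulus keep all estimates in the ordered field [R];
    [cdiff_derivable] makes the link with [derivable]. *)
Definition cdiff F z := exists d : R[i], forall eps : R, 0 < eps ->
  exists2 dl : R, 0 < dl & forall h, cabs h < dl ->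
    cabs (F (z + h) - F z - d * h) <= eps * cabs h.

Definition ccontz F z := forall eps : R, 0 < eps ->
  exists2 dl : R, 0 < dl & forall h, cabs h < dl -> cabs (F (z + h) - F z) <= eps.

Lemma cdiff_derivable (F : R[i]^o -> R[i]^o) z : derivable F z 1 -> cdiff F z.
Proof.
move=> /derivable_eps dF; exists ('D_1 F z) => eps eps0.
have /dF[d d0 hd] : 0 < eps%:C :> R[i] by rewrite ltcR.
have d0' : 0 < complex.Re d by move: d0; rewrite ltcE => /andP[].
have dE : d = (complex.Re d)%:C.
  by case: d d0 {hd d0'} => u v; rewrite ltcE /= => /andP[/eqP -> _].
exists (complex.Re d) => // h hh.
by have := hd h; rewrite dE -!/(cabs _)%:C ltcR -rmorphM lecR; apply.
Qed.

Lemma cdiff_lip F z : cdiff F z -> exists L : R, exists2 dl : R, 0 < dl &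
  0 < L /\ forall h, cabs h < dl -> cabs (F (z + h) - F z) <= L * cabs h.
Proof.
move=> [d /(_ 1 ltr01)[dl dl0 hd]]; exists (1 + cabs d), dl => //; split.
  by rewrite ltr_wpDr.
move=> h /hd; rewrite mul1r mulrDl mul1r -cabsM => H.
rewrite -[F (z + h) - F z](subrK (d * h)).
by rewrite (le_trans (cabsD _ _)) // lerD2r.
Qed.

Lemma cdiff_cont F z : cdiff F z -> ccontz F z.
Proof.
move=> /cdiff_lip[L [dl dl0 [L0 h]]] eps eps0.
exists (Num.min dl (eps / L)); first by rewrite lt_min dl0 divr_gt0.
move=> k; rewrite lt_min => /andP[/h H kL]; apply: le_trans H _.
by rewrite mulrC -ler_pdivlMr // ltW.
Qed.

Lemma ccontzM F G z : ccontz F z -> ccontz G z -> ccontz (fun w => F w * G w) z.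
Proof.
move=> hF hG eps e0.
pose K := cabs (F z) + cabs (G z) + 1.
have K0 : 0 < K by rewrite /K ltr_wpDl // addr_ge0.
have [d1 d10 h1] := hF _ (divr_gt0 e0 K0).
have [d2 d20 h2] := hG _ (divr_gt0 e0 K0).
have [d3 d30 h3] := hF _ ltr01.
exists (Num.min d1 (Num.min d2 d3)); first by rewrite !lt_min d10 d20.
move=> h; rewrite !lt_min => /and3P[/h1 H1 /h2 H2 /h3 H3].
have -> : F (z + h) * G (z + h) - F z * G z =
  F (z + h) * (G (z + h) - G z) + (F (z + h) - F z) * G z by ring.
have H4 : cabs (F (z + h)) <= cabs (F z) + 1.
  by rewrite -[F (z + h)](subrK (F z)) (le_trans (cabsD _ _)) // addrC lerD2l.
apply: le_trans (cabsD _ _) _; rewrite !cabsM.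
apply: (@le_trans _ _ ((cabs (F z) + 1) * (eps / K) + eps / K * cabs (G z))).
  by apply: lerD; [exact: ler_pM|exact: ler_wpM2r].
have -> : (cabs (F z) + 1) * (eps / K) + eps / K * cabs (G z) =
  eps / K * (cabs (F z) + cabs (G z) + 1) by ring.
by rewrite -/K divfK ?gt_eqF.
Qed.

Lemma cdiff_ext F G z : F =1 G -> cdiff F z -> cdiff G z.
Proof. by move=> /funext ->. Qed.

Lemma cdiff_cst c z : cdiff (fun=> c) z.
Proof.
exists 0 => eps eps0; exists 1 => // h _.
by rewrite subrr mul0r subrr cabs0 mulr_ge0 // ltW.
Qed.

Lemma cdiff_id z : cdiff id z.
Proof.
exists 1 => eps eps0; exists 1 => // h _.
by rewrite /= mul1r [z + h]addrC addrK subrr cabs0 mulr_ge0 // ltW.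
Qed.

Lemma cdiffD F G z : cdiff F z -> cdiff G z -> cdiff (fun w => F w + G w) z.
Proof.
move=> [a ha] [b hb]; exists (a + b) => eps eps0.
have e2 : 0 < eps / 2 by rewrite divr_gt0.
have [d1 d10 h1] := ha _ e2; have [d2 d20 h2] := hb _ e2.
exists (Num.min d1 d2); first by rewrite lt_min d10.
move=> h; rewrite lt_min => /andP[/h1 H1 /h2 H2].
have -> : F (z + h) + G (z + h) - (F z + G z) - (a + b) * h =
  (F (z + h) - F z - a * h) + (G (z + h) - G z - b * h) by ring.
rewrite (le_trans (cabsD _ _)) // [eps]splitr mulrDl.
exact: lerD.
Qed.

Lemma cdiffM F G z : cdiff F z -> cdiff G z -> cdiff (fun w => F w * G w) z.
Proof.
move=> hF hG; have [L [d0 d00 [L0 hL]]] := cdiff_lip hG.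
move: hF hG => [a ha] [b hb]; exists (a * G z + F z * b) => eps eps0.
pose K : R := cabs (G z) + L * d0 + cabs (F z) + 1 + cabs a * L.
have K0 : 0 < K.
  rewrite /K -addrA addrC ltr_wpDr //; first by rewrite !addr_ge0 // mulr_ge0 // ltW.
  by rewrite ltr_wpDr // mulr_ge0 // ltW.
have e3 : 0 < eps / K by rewrite divr_gt0.
have [d1 d10 h1] := ha _ e3; have [d2 d20 h2] := hb _ e3.
exists (Num.min (Num.min d0 (eps / K)) (Num.min d1 d2)).
  by rewrite !lt_min d00 d10 d20 e3.
move=> h; rewrite !lt_min => /andP[/andP[hd0 he] /andP[/h1 H1 /h2 H2]].
have H0 := hL h hd0.
have -> : F (z + h) * G (z + h) - F z * G z - (a * G z + F z * b) * h =
  (F (z + h) - F z - a * h) * (G (z + h) - G z) +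
  (F (z + h) - F z - a * h) * G z + F z * (G (z + h) - G z - b * h)
  + a * h * (G (z + h) - G z) by ring.
apply: (@le_trans _ _ ((eps / K * cabs h) * (L * d0) + (eps / K * cabs h) * cabs (G z)
   + cabs (F z) * (eps / K * cabs h) + cabs a * cabs h * (L * (eps / K)))).
  rewrite (le_trans (cabsD _ _)) // lerD //; last first.
    rewrite !cabsM ler_wpM2l ?mulr_ge0 // (le_trans H0) // ler_wpM2l ?ltW //.
  rewrite (le_trans (cabsD _ _)) // lerD //; last by rewrite cabsM ler_wpM2l.
  rewrite (le_trans (cabsD _ _)) // lerD //; last by rewrite cabsM ler_wpM2r.
  rewrite cabsM ler_pM // (le_trans H0) // ler_wpM2l ?ltW //.
have -> : eps / K * cabs h * (L * d0) + eps / K * cabs h * cabs (G z) +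
    cabs (F z) * (eps / K * cabs h) + cabs a * cabs h * (L * (eps / K)) =
  eps / K * cabs h * (cabs (G z) + L * d0 + cabs (F z) + cabs a * L) by ring.
rewrite mulrAC; apply: ler_wpM2r => //.
rewrite mulrAC -mulrA ler_piMr ?(ltW eps0) //.
rewrite ler_pdivrMr // mul1r /K.
by rewrite -!addrA !lerD2l lerDr.
Qed.

(** Assembled from the derivatives of [expR], [cos] and [sin] at 0; by the functional equation of
    [cexp] this single point suffices for [cdiff_cexp]. *)
Lemma cexp_deriv0 (eps : R) : 0 < eps ->
  exists2 dl : R, 0 < dl & forall h, cabs h < dl ->
    cabs (cexp h - 1 - h) <= eps * cabs h.
Proof.
move=> eps0.
(* The errors of the real and imaginary parts are at most [4 * e1] and [5 * e1] times the modulus of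
   [h], so the factor 14 leaves room. *)
have [e1 [e10 e11 e1e]] : exists e1 : R, [/\ 0 < e1, e1 <= 1 & 14 * e1 <= eps].
  exists (Num.min 1 (eps / 14)); split.
  - by rewrite lt_min ltr01 divr_gt0.
  - by rewrite ge_min lexx.
  - by rewrite mulrC -ler_pdivlMr // ge_min lexx orbT.
have [d1 d10 H1] := derivable_eps (@derivable_expR R 0) e10.
have [d2 d20 H2] := derivable_eps (@derivable_sin R 0) e10.
have [d3 d30 H3] := derivable_eps (@derivable_cos R 0) e10.
exists (Num.min e1 (Num.min d1 (Num.min d2 d3))).
  by rewrite !lt_min e10 d10 d20 d30.
case=> u v hh.
have hu := le_lt_trans (Re_cabs (u +i* v)) hh.
have hv := le_lt_trans (Im_cabs (u +i* v)) hh.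
rewrite /= !lt_min in hu hv.
case/and4P: hu => u0 u1 u2 u3; case/and4P: hv => v0 v1 v2 v3.
have {H1} := H1 u u1; have {H2} := H2 v v2; have {H3} := H3 v v3.
rewrite !add0r cos0 sin0 expR0.
have -> : 'D_1 (cos : R^o -> R^o) 0 = 0.
  have /@derive_val -> := is_derive_cos (0 : R).
  by rewrite sin0 oppr0.
have -> : 'D_1 (sin : R^o -> R^o) 0 = 1.
  by have /@derive_val -> := is_derive_sin (0 : R); rewrite cos0.
have -> : 'D_1 (expR : R^o -> R^o) 0 = 1.
  by have /@derive_val -> := is_derive_expR (0 : R); rewrite expR0.
rewrite mul0r !mul1r !subr0 => C3 C2 C1.
have nz := cabs_ge0 (u +i* v).
apply: le_trans (cabs_ReIm _) _.
have -> : cexp (u +i* v) - 1 - (u +i* v) =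
  (expR u * cos v - 1 - u) +i* (expR u * sin v - v).
  rewrite /cexp /= /real_complex_def; simpc.
  by apply/eqP; rewrite eq_complex /=; apply/andP; split; apply/eqP; ring.
rewrite /=.
have U := Re_cabs (u +i* v); have V := Im_cabs (u +i* v).
rewrite /= in U V.
have E3 : `|expR u| <= 3.
  have -> : expR u = (expR u - 1 - u) + (1 + u) by ring.
  apply: le_trans (ler_normD _ _) _; apply: le_trans (lerD C1 (ler_normD _ _)) _.
  by rewrite normr1; have := normr_ge0 u; nra.
have T1 : `|expR u * cos v - 1 - u| <= 3 * (e1 * `|v|) + e1 * `|u|.
  have -> : expR u * cos v - 1 - u = expR u * (cos v - 1) + (expR u - 1 - u) by ring.
  rewrite (le_trans (ler_normD _ _)) // lerD // normrM.
  exact: ler_pM.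
have T2 : `|expR u * sin v - v| <= 3 * (e1 * `|v|) + 2 * e1 * `|v|.
  have -> : expR u * sin v - v = expR u * (sin v - v) + (expR u - 1) * v by ring.
  rewrite (le_trans (ler_normD _ _)) // lerD // normrM; first exact: ler_pM.
  apply: ler_pM => //.
  rewrite -[expR u - 1](subrK u); apply: le_trans (ler_normD _ _) _.
  by have := normr_ge0 u; nra.
have := normr_ge0 u; have := normr_ge0 v; nra.
Qed.

Lemma cdiff_cexp F z : cdiff F z -> cdiff (fun w => cexp (F w)) z.
Proof.
move=> hF; have [L [d0 d00 [L0 hL]]] := cdiff_lip hF.
move: hF => [a ha]; exists (cexp (F z) * a) => eps eps0.
pose K : R := cabs (cexp (F z)) * (L + 1) + 1.
have K0 : 0 < K by rewrite ltr_wpDl // mulr_ge0 // addr_ge0 // ltW.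
have eK : 0 < eps / K by rewrite divr_gt0.
have [d1 d10 h1] := ha _ eK; have [d2 d20 h2] := cexp_deriv0 eK.
exists (Num.min d0 (Num.min d1 (d2 / L))); first by rewrite !lt_min d00 d10 divr_gt0.
move=> h; rewrite !lt_min => /and3P[/hL H0 /h1 H1 hd2].
have {h2} H2 : cabs (cexp (F (z + h) - F z) - 1 - (F (z + h) - F z))
    <= eps / K * cabs (F (z + h) - F z).
  by apply: h2; rewrite (le_lt_trans H0) // mulrC -ltr_pdivlMr.
have -> : cexp (F (z + h)) - cexp (F z) - cexp (F z) * a * h =
  cexp (F z) * ((cexp (F (z + h) - F z) - 1 - (F (z + h) - F z)) +
    (F (z + h) - F z - a * h)).
  have e1 : cexp (F (z + h)) = cexp (F z) * cexp (F (z + h) - F z).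
    by rewrite -cexpD [F z + _]addrC subrK.
  by rewrite {1}e1; ring.
rewrite cabsM.
apply: (@le_trans _ _ (cabs (cexp (F z)) * (eps / K * (L * cabs h) + eps / K * cabs h))).
  rewrite ler_wpM2l // (le_trans (cabsD _ _)) // lerD //.
  by rewrite (le_trans H2) // ler_wpM2l // ltW.
have -> : cabs (cexp (F z)) * (eps / K * (L * cabs h) + eps / K * cabs h) =
  eps / K * (cabs (cexp (F z)) * (L + 1)) * cabs h by ring.
rewrite ler_wpM2r // mulrAC ler_pdivrMr // ler_wpM2l ?(ltW eps0) //.
by rewrite /K lerDl.
Qed.

Lemma cdiff_E a z : cdiff (E a) z.
Proof.
apply: (@cdiff_ext (fun w => cexp ('i * a%:C * w))).
  by move=> w; rewrite E_cexp.
apply: cdiff_cexp; apply: cdiffM; [exact: cdiff_cst|exact: cdiff_id].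
Qed.

Lemma cdiff_sum (I : Type) (r : seq I) (F : I -> R[i] -> R[i]) z :
  (forall i, cdiff (F i) z) -> cdiff (fun w => \sum_(i <- r) F i w) z.
Proof.
move=> h; elim: r => [|i r IH].
  by apply: cdiff_ext (cdiff_cst 0 z) => w; rewrite big_nil.
by apply: cdiff_ext (cdiffD (h i) IH) => w; rewrite big_cons.
Qed.

Lemma cdiff_ev s z : cdiff (ev s) z.
Proof. by apply: cdiff_sum => t; apply: cdiffM; [exact: cdiff_cst|exact: cdiff_E]. Qed.

End ComplexDerivative.

Section ComplexIntegral.
Variable R : realType.
Implicit Types (a b c d x y : R) (f g : R -> R[i]) (F G : R[i] -> R[i]).
Local Open Scope complex_scope.
Local Notation mu := (@lebesgue_measure R).

Definition ccont (A : set R) f := forall x, A x -> forall eps : R, 0 < eps ->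
  exists2 dl : R, 0 < dl &
    forall y, A y -> `|y - x| < dl -> cabs (f y - f x) <= eps.

Definition cint a b f : R[i] :=
  (\int[mu]_(x in `[a, b]) complex.Re (f x)) +i*
  (\int[mu]_(x in `[a, b]) complex.Im (f x)).

Lemma Re_cint a b f : complex.Re (cint a b f) = \int[mu]_(x in `[a, b]) complex.Re (f x).
Proof. by []. Qed.

Lemma ccontS (A B : set R) f : A `<=` B -> ccont B f -> ccont A f.
Proof.
move=> AB h x /AB Bx eps e0; have [dl d0 hd] := h x Bx eps e0.
by exists dl => // y /AB; exact: hd.
Qed.

Lemma ccont_cst A (k : R[i]) : ccont A (fun=> k).
Proof. by move=> x _ eps e0; exists 1 => // y _ _; rewrite subrr cabs0 ltW. Qed.

Lemma ccontD A f g : ccont A f -> ccont A g -> ccont A (fun x => f x + g x).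
Proof.
move=> hf hg x Ax eps e0; have e2 : 0 < eps / 2 by rewrite divr_gt0.
have [d1 d10 h1] := hf x Ax _ e2; have [d2 d20 h2] := hg x Ax _ e2.
exists (Num.min d1 d2); first by rewrite lt_min d10.
move=> y Ay; rewrite lt_min => /andP[/(h1 y Ay) H1 /(h2 y Ay) H2].
rewrite opprD addrACA (le_trans (cabsD _ _)) // [eps]splitr.
exact: lerD.
Qed.

Lemma ccontM A f g : ccont A f -> ccont A g -> ccont A (fun x => f x * g x).
Proof.
move=> hf hg x Ax eps e0.
pose K := cabs (f x) + cabs (g x) + 1.
have K0 : 0 < K by rewrite /K ltr_wpDl // addr_ge0.
have [d1 d10 h1] := hf x Ax _ (divr_gt0 e0 K0).
have [d2 d20 h2] := hg x Ax _ (divr_gt0 e0 K0).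
have [d3 d30 h3] := hf x Ax _ ltr01.
exists (Num.min d1 (Num.min d2 d3)); first by rewrite !lt_min d10 d20.
move=> y Ay; rewrite !lt_min => /and3P[/(h1 y Ay) H1 /(h2 y Ay) H2 /(h3 y Ay) H3].
have -> : f y * g y - f x * g x = f y * (g y - g x) + (f y - f x) * g x by ring.
have H4 : cabs (f y) <= cabs (f x) + 1.
  by rewrite -[f y](subrK (f x)) (le_trans (cabsD _ _)) // addrC lerD2l.
apply: le_trans (cabsD _ _) _; rewrite !cabsM.
apply: (@le_trans _ _ ((cabs (f x) + 1) * (eps / K) + eps / K * cabs (g x))).
  by apply: lerD; [exact: ler_pM|exact: ler_wpM2r].
have -> : (cabs (f x) + 1) * (eps / K) + eps / K * cabs (g x) =
    eps / K * (cabs (f x) + cabs (g x) + 1) by ring.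
by rewrite -/K divfK ?gt_eqF.
Qed.

Lemma ccontZ A (k : R[i]) f : ccont A f -> ccont A (fun x => k * f x).
Proof. by move=> h; apply: ccontM => //; exact: ccont_cst. Qed.

Lemma ccontN A f : ccont A f -> ccont A (fun x => - f x).
Proof.
move=> h x Ax eps e0; have [dl d0 hd] := h x Ax eps e0; exists dl => // y Ay yx.
by rewrite -opprD cabsN; exact: hd.
Qed.

Lemma ccontB A f g : ccont A f -> ccont A g -> ccont A (fun x => f x - g x).
Proof. by move=> hf hg; apply: ccontD => //; exact: ccontN. Qed.

Lemma ccont_sum A (I : Type) (r : seq I) (f : I -> R -> R[i]) :
  (forall i, ccont A (f i)) -> ccont A (fun x => \sum_(i <- r) f i x).
Proof.
move=> h; elim: r => [|i r IH].
  rewrite (_ : (fun x => _) = fun=> 0); first exact: ccont_cst.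
  by apply/funext => x; rewrite big_nil.
rewrite (_ : (fun x => _) = fun x => f i x + \sum_(j <- r) f j x).
  exact: ccontD.
by apply/funext => x; rewrite big_cons.
Qed.

Lemma ccont_conj A f : ccont A f -> ccont A (fun x => conjc (f x)).
Proof.
move=> h x Ax eps e0; have [dl d0 hd] := h x Ax eps e0; exists dl => // y Ay yx.
have -> : conjc (f y) - conjc (f x) = conjc (f y - f x).
  by case: (f y) (f x) => [u v] [u' v']; simpc; congr (_ +i* _); ring.
by rewrite cabs_conj; exact: hd.
Qed.

Lemma ccont_unif A f : (forall eps : R, 0 < eps ->
  exists2 g, ccont A g & forall x, A x -> cabs (f x - g x) <= eps) -> ccont A f.
Proof.
move=> h x Ax eps e0; have e3 : 0 < eps / 3 by rewrite divr_gt0.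
have [g hg fg] := h _ e3; have [dl d0 hd] := hg x Ax _ e3.
exists dl => // y Ay yx.
have -> : f y - f x = (f y - g y) + (g y - g x) + (g x - f x) by ring.
have H := hd y Ay yx; have H1 := fg y Ay; have H2 := fg x Ax.
rewrite cabsC in H2.
apply: le_trans (cabsD _ _) _.
have := cabsD (f y - g y) (g y - g x); lra.
Qed.

Lemma ccont_path A (p : R -> R[i]) F :
  (forall x y, cabs (p y - p x) = `|y - x|) ->
  (forall x, A x -> ccontz F (p x)) -> ccont A (fun x => F (p x)).
Proof.
move=> hp h x Ax eps e0; have [dl d0 hd] := h x Ax eps e0; exists dl => // y Ay yx.
have := hd (p y - p x); rewrite hp => /(_ yx).
by rewrite [p x + _]addrC subrK.
Qed.

Lemma hpathE c x y : cabs (y +i* c - x +i* c) = `|y - x|.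
Proof. by rewrite -cabsR; congr cabs; apply/eqP; rewrite eq_complex /= subrr !eqxx. Qed.

Lemma vpathE c x y : cabs (c +i* y - c +i* x) = `|y - x|.
Proof.
have -> : c +i* y - c +i* x = 'i * (y - x)%:C.
  by apply/eqP; rewrite eq_complex /=; apply/andP; split; apply/eqP; ring.
by rewrite cabsM cabsR cabsE expr0n /= add0r expr1n sqrtr1 mul1r.
Qed.

Lemma ccont_h A F c : (forall x, A x -> ccontz F (x +i* c)) ->
  ccont A (fun x => F (x +i* c)).
Proof. exact: (ccont_path (p := fun x => x +i* c) (hpathE c)). Qed.

Lemma ccont_v A F c : (forall y, A y -> ccontz F (c +i* y)) ->
  ccont A (fun y => F (c +i* y)).
Proof. exact: (ccont_path (p := fun y => c +i* y) (vpathE c)). Qed.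

Lemma ccont_e A a : ccont A (e a).
Proof.
rewrite (_ : e a = fun x => E a (x +i* 0)).
  by apply: ccont_h => x _; apply: cdiff_cont; exact: cdiff_E.
by apply/funext => x; rewrite -E_real.
Qed.

Section Integrability.
Variables (a b : R) (f : R -> R[i]).
Hypothesis hf : ccont `[a, b] f.

Lemma ccont_Re_integrable : mu.-integrable `[a, b] (EFin \o (fun x => complex.Re (f x))).
Proof.
apply: continuous_compact_integrable; first exact: segment_compact.
apply/subspace_continuousP => x Ax; apply/cvgrPdist_le => eps e0.
have [dl d0 hd] := hf Ax e0.
rewrite near_withinE; apply/nbhs_ballP; exists dl => //= y.
rewrite /ball /= => xy Ay; have := hd y Ay; rewrite distrC => /(_ xy).
rewrite /from_subspace; apply: le_trans; rewrite cabsC; move: (Re_cabs (f x - f y)).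
by case: (f x) (f y) => [u v] [u' v'] /=.
Qed.

Lemma ccont_Im_integrable : mu.-integrable `[a, b] (EFin \o (fun x => complex.Im (f x))).
Proof.
apply: continuous_compact_integrable; first exact: segment_compact.
apply/subspace_continuousP => x Ax; apply/cvgrPdist_le => eps e0.
have [dl d0 hd] := hf Ax e0.
rewrite near_withinE; apply/nbhs_ballP; exists dl => //= y.
rewrite /ball /= => xy Ay; have := hd y Ay; rewrite distrC => /(_ xy).
rewrite /from_subspace; apply: le_trans; rewrite cabsC; move: (Im_cabs (f x - f y)).
by case: (f x) (f y) => [u v] [u' v'] /=.
Qed.

Lemma ccont_bounded : exists M : R, forall x, a <= x <= b -> cabs (f x) <= M.
Proof.
have [ab|ba] := leP a b; last first.
  by exists 0 => x /andP[h1 h2]; have := le_trans h1 h2; rewrite leNgt ba.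
have hc : {within `[a, b], continuous (fun x => cabs (f x))}.
  apply/subspace_continuousP => x Ax; apply/cvgrPdist_le => eps e0.
  have [dl d0 hd] := hf Ax e0.
  rewrite near_withinE; apply/nbhs_ballP; exists dl => //= y.
  rewrite /ball /= => xy Ay; have := hd y Ay; rewrite distrC => /(_ xy).
  rewrite /from_subspace => H.
  rewrite ler_norml; apply/andP; split; last first.
    by rewrite cabsC in H; exact: le_trans (cabs_le_dist _ _) H.
  by rewrite lerNl opprB; exact: le_trans (cabs_le_dist _ _) H.
have [k _ hk] := EVT_max ab hc.
by exists (cabs (f k)) => x hx; apply: hk; rewrite in_itv.
Qed.

End Integrability.
Hint Extern 0 (Measurable.sort _ _) => exact: measurable_itv : core.

Lemma cint_eq a b f g : (forall x, a <= x <= b -> f x = g x) ->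
  cint a b f = cint a b g.
Proof.
move=> fg; rewrite /cint; congr (_ +i* _); apply: eq_Rintegral => x;
by rewrite inE /= in_itv /= => /fg ->.
Qed.

Lemma cintD a b f g : ccont `[a, b] f -> ccont `[a, b] g ->
  cint a b (fun x => f x + g x) = cint a b f + cint a b g.
Proof.
move=> hf hg; rewrite /cint.
have -> : (fun x => complex.Re (f x + g x)) =
    (fun x => complex.Re (f x) + complex.Re (g x)).
  by apply/funext => x; case: (f x) (g x) => [u v] [u' v'].
have -> : (fun x => complex.Im (f x + g x)) =
    (fun x => complex.Im (f x) + complex.Im (g x)).
  by apply/funext => x; case: (f x) (g x) => [u v] [u' v'].
rewrite !RintegralD //; try exact: ccont_Re_integrable; try exact: ccont_Im_integrable.
Qed.

Lemma cintZ a b (k : R[i]) f : ccont `[a, b] f ->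
  cint a b (fun x => k * f x) = k * cint a b f.
Proof.
move=> hf; rewrite /cint; case: k => p q.
have i1 := ccont_Re_integrable hf; have i2 := ccont_Im_integrable hf.
have -> : (fun x => complex.Re ((p +i* q) * f x)) =
    (fun x => p * complex.Re (f x) - q * complex.Im (f x)).
  by apply/funext => x; case: (f x) => [u v].
have -> : (fun x => complex.Im ((p +i* q) * f x)) =
    (fun x => p * complex.Im (f x) + q * complex.Re (f x)).
  by apply/funext => x; case: (f x) => [u v].
have Z r (h : R -> R) : mu.-integrable `[a, b] (EFin \o h) ->
    mu.-integrable `[a, b] (EFin \o (fun x => r * h x)).
  by move=> ih; apply: (integrableZl (mu := mu) (measurable_itv _) r ih).
rewrite RintegralB //; [|exact: Z|exact: Z].
rewrite RintegralD //; [|exact: Z|exact: Z].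
by rewrite !RintegralZl //; simpc.
Qed.

Lemma cintN a b f : ccont `[a, b] f -> cint a b (fun x => - f x) = - cint a b f.
Proof.
move=> hf; rewrite -mulN1r -cintZ //; apply: cint_eq => x _.
by rewrite mulN1r.
Qed.

Lemma cintB a b f g : ccont `[a, b] f -> ccont `[a, b] g ->
  cint a b (fun x => f x - g x) = cint a b f - cint a b g.
Proof. by move=> hf hg; rewrite cintD ?cintN //; exact: ccontN. Qed.

Lemma cint_cst a b (k : R[i]) : a <= b -> cint a b (fun=> k) = k * (b - a)%:C.
Proof.
move=> ab; rewrite /cint !Rintegral_cst ?measurable_itv //.
rewrite /= lebesgue_measure_itv /= lte_fin.
have -> : fine (if (a < b)%R then b%:E - a%:E else 0)%E = b - a.
  case: ltP => // ba; have -> : a = b by apply/eqP; rewrite eq_le ab.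
  by rewrite subrr.
by case: k => u v; rewrite /real_complex_def; simpc.
Qed.

Lemma cint_split a m b f : a <= m <= b -> ccont `[a, b] f ->
  cint a b f = cint a m f + cint m b f.
Proof.
move=> /andP[am mb] hf; rewrite /cint; simpc.
have H (h : R -> R) : mu.-integrable `[a, b] (EFin \o h) ->
    \int[mu]_(x in `[a, b]) h x = \int[mu]_(x in `[a, m]) h x + \int[mu]_(x in `[m, b]) h x.
  move=> ih.
  have := @Rintegral_itvB _ h (BLeft a) (BRight b) m ih.
  rewrite !bnd_simp => /(_ am mb).
  rewrite Rintegral_itv_obnd_cbnd; last first.
    apply: integrableS ih; [exact: measurable_itv|exact: measurable_itv|].
    by apply: subset_itvr; rewrite bnd_simp.
  by move=> <-; rewrite addrC subrK.
congr (_ +i* _); apply: H; [exact: ccont_Re_integrable|exact: ccont_Im_integrable].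
Qed.

(** As [cint] is defined by real and imaginary parts, the integrand is rotated by the conjugate of
    the integral [I]: the squared modulus of [I] is then the integral of a real part, bounded
    pointwise by [cabs I * M]. *)
Lemma cint_bound a b f (M : R) : a <= b -> ccont `[a, b] f ->
  (forall x, a <= x <= b -> cabs (f x) <= M) -> cabs (cint a b f) <= M * (b - a).
Proof.
move=> ab hf fM; set I := cint a b f.
have M0 : 0 <= M by apply: le_trans (fM a _); rewrite ?lexx.
have [I0|I0] := eqVneq I 0; first by rewrite I0 cabs0 mulr_ge0 ?subr_ge0.
have Ip : 0 < cabs I by rewrite cabs_gt0.
rewrite -(ler_pM2l Ip).
have -> : cabs I * cabs I = complex.Re (cint a b (fun x => conjc I * f x)).
  by rewrite cintZ // -/I [conjc I * I]mulrC -sqr_cabs -expr2.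
have -> : cabs I * (M * (b - a)) = complex.Re (cint a b (fun=> (cabs I * M)%:C)).
  by rewrite cint_cst // -rmorphM /= mulrA.
rewrite !Re_cint; apply: le_Rintegral => //.
- by apply: ccont_Re_integrable; exact: ccontZ.
- apply: (ccont_Re_integrable (f := fun=> (cabs I * M)%:C)).
  exact: ccont_cst.
- move=> x xab; have /fM H : a <= x <= b by move: xab; rewrite /= in_itv.
  apply: le_trans (ler_norm _) _; apply: le_trans (Re_cabs _) _.
  by rewrite cabsM cabs_conj ler_wpM2l.
Qed.

End ComplexIntegral.

Section Goursat.
Variable R : realType.
Implicit Types (a b c d x y : R) (F G : R[i] -> R[i]).
Local Open Scope complex_scope.

(** The contour integral along the boundary of the rectangle, counterclockwise; the factor ['i]
    comes from parametrizing the vertical sides by height. *)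
Definition rint F a b c d : R[i] :=
  (cint a b (fun x => F (x +i* c)) - cint a b (fun x => F (x +i* d))) +
  'i * (cint c d (fun y => F (b +i* y)) - cint c d (fun y => F (a +i* y))).

Definition on_rect (P : R[i] -> Prop) a b c d :=
  forall x y, a <= x <= b -> c <= y <= d -> P (x +i* y).

Lemma on_rectS (P : R[i] -> Prop) a b c d a' b' c' d' :
  a <= a' -> b' <= b -> c <= c' -> d' <= d ->
  on_rect P a b c d -> on_rect P a' b' c' d'.
Proof.
move=> aa bb cc dd h x y /andP[x1 x2] /andP[y1 y2]; apply: h.
  by rewrite (le_trans aa x1) (le_trans x2 bb).
by rewrite (le_trans cc y1) (le_trans y2 dd).
Qed.

Section Sides.
Variables (a b c d : R) (F : R[i] -> R[i]).
Hypotheses (ab : a <= b) (cd : c <= d) (hF : on_rect (ccontz F) a b c d).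

Lemma ccont_hside y : c <= y <= d -> ccont `[a, b] (fun x => F (x +i* y)).
Proof. by move=> hy; apply: ccont_h => x; rewrite /= in_itv => hx; exact: hF. Qed.

Lemma ccont_vside x : a <= x <= b -> ccont `[c, d] (fun y => F (x +i* y)).
Proof. by move=> hx; apply: ccont_v => y; rewrite /= in_itv => hy; exact: hF. Qed.

Lemma rint_splith m : a <= m <= b -> rint F a b c d = rint F a m c d + rint F m b c d.
Proof.
move=> m_ab; rewrite /rint.
rewrite !(cint_split m_ab); try by apply: ccont_hside; rewrite lexx ?cd.
ring.
Qed.

Lemma rint_splitv m : c <= m <= d -> rint F a b c d = rint F a b c m + rint F a b m d.
Proof.
move=> m_cd; rewrite /rint.
rewrite !(cint_split m_cd); try by apply: ccont_vside; rewrite lexx ?ab.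
ring.
Qed.

Lemma rint_bound (M : R) : on_rect (fun z => cabs (F z) <= M) a b c d ->
  cabs (rint F a b c d) <= 2 * M * ((b - a) + (d - c)).
Proof.
move=> hM.
have B1 y : c <= y <= d -> cabs (cint a b (fun x => F (x +i* y))) <= M * (b - a).
  by move=> hy; apply: cint_bound => // [|x hx]; [exact: ccont_hside|exact: hM].
have B2 x : a <= x <= b -> cabs (cint c d (fun y => F (x +i* y))) <= M * (d - c).
  by move=> hx; apply: cint_bound => // [|y hy]; [exact: ccont_vside|exact: hM].
have := B1 c; have := B1 d; have := B2 a; have := B2 b.
rewrite !lexx ab cd => /(_ isT) h1 /(_ isT) h2 /(_ isT) h3 /(_ isT) h4.
apply: le_trans (cabsD _ _) _; rewrite cabsM.
have -> : cabs ('i : R[i]) = 1 by rewrite cabsE expr0n /= add0r expr1n sqrtr1.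
rewrite mul1r; apply: le_trans (lerD (cabsB _ _) (cabsB _ _)) _.
lra.
Qed.

End Sides.

Lemma rintD a b c d F G : a <= b -> c <= d ->
  on_rect (ccontz F) a b c d -> on_rect (ccontz G) a b c d ->
  rint (fun z => F z + G z) a b c d = rint F a b c d + rint G a b c d.
Proof.
move=> ab cd hF hG; rewrite /rint.
rewrite !cintD; try by [apply: ccont_hside hF _ _; rewrite lexx ?cd
  |apply: ccont_hside hG _ _; rewrite lexx ?cd
  |apply: ccont_vside hF _ _; rewrite lexx ?ab
  |apply: ccont_vside hG _ _; rewrite lexx ?ab].
ring.
Qed.

(** On opposite sides the values of an affine function differ by a constant, so the four integrals
    pair off and cancel without recourse to a primitive. *)
Lemma rint_affine a b c d (p q : R[i]) : a <= b -> c <= d ->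
  rint (fun z => p + q * z) a b c d = 0.
Proof.
move=> ab cd.
have hF : on_rect (ccontz (fun z => p + q * z)) a b c d.
  move=> x y _ _; apply: cdiff_cont; apply: cdiffD; first exact: cdiff_cst.
  by apply: cdiffM; [exact: cdiff_cst|exact: cdiff_id].
rewrite /rint -!cintB; try by [apply: ccont_hside hF _ _; rewrite lexx ?cd
  |apply: ccont_vside hF _ _; rewrite lexx ?ab].
rewrite (@cint_eq _ _ _ _ (fun=> q * 'i * (c - d)%:C)); last first.
  move=> x _; rewrite opprD addrACA subrr add0r -mulrBr -mulrA; congr (_ * _).
  by apply/eqP; rewrite eq_complex /=; apply/andP; split; apply/eqP; ring.
rewrite [X in _ + _ * X](@cint_eq _ _ _ _ (fun=> q * (b - a)%:C)); last first.
  move=> x _; rewrite opprD addrACA subrr add0r -mulrBr; congr (_ * _).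
  by apply/eqP; rewrite eq_complex /=; apply/andP; split; apply/eqP; ring.
rewrite !cint_cst // -(opprB d c) rmorphN; ring.
Qed.

Lemma on_rect_cont a b c d F : on_rect (cdiff F) a b c d -> on_rect (ccontz F) a b c d.
Proof. by move=> h x y hx hy; apply: cdiff_cont; exact: h. Qed.

Lemma rint_quarter a b c d F : a <= b -> c <= d -> on_rect (ccontz F) a b c d ->
  exists a' c', [/\ a <= a', a' + (b - a) / 2 <= b, c <= c', c' + (d - c) / 2 <= d &
    cabs (rint F a b c d) <=
      4 * cabs (rint F a' (a' + (b - a) / 2) c' (c' + (d - c) / 2))].
Proof.
move=> ab cd hF; pose m := a + (b - a) / 2; pose n := c + (d - c) / 2.
have am : a <= m by rewrite /m; lra.
have mb : m <= b by rewrite /m; lra.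
have cn : c <= n by rewrite /n; lra.
have nd : n <= d by rewrite /n; lra.
have mE : m + (b - a) / 2 = b by rewrite /m; lra.
have nE : n + (d - c) / 2 = d by rewrite /n; lra.
have hS a' b' c' d' : a <= a' -> b' <= b -> c <= c' -> d' <= d ->
  on_rect (ccontz F) a' b' c' d' by move=> h1 h2 h3 h4; exact: on_rectS hF.
have e1 : rint F a b c d = rint F a m c d + rint F m b c d.
  by apply: rint_splith => //; rewrite am.
have e2 : rint F a m c d = rint F a m c n + rint F a m n d.
  by apply: rint_splitv => //; [exact: hS|rewrite cn].
have e3 : rint F m b c d = rint F m b c n + rint F m b n d.
  by apply: rint_splitv => //; [exact: hS|rewrite cn].
have H : cabs (rint F a b c d) <= cabs (rint F a m c n) + cabs (rint F a m n d) +
    (cabs (rint F m b c n) + cabs (rint F m b n d)).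
  rewrite e1 e2 e3; apply: le_trans (cabsD _ _) _.
  exact: lerD (cabsD _ _) (cabsD _ _).
move: H; set I := cabs (rint F a b c d); move: (cabs_ge0 (rint F a b c d)) => _ H.
have [h1|h1] := leP I (4 * cabs (rint F a m c n)); first by exists a, c; split.
have [h2|h2] := leP I (4 * cabs (rint F a m n d)).
  by exists a, n; split=> //; rewrite nE.
have [h3|h3] := leP I (4 * cabs (rint F m b c n)).
  by exists m, c; split=> //; rewrite mE.
have [h4|h4] := leP I (4 * cabs (rint F m b n d)).
  by exists m, n; split=> //; rewrite ?mE ?nE.
by exfalso; lra.
Qed.

Theorem goursat a b c d F : a <= b -> c <= d -> on_rect (cdiff F) a b c d ->
  rint F a b c d = 0.
Proof.
move=> ab cd dF; have cF := on_rect_cont dF.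
apply/eqP; rewrite -cabs_eq0; apply/negPn/negP => I0.
pose I := cabs (rint F a b c d); have {I0} Ip : 0 < I by rewrite lt_def I0 /I cabs_ge0.
pose w n := (b - a) / 2 ^+ n; pose h n := (d - c) / 2 ^+ n.
have p2 n : 0 < 2 ^+ n :> R by rewrite exprn_gt0.
have w0 n : 0 <= w n by rewrite divr_ge0 ?subr_ge0 // ltW.
have h0 n : 0 <= h n by rewrite divr_ge0 ?subr_ge0 // ltW.
have wS n : w n.+1 = w n / 2 by rewrite /w exprS invfM mulrA mulrAC.
have hS n : h n.+1 = h n / 2 by rewrite /h exprS invfM mulrA mulrAC.
pose good n (p : R * R) := [/\ a <= p.1, p.1 + w n <= b, c <= p.2, p.2 + h n <= d &
  I <= 4 ^+ n * cabs (rint F p.1 (p.1 + w n) p.2 (p.2 + h n))].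
(* The assumption [good] sits under the existential so that [choice] yields a total function; away
   from good corners any value will do. *)
have step : forall t : nat * (R * R), exists p, good t.1 t.2 ->
    [/\ good t.1.+1 p, t.2.1 <= p.1, p.1 + w t.1.+1 <= t.2.1 + w t.1,
        t.2.2 <= p.2 & p.2 + h t.1.+1 <= t.2.2 + h t.1].
  move=> [n p] /=; have [|] := pselect (good n p); last by move=> ng; exists p => /ng.
  move=> [g1 g2 g3 g4 g5].
  have aw : p.1 <= p.1 + w n by rewrite lerDl.
  have ch : p.2 <= p.2 + h n by rewrite lerDl.
  have e1 : p.1 + w n - p.1 = w n by rewrite addrC addKr.
  have e2 : p.2 + h n - p.2 = h n by rewrite addrC addKr.
  have [|a' [c' []]] := @rint_quarter _ _ _ _ F aw ch; first exact: on_rectS cF.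
  rewrite e1 e2.
  rewrite -wS -hS => q1 q2 q3 q4 q5; exists (a', c') => _; split=> //=.
  split=> /=; try by [exact: le_trans g1 q1|exact: le_trans q2 g2
    |exact: le_trans g3 q3|exact: le_trans q4 g4].
  rewrite exprSr -mulrA; apply: le_trans g5 _.
  by rewrite ler_wpM2l // exprn_ge0.
have [f hf] := choice step.
pose fix s n : R * R := if n is k.+1 then f (k, s k) else (a, c).
have wb : a + w 0%N = b by rewrite /w expr0 divr1 addrC subrK.
have hd : c + h 0%N = d by rewrite /h expr0 divr1 addrC subrK.
have gs n : good n (s n).
  elim: n => [|n IH]; last by have [] := hf (n, s n) IH.
  by split; rewrite /= ?wb ?hd ?expr0 ?mul1r; exact: lexx.
have mono n : [/\ (s n).1 <= (s n.+1).1, (s n.+1).1 + w n.+1 <= (s n).1 + w n,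
    (s n).2 <= (s n.+1).2 & (s n.+1).2 + h n.+1 <= (s n).2 + h n].
  by have [] := hf (n, s n) (gs n).
have limit (u v : nat -> R) : (forall n, 0 <= v n) -> (forall n, u n <= u n.+1) ->
    (forall n, u n.+1 + v n.+1 <= u n + v n) ->
    exists l, forall n, u n <= l <= u n + v n.
  move=> v0 um vm.
  have umm n k : u n <= u (k + n)%N.
    by elim: k => [|k IH]; rewrite ?add0n // addSn (le_trans IH).
  have vmm n k : u (k + n)%N + v (k + n)%N <= u n + v n.
    by elim: k => [|k IH]; rewrite ?add0n // addSn (le_trans (vm _)).
  have ub n m : u m <= u n + v n.
    have [nm|/ltnW mn] := leqP n m.
      by rewrite -(subnK nm) (le_trans _ (vmm n (m - n)%N)) // lerDl.
    by rewrite (le_trans _ (_ : u n <= _)) ?lerDl // -(subnK mn).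
  have hs : has_sup (range u).
    split; first by exists (u 0%N), 0%N.
    by exists (u 0%N + v 0%N) => _ [m _ <-].
  exists (sup (range u)) => n; apply/andP; split.
    by apply: ub_le_sup; [exact: hs.2|exists n].
  by apply: ge_sup => [|_ [m _ <-]//]; exact: hs.1.
have [x0 hx0] : exists l, forall n, (s n).1 <= l <= (s n).1 + w n.
  by apply: limit => // n; have [] := mono n.
have [y0 hy0] : exists l, forall n, (s n).2 <= l <= (s n).2 + h n.
  by apply: limit => // n; have [] := mono n.
have [q dq] : cdiff F (x0 +i* y0).
  apply: dF; first by have := hx0 0%N; have [_ ? _ _ _] := gs 0%N; rewrite /= in hx0 *; lra.
  by have := hy0 0%N; have [_ _ _ ? _] := gs 0%N; rewrite /= in hy0 *; lra.
pose L := (b - a) + (d - c).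
have L0 : 0 <= L by rewrite /L addr_ge0 ?subr_ge0.
(* With the tolerance [I / (4 * L ^+ 2 + 1)], the bound of [rint_bound] on the small rectangle
   multiplied by [4 ^+ n] is [2 * I * L ^+ 2 / (4 * L ^+ 2 + 1)], which is below [I]. *)
have K0 : 0 < 4 * L ^+ 2 + 1 by rewrite ltr_wpDl // mulr_ge0 // sqr_ge0.
have [dl dl0 hdl] := dq _ (divr_gt0 Ip K0).
have [n hn] : exists n, L / 2 ^+ n < dl.
  exists (Num.bound (L / dl)); have := @archi_boundP R (L / dl).
  rewrite divr_ge0 ?(ltW dl0) // => /(_ isT) h1.
  rewrite ltr_pdivrMr // mulrC -ltr_pdivrMr //.
  apply: lt_le_trans h1 _; rewrite -natrX ler_nat.
  by apply: ltnW; exact: ltn_expl.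
have [g1 g2 g3 g4 g5] := gs n.
have /andP[x1 x2] := hx0 n; have /andP[y1 y2] := hy0 n.
set p := s n in g1 g2 g3 g4 g5 x1 x2 y1 y2.
have aw : p.1 <= p.1 + w n by rewrite lerDl.
have ch : p.2 <= p.2 + h n by rewrite lerDl.
(* [A] is the tangent map of [F] at the common point of the nested rectangles. Its boundary integral
   vanishes, so only the remainder [G] counts. *)
pose z0 := x0 +i* y0; pose A z := F z0 - q * z0 + q * z.
pose G z := F z - A z.
have cA : on_rect (ccontz A) p.1 (p.1 + w n) p.2 (p.2 + h n).
  move=> x y _ _; apply: cdiff_cont; apply: cdiffD; first exact: cdiff_cst.
  by apply: cdiffM; [exact: cdiff_cst|exact: cdiff_id].
have cG : on_rect (ccontz G) p.1 (p.1 + w n) p.2 (p.2 + h n).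
  have dF' : on_rect (cdiff F) p.1 (p.1 + w n) p.2 (p.2 + h n) by exact: on_rectS dF.
  move=> x y hx hy; apply: cdiff_cont.
  apply: (@cdiff_ext _ (fun z => F z + (-1) * A z)).
    by move=> z; rewrite /G mulN1r.
  apply: cdiffD; first exact: dF'.
  apply: cdiffM; first exact: cdiff_cst.
  apply: cdiffD; first exact: cdiff_cst.
  by apply: cdiffM; [exact: cdiff_cst|exact: cdiff_id].
have FE : rint F p.1 (p.1 + w n) p.2 (p.2 + h n) = rint G p.1 (p.1 + w n) p.2 (p.2 + h n).
  rewrite -[RHS]addr0 -(rint_affine (F z0 - q * z0) q aw ch) -rintD //.
  have -> : (fun z => G z + (F z0 - q * z0 + q * z)) = F by apply/funext => z; exact: subrK.
  by [].
pose eps := I / (4 * L ^+ 2 + 1).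
have Ln : w n + h n = L / 2 ^+ n by rewrite /w /h /L -mulrDl.
have GB : on_rect (fun z => cabs (G z) <= eps * (L / 2 ^+ n)) p.1 (p.1 + w n) p.2 (p.2 + h n).
  move=> x y hx hy; pose k := (x +i* y) - z0.
  have kL : cabs k <= L / 2 ^+ n.
    apply: le_trans (cabs_ReIm _) _; rewrite -Ln /k /z0 /=.
    by apply: lerD; rewrite ler_norml; apply/andP; split; lra.
  have -> : G (x +i* y) = F (z0 + k) - F z0 - q * k.
    by rewrite /k [z0 + _]addrC subrK /G /A; ring.
  apply: le_trans (hdl k (le_lt_trans kL hn)) _.
  by rewrite ler_wpM2l // divr_ge0 // ltW.
have := rint_bound aw ch cG GB.
have ew : p.1 + w n - p.1 = w n by rewrite addrC addKr.
have eh : p.2 + h n - p.2 = h n by rewrite addrC addKr.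
rewrite -FE ew eh Ln => B.
have fieldE (u l t : R) : t != 0 -> t * t * (2 * (u * (l / t)) * (l / t)) = 2 * u * l ^+ 2.
  by move=> t0; field.
have B2 : 4 ^+ n * cabs (rint F p.1 (p.1 + w n) p.2 (p.2 + h n)) <= 2 * eps * L ^+ 2.
  apply: le_trans (ler_wpM2l _ B) _; first by rewrite exprn_ge0.
  have -> : 4 ^+ n = 2 ^+ n * 2 ^+ n :> R by rewrite -exprMn -natrM.
  by rewrite fieldE // gt_eqF.
have := le_trans g5 B2; rewrite leNgt => /negP; apply.
have -> : 2 * eps * L ^+ 2 = 2 * I * L ^+ 2 / (4 * L ^+ 2 + 1) by rewrite /eps; ring.
rewrite ltr_pdivrMr //; have := mulr_ge0 (ltW Ip) (sqr_ge0 L).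
by move: Ip; clearbody I L; move=> Ip LI; lra.
Qed.

End Goursat.

(** * Means of almost periodic functions *)

Section Limits.
Variable R : realType.
Implicit Types (u v : nat -> R[i]) (l : R[i]).
Local Open Scope complex_scope.

Definition cvgC u l := forall eps : R, 0 < eps ->
  exists n0 : nat, forall n : nat, (n0 <= n)%N -> cabs (u n - l) <= eps.

Definition cauchyC u := forall eps : R, 0 < eps ->
  exists n0 : nat, forall n m : nat, (n0 <= n)%N -> (n0 <= m)%N -> cabs (u n - u m) <= eps.

Lemma real_cauchy (u : nat -> R) : (forall eps : R, 0 < eps ->
    exists n0 : nat, forall n m : nat, (n0 <= n)%N -> (n0 <= m)%N -> `|u n - u m| <= eps) ->
  exists l : R, forall eps : R, 0 < eps ->
    exists n0 : nat, forall n : nat, (n0 <= n)%N -> `|u n - l| <= eps.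
Proof.
move=> h; have cu : cvgn u.
  apply/cauchy_cvgP; apply: cauchy_exP => eps eps0.
  have e2 : 0 < eps / 2 by rewrite divr_gt0.
  have [n0 hn] := h _ e2; exists (u n0); exists n0 => // n /= n0n.
  rewrite /ball /=; apply: le_lt_trans (hn _ _ (leqnn _) n0n) _.
  by rewrite ltr_pdivrMr // ltr_pMr // ltr1n.
exists (limn u) => eps eps0.
have /cvgrPdist_le/(_ _ eps0)[n0 _ hn] : u @ \oo --> limn u by [].
by exists n0 => n n0n; rewrite distrC; exact: hn.
Qed.

Lemma cauchyC_cvg u : cauchyC u -> exists l, cvgC u l.
Proof.
move=> h.
have [x hx] : exists l : R, forall eps : R, 0 < eps ->
    exists n0 : nat, forall n : nat, (n0 <= n)%N -> `|complex.Re (u n) - l| <= eps.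
  apply: real_cauchy => eps /h[n0 hn]; exists n0 => n m hn1 hm1.
  apply: le_trans (hn n m hn1 hm1); move: (Re_cabs (u n - u m)).
  by case: (u n) (u m) => [a b] [a' b'].
have [y hy] : exists l : R, forall eps : R, 0 < eps ->
    exists n0 : nat, forall n : nat, (n0 <= n)%N -> `|complex.Im (u n) - l| <= eps.
  apply: real_cauchy => eps /h[n0 hn]; exists n0 => n m hn1 hm1.
  apply: le_trans (hn n m hn1 hm1); move: (Im_cabs (u n - u m)).
  by case: (u n) (u m) => [a b] [a' b'].
exists (x +i* y) => eps eps0; have e2 : 0 < eps / 2 by rewrite divr_gt0.
have [n1 h1] := hx _ e2; have [n2 h2] := hy _ e2; exists (maxn n1 n2) => n.
rewrite geq_max => /andP[/h1 H1 /h2 H2]; apply: le_trans (cabs_ReIm _) _.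
rewrite [eps]splitr; move: H1 H2; case: (u n) => a b /= H1 H2.
exact: lerD.
Qed.

Lemma cvgC_le u l (c : R[i]) (M : R) n0 : cvgC u l ->
  (forall n, (n0 <= n)%N -> cabs (u n - c) <= M) -> cabs (l - c) <= M.
Proof.
move=> h hM; apply/ler_addgt0Pr => eps eps0; have [n1 hn] := h _ eps0.
have H1 := hn _ (leq_maxl n1 n0); have H2 := hM _ (leq_maxr n1 n0).
have -> : l - c = (u (maxn n1 n0) - c) - (u (maxn n1 n0) - l) by ring.
by apply: le_trans (cabsB _ _) _; exact: lerD.
Qed.

Lemma cvgC_uniq u l l' : cvgC u l -> cvgC u l' -> l = l'.
Proof.
move=> h h'; apply/eqP; rewrite -subr_eq0 -cabs_eq0 eq_le cabs_ge0 andbT.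
apply/ler_addgt0Pr => eps eps0; rewrite add0r.
by have [n0 hn] := h' _ eps0; apply: cvgC_le h hn.
Qed.

Lemma cvgC_cst l : cvgC (fun=> l) l.
Proof. by move=> eps e0; exists 0%N => n _; rewrite subrr cabs0 ltW. Qed.

Lemma cvgCD u v l k : cvgC u l -> cvgC v k -> cvgC (fun n => u n + v n) (l + k).
Proof.
move=> hu hv eps e0; have e2 : 0 < eps / 2 by rewrite divr_gt0.
have [n1 h1] := hu _ e2; have [n2 h2] := hv _ e2; exists (maxn n1 n2) => n.
rewrite geq_max => /andP[/h1 H1 /h2 H2]; rewrite opprD addrACA [eps]splitr.
by apply: le_trans (cabsD _ _) _; exact: lerD.
Qed.

Lemma cvgCM u v l k : cvgC u l -> cvgC v k -> cvgC (fun n => u n * v n) (l * k).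
Proof.
move=> hu hv eps e0.
pose K := cabs l + cabs k + 1.
have K0 : 0 < K by rewrite /K ltr_wpDl // addr_ge0.
have [n1 h1] := hu _ (divr_gt0 e0 K0); have [n2 h2] := hv _ (divr_gt0 e0 K0).
have [n3 h3] := hu _ ltr01.
exists (maxn n1 (maxn n2 n3)) => n.
rewrite !geq_max => /and3P[/h1 H1 /h2 H2 /h3 H3].
have -> : u n * v n - l * k = u n * (v n - k) + (u n - l) * k by ring.
have H4 : cabs (u n) <= cabs l + 1.
  by rewrite -[u n](subrK l) (le_trans (cabsD _ _)) // addrC lerD2l.
apply: le_trans (cabsD _ _) _; rewrite !cabsM.
apply: (@le_trans _ _ ((cabs l + 1) * (eps / K) + eps / K * cabs k)).
  by apply: lerD; [exact: ler_pM|exact: ler_wpM2r].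
have -> : (cabs l + 1) * (eps / K) + eps / K * cabs k =
  eps / K * (cabs l + cabs k + 1) by ring.
by rewrite -/K divfK ?gt_eqF.
Qed.

End Limits.

Section Means.
Variable R : realType.
Implicit Types (f g : R -> R[i]) (a b c d x y K : R) (m : R[i]).
Local Open Scope complex_scope.

Definition cmean f m := forall eps : R, 0 < eps -> exists2 T0 : R, 0 < T0 &
  forall T, T0 <= T -> cabs (((2 * T)^-1)%:C * cint (- T) T f - m) <= eps.

(** [bohr_mean] is built on [lim], which has a value even without convergence. Means are therefore
    computed through [cmean] and transferred here; this also makes them unique. *)
Lemma cmean_bohr f m : cmean f m -> bohr_mean f = m.
Proof.
move=> h; have real_meanE (u : R -> R) l : (forall eps : R, 0 < eps ->
    exists2 T0 : R, 0 < T0 & forall T, T0 <= T ->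
      `|(2 * T)^-1 * \int[@lebesgue_measure R]_(t in `[- T, T]) u t - l| <= eps) ->
    real_mean u = l.
  move=> hu; apply/cvg_lim => //; apply/cvgrPdist_le => eps e0.
  have [T0 T00 hT] := hu _ e0; near=> T; rewrite distrC; apply: hT.
  by near: T; apply: nbhs_pinfty_ge; rewrite num_real.
rewrite /bohr_mean; case: m h => p q h; congr (_ +i* _); apply: real_meanE => eps /h;
  move=> [T0 T00 hT]; exists T0 => // T /hT; apply: le_trans.
- move: (Re_cabs (((2 * T)^-1)%:C * cint (- T) T f - (p +i* q))).
  by rewrite /= mul0r subr0.
- move: (Im_cabs (((2 * T)^-1)%:C * cint (- T) T f - (p +i* q))).
  by rewrite /= mul0r addr0.
Unshelve. all: by end_near.
Qed.

Lemma cmean_bound f m K : ccont setT f -> (forall x, cabs (f x) <= K) ->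
  cmean f m -> cabs m <= K.
Proof.
move=> cf fK h; apply/ler_addgt0Pr => eps eps0; have [T T0 hT] := h _ eps0.
have := hT T (lexx _); set I := _ * _ => H.
have HI : cabs I <= K.
  rewrite /I cabsM cabsR ger0_norm ?invr_ge0 ?mulr_ge0 // ?(ltW T0) //.
  rewrite mulrC ler_pdivrMr ?mulr_gt0 //.
  have -> : K * (2 * T) = K * (T - - T) by ring.
  apply: cint_bound => //; first by lra.
  by apply: ccontS cf.
have -> : m = I - (I - m) by ring.
by apply: le_trans (cabsB _ _) _; exact: lerD.
Qed.

Lemma cmean_approx f m : ccont setT f -> (forall eps : R, 0 < eps -> exists g m',
    [/\ ccont setT g, forall x, cabs (f x - g x) <= eps, cmean g m' &
      cabs (m' - m) <= eps]) -> cmean f m.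
Proof.
move=> cf h eps eps0; have e3 : 0 < eps / 3 by rewrite divr_gt0.
have [g [m' [cg fg hg mm]]] := h _ e3; have [T0 T00 hT] := hg _ e3.
exists T0 => // T /[dup] T0T /hT H; have T_0 : 0 < T by exact: lt_le_trans T0T.
have cS k : ccont setT k -> ccont `[- T, T] k by apply: ccontS.
have H2 : cabs (((2 * T)^-1)%:C * cint (- T) T f - ((2 * T)^-1)%:C * cint (- T) T g)
    <= eps / 3.
  rewrite -mulrBr -cintB; [|exact: cS|exact: cS].
  rewrite cabsM cabsR ger0_norm ?invr_ge0 ?mulr_ge0 // ?(ltW T_0) //.
  rewrite mulrC ler_pdivrMr ?mulr_gt0 //.
  have -> : eps / 3 * (2 * T) = eps / 3 * (T - - T) by ring.
  by apply: cint_bound => //; [lra|exact: cS (ccontB cf cg)].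
move: H H2 mm; set I := _ * cint _ _ f; set J := _ * cint _ _ g => H H2 mm.
have -> : I - m = (I - J) + (J - m') + (m' - m) by ring.
apply: le_trans (cabsD _ _) _.
have := cabsD (I - J) (J - m'); lra.
Qed.

Lemma cmeanD f g m m' : ccont setT f -> ccont setT g ->
  cmean f m -> cmean g m' -> cmean (fun x => f x + g x) (m + m').
Proof.
move=> cf cg hf hg eps e0; have e2 : 0 < eps / 2 by rewrite divr_gt0.
have [T1 T10 h1] := hf _ e2; have [T2 T20 h2] := hg _ e2.
exists (Num.max T1 T2); first by rewrite lt_max T10.
move=> T; rewrite ge_max => /andP[/h1 H1 /h2 H2].
rewrite cintD; [|by apply: ccontS cf|by apply: ccontS cg].
rewrite mulrDr opprD addrACA [eps]splitr.
by apply: le_trans (cabsD _ _) _; exact: lerD.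
Qed.

Lemma cmeanZ f m (k : R[i]) : ccont setT f -> cmean f m ->
  cmean (fun x => k * f x) (k * m).
Proof.
move=> cf hf eps e0; have K0 : 0 < cabs k + 1 by rewrite ltr_wpDl.
have [T0 T00 hT] := hf _ (divr_gt0 e0 K0); exists T0 => // T /hT H.
rewrite cintZ; last by apply: ccontS cf.
rewrite mulrCA -mulrBr cabsM.
apply: le_trans (ler_wpM2l (cabs_ge0 k) H) _.
rewrite mulrA ler_pdivrMr // mulrC ler_wpM2l ?(ltW e0) //.
by rewrite lerDl.
Qed.

Lemma cmean_ext f g m : f =1 g -> cmean f m -> cmean g m.
Proof. by move=> /funext ->. Qed.

Lemma cmean_cst m : cmean (fun=> m) m.
Proof.
move=> eps e0; exists 1 => // T T1; have T0 : 0 < T by exact: lt_le_trans T1.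
rewrite cint_cst; last by lra.
rewrite mulrCA -rmorphM.
have -> : (2 * T)^-1 * (T - - T) = 1 by field; rewrite gt_eqF.
by rewrite mulr1 subrr cabs0 ltW.
Qed.

Lemma cmean_sum (I : Type) (r : seq I) (F : I -> R -> R[i]) (mm : I -> R[i]) :
  (forall i, ccont setT (F i)) -> (forall i, cmean (F i) (mm i)) ->
  cmean (fun x => \sum_(i <- r) F i x) (\sum_(i <- r) mm i).
Proof.
move=> cF hF; elim: r => [|i r IH].
  rewrite big_nil; apply: cmean_ext (cmean_cst 0) => x.
  by rewrite big_nil.
rewrite big_cons; apply: cmean_ext (cmeanD (cF i) _ (hF i) IH).
  by move=> x; rewrite big_cons.
exact: ccont_sum.
Qed.

Lemma expR_small (k eta : R) : 0 < k -> 0 < eta ->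
  exists2 Y : R, 0 < Y & expR (- (k * Y)) <= eta.
Proof.
move=> k0 e0; exists ((k * eta)^-1); first by rewrite invr_gt0 mulr_gt0.
rewrite expRN invfM mulrA divff ?gt_eqF // mul1r.
rewrite invf_ple ?posrE ?expR_gt0 //.
by apply: le_trans (expR_ge1Dx _); rewrite lerDr.
Qed.

(** Cauchy's theorem moves the integral to the opposite horizontal side, where the integrand is
    small. The vertical sides cost a term independent of the width [b - a], which disappears after
    division by the width in a mean. *)
Lemma side_bound a b c d (F : R[i] -> R[i]) (M eta : R) : a <= b -> c <= d ->
  on_rect (cdiff F) a b c d -> on_rect (fun z => cabs (F z) <= M) a b c d ->
  ((forall x, a <= x <= b -> cabs (F (x +i* d)) <= eta) ->
    cabs (cint a b (fun x => F (x +i* c))) <= eta * (b - a) + 2 * M * (d - c)) /\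
  ((forall x, a <= x <= b -> cabs (F (x +i* c)) <= eta) ->
    cabs (cint a b (fun x => F (x +i* d))) <= eta * (b - a) + 2 * M * (d - c)).
Proof.
move=> ab cd dF FM; have := goursat ab cd dF; rewrite /rint.
have cF := on_rect_cont dF.
have V x : a <= x <= b -> cabs (cint c d (fun y => F (x +i* y))) <= M * (d - c).
  by move=> hx; apply: cint_bound => // [|y hy]; [exact: ccont_vside cF _ hx|exact: FM].
have := V a; have := V b; rewrite !lexx ab => /(_ isT) + /(_ isT).
set Ib := cint c d _; set Ia := cint c d _; set Jc := cint a b _; set Jd := cint a b _.
move=> hb ha H.
have i1 : cabs ('i : R[i]) = 1 by rewrite cabsE expr0n /= add0r expr1n sqrtr1.
have S : cabs ('i * (Ib - Ia)) <= 2 * M * (d - c).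
  by rewrite cabsM i1 mul1r; apply: le_trans (cabsB _ _) _; lra.
split=> hM.
  have -> : Jc = Jd - 'i * (Ib - Ia).
    by apply/eqP; rewrite -subr_eq0; apply/eqP; rewrite -H; ring.
  apply: le_trans (cabsB _ _) _; apply: lerD => //.
  by apply: cint_bound => //; apply: ccont_hside cF _ _; rewrite lexx cd.
have -> : Jd = Jc + 'i * (Ib - Ia).
  by apply/esym/eqP; rewrite -subr_eq0; apply/eqP; rewrite -H; ring.
apply: le_trans (cabsD _ _) _; apply: lerD => //.
by apply: cint_bound => //; apply: ccont_hside cF _ _; rewrite lexx cd.
Qed.

(** For [a != 0] the line of integration is moved into the half-plane where [E a] decays; the
    functions of the Hardy classes are treated in the same way below. *)
Lemma cmean_e a : cmean (e a) (if a == 0 then 1 else 0).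
Proof.
case: (eqVneq a 0) => [->|a0].
  by apply: cmean_ext (cmean_cst 1) => x; rewrite e0.
move=> eps eps0; have ap : 0 < `|a| by rewrite normr_gt0.
have e2 : 0 < eps / 2 by rewrite divr_gt0.
have [Y Y0 hY] := expR_small ap e2.
exists (2 * Y / eps); first by rewrite divr_gt0 // mulr_gt0.
move=> T hT; have T0 : 0 < T by apply: lt_le_trans hT; rewrite divr_gt0 // mulr_gt0.
have TT : - T <= T by lra.
have dE c d : on_rect (cdiff (E a)) (- T) T c d by move=> x y _ _; exact: cdiff_E.
have H : cabs (cint (- T) T (e a)) <= eps / 2 * (T - - T) + 2 * 1 * (Y - 0).
  have -> : e a = fun x => E a (x +i* 0) by apply/funext => x; rewrite -E_real.
  case: (ltgtP a 0) a0 => // aneg _.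
    have /(_ (- Y) 0 1 (eps / 2) TT) := @side_bound (- T) T _ _ (E a).
    have -> : Y - 0 = 0 - - Y by ring.
    case=> //; first by lra.
      move=> x y _ /andP[y1 y2]; rewrite cabs_E /= -expR0 ler_expR; nra.
    move=> _; apply => x _; rewrite cabs_E /=; apply: le_trans hY.
    by rewrite ltr0_norm // ler_expR; lra.
  have /(_ 0 Y 1 (eps / 2) TT) := @side_bound (- T) T _ _ (E a).
  case=> //; first by lra.
    move=> x y _ /andP[y1 y2]; rewrite cabs_E /= -expR0 ler_expR; nra.
  move=> + _; apply => x _; rewrite cabs_E /=; apply: le_trans hY.
  by rewrite gtr0_norm // ler_expR; lra.
rewrite subr0 cabsM cabsR ger0_norm ?invr_ge0 ?mulr_ge0 // ?(ltW T0) //.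
rewrite mulrC ler_pdivrMr ?mulr_gt0 //; apply: le_trans H _.
have : 2 * Y <= T * eps by rewrite -ler_pdivrMr.
nra.
Qed.

End Means.

Section Coefficients.
Variable R : realType.
Implicit Types (z : R[i]) (a b x y M : R) (s r : seq (R[i] * R)) (L : seq R).
Implicit Types (S : pred R) (w : R -> R) (P Q : R[i] -> R[i]).
Local Open Scope complex_scope.

Definition coefl s a : R[i] := \sum_(t <- s | t.2 == a) t.1.

Lemma cmean_uniq (f : R -> R[i]) m m' : cmean f m -> cmean f m' -> m = m'.
Proof. by move=> /cmean_bohr <- /cmean_bohr. Qed.

Lemma ccont_ev (A : set R) s : ccont A (fun x => ev s x%:C).
Proof.
rewrite /ev; apply: ccont_sum => t; apply: ccontZ.
rewrite (_ : (fun x => _) = e t.2); first exact: ccont_e.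
by apply/funext => x; rewrite E_real.
Qed.

Lemma cmean_ev s a : cmean (fun x => e (- a) x * ev s x%:C) (coefl s a).
Proof.
have -> : coefl s a = \sum_(t <- s) t.1 * (if t.2 - a == 0 then 1 else 0).
  rewrite /coefl big_mkcond; apply: eq_bigr => t _; rewrite subr_eq0.
  by case: eqP; rewrite ?mulr1 ?mulr0.
have h t : ccont setT (fun x => t.1 * e (t.2 - a) x).
  by apply: ccontZ; exact: ccont_e.
apply: cmean_ext (cmean_sum s h _) => [x|t]; last first.
  by apply: cmeanZ; [exact: ccont_e|exact: cmean_e].
rewrite /ev mulr_sumr; apply: eq_bigr => t _.
by rewrite e_add E_real; ring.
Qed.

(** Coefficients are means of the function on the real line, so they do not see the list that
    represents it. *)
Lemma coefl_eq s r : (forall x, ev s x%:C = ev r x%:C) -> coefl s =1 coefl r.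
Proof.
move=> h a; apply: cmean_uniq (cmean_ev s a) _.
by apply: cmean_ext (cmean_ev r a) => x; rewrite h.
Qed.

Lemma big_coefl (V : nmodType) L s (F : R[i] * R -> V) : uniq L ->
  all (fun t => t.2 \in L) s ->
  \sum_(t <- s) F t = \sum_(a <- L) \sum_(t <- s | t.2 == a) F t.
Proof.
move=> uL /allP hs.
rewrite (exchange_big_dep xpredT) //= [LHS]big_seq [RHS]big_seq.
apply: eq_bigr => t /hs tL.
rewrite (eq_bigl (fun a => a == t.2)); last by move=> a; rewrite eq_sym.
rewrite big_mkcond (bigD1_seq t.2) //= eqxx big1 ?addr0 // => a /negPf ->.
by [].
Qed.

Lemma ev_coefl L s z : uniq L -> all (fun t => t.2 \in L) s ->
  ev s z = \sum_(a <- L) coefl s a * E a z.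
Proof.
move=> uL hs; rewrite /ev (big_coefl _ uL hs); apply: eq_bigr => a _.
by rewrite /coefl mulr_suml; apply: eq_bigr => t /eqP ->.
Qed.

Lemma coefl_filter S s a : coefl [seq t <- s | S t.2] a = if S a then coefl s a else 0.
Proof.
rewrite /coefl big_filter_cond; case: ifP => Sa.
  by apply: eq_bigl => t; case: eqP => [->|]; rewrite ?Sa ?andbF.
by rewrite big_pred0 // => t; case: eqP => [->|]; rewrite ?Sa ?andbF.
Qed.

(** Makes the restriction to frequencies in [S] an operation on functions: once both lists are
    regrouped over a common set of frequencies, only the coefficients matter. *)
Lemma ev_filter S s r : (forall x, ev s x%:C = ev r x%:C) ->
  ev [seq t <- s | S t.2] =1 ev [seq t <- r | S t.2].
Proof.
move=> h z; pose L := undup (map snd (s ++ r)).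
have uL : uniq L by exact: undup_uniq.
have inL t : t \in s ++ r -> t.2 \in L by move=> ht; rewrite mem_undup map_f.
have hs : all (fun t => t.2 \in L) [seq t <- s | S t.2].
  apply/allP => t; rewrite mem_filter => /andP[_ ts].
  by apply: inL; rewrite mem_cat ts.
have hr : all (fun t => t.2 \in L) [seq t <- r | S t.2].
  apply/allP => t; rewrite mem_filter => /andP[_ ts].
  by apply: inL; rewrite mem_cat ts orbT.
rewrite (ev_coefl _ uL hs) (ev_coefl _ uL hr); apply: eq_bigr => a _.
by rewrite !coefl_filter (coefl_eq h).
Qed.

Lemma wn_filter S w s : (forall a, 0 <= w a) -> wn w [seq t <- s | S t.2] <= wn w s.
Proof.
move=> w0; rewrite /wn big_filter big_mkcond ler_sum // => t _.
by case: ifP => // _; rewrite mulr_ge0.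
Qed.

Lemma filter_all_freq S s : all (fun t => S t.2) s -> [seq t <- s | S t.2] = s.
Proof. by move=> /all_filterP. Qed.

(** By [ev_filter], discarding from the first list the frequencies outside [S'] does not change the
    function, because the second list has none; and discarding terms cannot raise the norm. *)
Lemma ep_cap S S' w w' M M' P : (forall a, 0 <= w a) ->
  ep S w M P -> ep S' w' M' P -> ep S' w M P.
Proof.
move=> w0 [s [h1 h2 h3]] [r [k1 k2 k3]].
exists [seq t <- s | S' t.2]; split.
- exact: filter_all.
- exact: le_trans (wn_filter _ _ w0) h2.
- move=> z; rewrite k3 -{1}(filter_all_freq k1).
  by apply: ev_filter => x; rewrite -k3 h3.
Qed.

Lemma ep_split S w M P : (forall a, 0 <= w a) -> ep predT w M P -> exists P1 P2,
  [/\ ep S w M P1, ep (predC S) w M P2 & forall z, P z = P1 z + P2 z].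
Proof.
move=> w0 [s [h1 h2 h3]].
exists (ev [seq t <- s | S t.2]), (ev [seq t <- s | predC S t.2]); split.
- by apply: ep_le (ep_ev _ (filter_all _ _)); exact: le_trans (wn_filter _ _ w0) h2.
- by apply: ep_le (ep_ev _ (filter_all _ _)); exact: le_trans (wn_filter (predC S) _ w0) h2.
- move=> z; rewrite h3 /ev !big_filter /= (bigID (fun t => S t.2)) /=.
  by [].
Qed.

Lemma wn_coefl L s w : uniq L -> (forall a, 0 <= w a) ->
  \sum_(a <- L) cabs (coefl s a) * w a <= wn w s.
Proof.
move=> uL w0; pose L' := undup (L ++ map snd s).
have hs : all (fun t => t.2 \in L') s.
  by apply/allP => t ts; rewrite mem_undup mem_cat map_f ?orbT.
have uL' : uniq L' by exact: undup_uniq.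
apply: (@le_trans _ _ (\sum_(a <- L') cabs (coefl s a) * w a)).
  have hp : perm_eq L' (L ++ [seq a <- L' | a \notin L]).
    apply: uniq_perm => //.
      rewrite cat_uniq uL filter_uniq // andbT /=.
      by apply/hasPn => a; rewrite mem_filter => /andP[].
    move=> a; rewrite mem_cat mem_filter /L' mem_undup mem_cat.
    by case: (a \in L).
  rewrite (perm_big _ hp) big_cat /= lerDl sumr_ge0 // => a _.
  by rewrite mulr_ge0.
rewrite /wn (big_coefl _ uL' hs) ler_sum // => a _.
rewrite /coefl; apply: le_trans (ler_wpM2r (w0 a) (cabs_sum _ _ _)) _.
by rewrite mulr_suml ler_sum // => t /eqP ->.
Qed.

(** On the line of height [y] the sum is again an exponential sum in [x], whose coefficients are
    rescaled by [expR (- a * y)] and are means, hence bounded by the supremum. *)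
Lemma coefl_bound s y a M : (forall x, cabs (ev s (x +i* y)) <= M) ->
  cabs (coefl s a) * expR (- a * y) <= M.
Proof.
move=> hM; pose s' := [seq (t.1 * (expR (- t.2 * y))%:C, t.2) | t <- s].
have evE x : ev s (x +i* y) = ev s' x%:C.
  rewrite /ev big_map; apply: eq_bigr => t _; rewrite -mulrA; congr (_ * _).
  by rewrite /E /= mulr0 expR0 mul1r.
have cE : coefl s' a = coefl s a * (expR (- a * y))%:C.
  by rewrite /coefl big_map mulr_suml; apply: eq_bigr => t /= /eqP ->.
have := cmean_ev s' a; move/(cmean_bound _ _) => H.
have : cabs (coefl s' a) <= M.
  apply: H => [|x]; first by apply: ccontM; [exact: ccont_e|exact: ccont_ev].
  by rewrite cabsM cabs_e mul1r -evE.
by rewrite cE cabsM cabsR ger0_norm // expR_ge0.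
Qed.

(** The integer combinations of the frequencies with each multiplicity at most [k]. This box
    contains the frequencies of a [k]-th power, and its size is polynomial in [k], which is all that
    an argument of spectral radius type requires. *)
Fixpoint multiples L k : seq R :=
  if L is a :: L' then [seq a *+ j + b | j <- iota 0 k.+1, b <- multiples L' k]
  else [:: 0].

Lemma multiples_cons a L k : multiples (a :: L) k =
  [seq a *+ j + b | j <- iota 0 k.+1, b <- multiples L k].
Proof. by []. Qed.

Lemma size_multiples L k : size (multiples L k) = (k.+1 ^ size L)%N.
Proof.
elim: L => [|a L IH]; first by [].
by rewrite multiples_cons size_allpairs IH size_iota -expnS.
Qed.

Lemma multiplesS L k b : b \in multiples L k -> b \in multiples L k.+1.
Proof.
elim: L b => [|a L IH] b; first by [].
rewrite !multiples_cons => /allpairsP[[j c] [hj hc ->]].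
apply/allpairsP; exists (j, c); split; [|exact: IH|by []].
by move: hj; rewrite !mem_iota !add0n /= => /ltn_trans; apply.
Qed.

Lemma multiples_add L k b a : b \in multiples L k -> a \in L -> b + a \in multiples L k.+1.
Proof.
elim: L b => [|c L IH] b; first by [].
rewrite !multiples_cons => /allpairsP[[j d] [hj hd ->]].
rewrite inE => /orP[/eqP -> | aL]; apply/allpairsP.
  exists (j.+1, d); split; last by rewrite /= mulrS addrAC [c + _]addrC.
    by move: hj; rewrite !mem_iota !add0n /= ltnS.
  exact: multiplesS.
exists (j, d + a); split; last by rewrite /= addrA.
  by move: hj; rewrite !mem_iota !add0n /= => /ltn_trans; apply.
exact: IH.
Qed.

Lemma ev_pow_freq s k : exists2 r, all (fun t => t.2 \in multiples (map snd s) k) r &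
  forall z, ev s z ^+ k = ev r z.
Proof.
elim: k => [|k [r hr hk]].
  exists [:: (1, 0)] => [|z]; last by rewrite /ev big_seq1 E0 mulr1.
  rewrite /all andbT [snd _]/=; elim: (map snd s) => [|a L IH]; first by rewrite inE.
  by rewrite multiples_cons; apply/allpairsP; exists (0%N, 0); split; rewrite //= mulr0n addr0.
exists [seq (t.1 * u.1, t.2 + u.2) | t <- r, u <- s].
  apply/allP => _ /allpairsP[[t u] /= [tr us ->]] /=.
  by apply: multiples_add; [move/allP: hr; apply|exact: map_f].
move=> z; rewrite exprSr hk /ev big_allpairs_dep /= mulr_suml.
apply: eq_bigr => t _; rewrite mulr_sumr; apply: eq_bigr => u _.
by rewrite E_add mulrACA.
Qed.

(* [P ^+ k] has at most [(k+1)^d] frequencies and its coefficients are bounded by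
   its supremum, so its norm grows essentially like the power of the supremum. *)
Lemma ep_pow_sup y M P rho : ep predT (sw y y) M P ->
  (forall x, cabs (P (x +i* y)) <= rho) -> exists d, forall k,
  ep predT (sw y y) ((k.+1 ^ d)%:R * rho ^+ k) (fun z => P z ^+ k).
Proof.
move=> [s [_ _ hs]] hrho; exists (size s) => k.
have [r hr hk] := ev_pow_freq s k.
pose L := undup (multiples (map snd s) k).
have hr' : all (fun t => t.2 \in L) r.
  by apply/allP => t /(allP hr); rewrite mem_undup.
have rho0 : 0 <= rho by apply: le_trans (hrho 0).
exists [seq (coefl r a, a) | a <- L]; split; first by apply/allP.
- rewrite /wn big_map /=.
  apply: (@le_trans _ _ (\sum_(a <- L) rho ^+ k)).
    apply: ler_sum => a _; rewrite /sw maxxx; apply: coefl_bound => x.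
    by rewrite -hk -hs cabsX lerXn2r ?nnegrE.
  rewrite big_const_seq count_predT iter_addr_0 -[_ *+ size L]mulr_natl.
  rewrite ler_wpM2r ?exprn_ge0 // ler_nat (leq_trans (size_undup _)) //.
  by rewrite size_multiples size_map.
- move=> z; rewrite hs hk (ev_coefl _ (undup_uniq _) hr').
  by rewrite /ev big_map.
Qed.

End Coefficients.

Section AlmostPeriodicTheory.
Variable R : realType.
Implicit Types (f g : R -> R[i]) (a b x y : R).
Local Open Scope complex_scope.

Lemma trig_poly_ev f : trig_poly f -> exists s, forall x, f x = ev s x%:C.
Proof.
move=> [n [c [a ->]]]; exists [seq (c k, a k) | k <- index_enum 'I_n] => x.
by rewrite /ev big_map; apply: eq_bigr => k _; rewrite E_real.
Qed.

Lemma ev_trig_poly s : trig_poly (fun x : R => ev s x%:C).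
Proof.
exists (size s), (fun k => (nth (0, 0) s k).1), (fun k => (nth (0, 0) s k).2).
apply/funext => x; rewrite /ev (big_nth (0, 0)) big_mkord.
by apply: eq_bigr => k _; rewrite E_real.
Qed.

Lemma AP_ev f (eps : R) : AP f -> 0 < eps ->
  exists s, forall x, cabs (f x - ev s x%:C) <= eps.
Proof.
move=> hf /hf[p /trig_poly_ev[s hs] hp]; exists s => x.
by rewrite -hs.
Qed.

Lemma AP_cont f : AP f -> ccont setT f.
Proof.
move=> hf; apply: ccont_unif => eps /(AP_ev hf)[s hs].
by exists (fun x => ev s x%:C) => [|x _]; [exact: ccont_ev|exact: hs].
Qed.

Lemma ev_real_bound s x : cabs (ev s x%:C) <= \sum_(t <- s) cabs t.1 :> R.
Proof.
apply: le_trans (cabs_sum _ _ _) _; apply: ler_sum => t _.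
by rewrite cabsM E_real cabs_e mulr1.
Qed.

Lemma AP_bounded f : AP f -> exists2 K : R, 0 < K & forall x, cabs (f x) <= K.
Proof.
move=> hf; have [s hs] := AP_ev hf ltr01.
exists (\sum_(t <- s) cabs t.1 + 1).
  by rewrite ltr_wpDl // sumr_ge0.
move=> x; rewrite -[f x](subrK (ev s x%:C)) (le_trans (cabsD _ _)) // addrC.
exact: lerD (ev_real_bound _ _) (hs x).
Qed.

Lemma AP_e a f : AP f -> AP (fun x => e a x * f x).
Proof.
move=> hf eps /(AP_ev hf)[s hs].
exists (fun x => ev [seq (t.1, a + t.2) | t <- s] x%:C); first exact: ev_trig_poly.
move=> x; have -> : ev [seq (t.1, a + t.2) | t <- s] x%:C = e a x * ev s x%:C.
  rewrite /ev big_map mulr_sumr; apply: eq_bigr => t _ /=.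
  by rewrite E_add E_real mulrCA.
by rewrite -mulrBr cabsM cabs_e mul1r.
Qed.

(** A mean is bounded by the supremum norm, so the constant coefficients of the approximants form a
    Cauchy sequence; its limit is the mean. *)
Lemma AP_mean f : AP f -> exists m, cmean f m.
Proof.
move=> hf; have inv0 n : 0 < n.+1%:R^-1 :> R by rewrite invr_gt0.
have /choice[s hs] : forall n : nat, exists s, forall x, cabs (f x - ev s x%:C) <= n.+1%:R^-1.
  by move=> n; exact: AP_ev.
have small (eps : R) : 0 < eps -> exists n0 : nat, forall n, (n0 <= n)%N -> n.+1%:R^-1 <= eps.
  move=> e0; exists (Num.bound eps^-1) => n hn.
  rewrite -[eps]invrK lef_pV2 ?posrE ?invr_gt0 //.
  apply: ltW; apply: lt_le_trans (archi_boundP _) _; first by rewrite invr_ge0 ltW.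
  by rewrite ler_nat ltnW.
have hm n : cmean (fun x => ev (s n) x%:C) (coefl (s n) 0).
  by apply: cmean_ext (cmean_ev (s n) 0) => x; rewrite oppr0 e0 mul1r.
have [m hmm] : exists m, cvgC (fun n => coefl (s n) 0) m.
  apply: cauchyC_cvg => eps e0; have e2 : 0 < eps / 2 by rewrite divr_gt0.
  have [n0 hn] := small _ e2; exists n0 => n k hn1 hk.
  have cN p : ccont setT (fun x : R => ev (s p) x%:C) by exact: ccont_ev.
  have := cmeanD (cN n) (ccontZ (-1) (cN k)) (hm n) (cmeanZ (-1) (cN k) (hm k)).
  move/cmean_bound => H; rewrite -mulN1r; apply: H.
    by apply: ccontD => //; exact: ccontZ.
  move=> x.
  have -> : ev (s n) x%:C + -1 * ev (s k) x%:C =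
    (f x - ev (s k) x%:C) - (f x - ev (s n) x%:C) by ring.
  rewrite [eps]splitr; apply: le_trans (cabsB _ _) _.
  by apply: lerD; [exact: le_trans (hs k x) (hn _ hk)|exact: le_trans (hs n x) (hn _ hn1)].
exists m; apply: cmean_approx; first exact: AP_cont.
move=> eps e0; have [n0 hn] := small _ e0; have [n1 hn1] := hmm _ e0.
exists (fun x => ev (s (maxn n0 n1)) x%:C), (coefl (s (maxn n0 n1)) 0); split => //.
- exact: ccont_ev.
- by move=> x; exact: le_trans (hs _ x) (hn _ (leq_maxl _ _)).
- exact: hn1 (leq_maxr _ _).
Qed.

Lemma bohr_coef_mean f a : AP f -> cmean (fun x => e (- a) x * f x) (bohr_coef f a).
Proof.
by move=> /(AP_e (- a))/AP_mean[m hm]; rewrite /bohr_coef (cmean_bohr hm).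
Qed.

Lemma bohr_coef_near f s a (eps : R) : AP f -> (forall x, cabs (f x - ev s x%:C) <= eps) ->
  cabs (bohr_coef f a - coefl s a) <= eps.
Proof.
move=> hf hs.
have c1 : ccont setT (fun x => e (- a) x * f x) by apply: AP_cont; exact: AP_e.
have c2 : ccont setT (fun x => e (- a) x * ev s x%:C).
  by apply: ccontM; [exact: ccont_e|exact: ccont_ev].
have := cmeanD c1 (ccontZ (-1) c2) (bohr_coef_mean a hf) (cmeanZ (-1) c2 (cmean_ev s a)).
move/cmean_bound => H; rewrite -mulN1r; apply: H => [|x].
  by apply: ccontD => //; exact: ccontZ.
have -> : e (- a) x * f x + -1 * (e (- a) x * ev s x%:C) =
  e (- a) x * (f x - ev s x%:C) by ring.
by rewrite cabsM cabs_e mul1r.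
Qed.

Lemma AP_shift f t : AP f -> AP (fun x => f (x + t)).
Proof.
move=> hf eps /(AP_ev hf)[s hs].
exists (fun x => ev [seq (u.1 * e u.2 t, u.2) | u <- s] x%:C); first exact: ev_trig_poly.
move=> x; have -> : ev [seq (u.1 * e u.2 t, u.2) | u <- s] x%:C = ev s (x + t)%:C.
  rewrite /ev big_map; apply: eq_bigr => u _ /=.
  by rewrite rmorphD E_addz !E_real; ring.
exact: hs.
Qed.

Lemma bohr_coef_shift f t a : AP f ->
  bohr_coef (fun x => f (x + t)) a = e a t * bohr_coef f a.
Proof.
move=> hf; apply/eqP; rewrite -subr_eq0 -cabs_eq0 eq_le cabs_ge0 andbT.
apply/ler_addgt0Pr => eps e0; rewrite add0r; have e2 : 0 < eps / 2 by rewrite divr_gt0.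
have [s hs] := AP_ev hf e2; pose s' := [seq (u.1 * e u.2 t, u.2) | u <- s].
have h1 := bohr_coef_near a hf hs.
have h2 : cabs (bohr_coef (fun x => f (x + t)) a - coefl s' a) <= eps / 2.
  apply: bohr_coef_near => [|x]; first exact: AP_shift.
  have -> : ev s' x%:C = ev s (x + t)%:C.
    rewrite /ev big_map; apply: eq_bigr => u _ /=.
    by rewrite rmorphD E_addz !E_real; ring.
  exact: hs.
have cE : coefl s' a = e a t * coefl s a.
  by rewrite /coefl big_map mulr_sumr; apply: eq_bigr => u /= /eqP ->; rewrite mulrC.
have -> : bohr_coef (fun x => f (x + t)) a - e a t * bohr_coef f a =
  (bohr_coef (fun x => f (x + t)) a - coefl s' a) - e a t * (bohr_coef f a - coefl s a).
  by rewrite cE mulrBr opprB addrA subrK.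
apply: le_trans (cabsB _ _) _; rewrite cabsM cabs_e mul1r [eps]splitr.
exact: (lerD h2 h1).
Qed.

(** When the conjugate factor is replaced by that of an exponential sum, the mean becomes a
    combination of Bohr coefficients of [f], all of them 0. *)
Lemma cmean_sq0 f : AP f -> (forall a, bohr_coef f a = 0) ->
  cmean (fun x => f x * conjc (f x)) 0.
Proof.
move=> hf h0; have [K K0 hK] := AP_bounded hf; have cf := AP_cont hf.
apply: cmean_approx; first by apply: ccontM => //; exact: ccont_conj.
move=> eps e0; have [s hs] := AP_ev hf (divr_gt0 e0 K0).
have cs : ccont setT (fun x : R => ev s x%:C) by exact: ccont_ev.
exists (fun x => f x * conjc (ev s x%:C)), 0; split.
- by apply: ccontM => //; exact: ccont_conj.
- move=> x; rewrite -mulrBr cabsM.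
  have -> : conjc (f x) - conjc (ev s x%:C) = conjc (f x - ev s x%:C).
    by case: (f x) (ev s _) => [u v] [u' v']; simpc; congr (_ +i* _); ring.
  rewrite cabs_conj; apply: (@le_trans _ _ (K * (eps / K))).
    exact: ler_pM.
  by rewrite mulrC divfK ?gt_eqF.
- have -> : 0 = \sum_(t <- s) conjc t.1 * 0 :> R[i].
    by rewrite big1 // => t _; rewrite mulr0.
  apply: (@cmean_ext _ (fun x => \sum_(t <- s) conjc t.1 * (e (- t.2) x * f x))).
    move=> x; rewrite /ev conj_sum mulr_sumr; apply: eq_bigr => t _.
    by rewrite conjM conj_E conjc_real E_real; ring.
  apply: cmean_sum => t.
    by apply: ccontZ; apply: AP_cont; exact: AP_e.
  apply: cmeanZ; first by apply: AP_cont; exact: AP_e.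
  by rewrite -(h0 t.2); exact: bohr_coef_mean.
- by rewrite subrr cabs0 ltW.
Qed.

(** Total boundedness of the values of finitely many functions, with the net inside [X]. The set [X]
    is arbitrary for the sake of the induction, which cuts it into cells where the first function
    varies by at most [eps]. *)
Lemma finite_net (hs : seq (R -> R)) (eps : R) : 0 < eps ->
  (forall i x, -1 <= nth (fun=> 0) hs i x <= 1) ->
  forall X : set R, exists ts : seq R, forall x, X x ->
    exists t, [/\ t \in ts, X t &
      forall i, `|nth (fun=> 0) hs i x - nth (fun=> 0) hs i t| <= eps].
Proof.
move=> e0; elim: hs => [|h hs IH] hb X.
  have [[x0 Xx0]|nX] := pselect (exists x, X x); last first.
    by exists [::] => x Xx; exfalso; apply: nX; exists x.
  exists [:: x0] => x Xx; exists x0; split => //; first by rewrite inE.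
  by move=> i; rewrite nth_nil subrr normr0 ltW.
have {}IH := IH (fun i => hb i.+1).
pose N := Num.bound (2 / eps).
pose cell (i : nat) := [set x | X x /\ i%:R * eps <= h x + 1 <= i.+1%:R * eps].
have /choice[ts hts] := fun i => IH (cell i).
exists (flatten [seq ts i | i <- iota 0 N]) => x Xx.
pose i := Num.truncn ((h x + 1) / eps).
have /andP[hx1 hx2] : -1 <= h x <= 1 := hb 0%N x.
have hx0 : 0 <= (h x + 1) / eps by rewrite divr_ge0 ?(ltW e0) //; lra.
have /andP[i1 i2] := truncn_itv hx0.
have iN : (i < N)%N.
  rewrite /i truncn_lt_nat //; apply: le_lt_trans (archi_boundP _); last by rewrite divr_ge0 // ltW.
  by rewrite ler_pM2r ?invr_gt0 //; lra.
have cx : cell i x.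
  split=> //; apply/andP; split; first by rewrite -ler_pdivlMr.
  by rewrite -ler_pdivrMr // ltW.
have [t [tj [Xt /andP[c1 c2]] ht]] := hts i x cx.
exists t; split=> //.
  by apply/flatten_mapP; exists i => //; rewrite mem_iota.
case=> [|k] /=; last exact: ht.
case: cx => _ /andP[c3 c4]; rewrite -natr1 mulrDl mul1r in c2 c4.
by rewrite ler_norml; apply/andP; split; lra.
Qed.

Lemma e_net (s : seq (R[i] * R)) (eps : R) : 0 < eps -> exists ts : seq R, forall x,
  exists2 t, t \in ts & forall u, u \in s -> cabs (e u.2 x - e u.2 t) <= eps.
Proof.
move=> e0; have e2 : 0 < eps / 2 by rewrite divr_gt0.
pose hc (u : R[i] * R) x := cos (u.2 * x) : R.
pose hn (u : R[i] * R) x := sin (u.2 * x) : R.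
have hb i x : -1 <= nth (fun=> 0) ([seq hc u | u <- s] ++ [seq hn u | u <- s]) i x <= 1.
  have [hi|hi] := ltnP i (size ([seq hc u | u <- s] ++ [seq hn u | u <- s])).
    rewrite nth_cat !size_map; case: ifP => hi'.
      by rewrite (nth_map (0, 0)) // /hc cos_geN1 cos_le1.
    rewrite (nth_map (0, 0)) // /hn ?sin_geN1 ?sin_le1 //.
    move: hi; rewrite size_cat !size_map => hi.
    by rewrite -(ltn_add2l (size s)) subnKC // leqNgt hi'.
  by rewrite nth_default // lerN10 ler01.
have [ts hts] := finite_net e2 hb setT.
exists ts => x; have [t [tts _ ht]] := hts x I; exists t => // u us.
apply: le_trans (cabs_ReIm _) _; rewrite [eps]splitr /=.
have ui : (index u s < size s)%N by rewrite index_mem.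
apply: lerD.
  have := ht (index u s); rewrite !nth_cat size_map ui !(nth_map (0, 0)) //.
  by rewrite nth_index.
have := ht (size s + index u s)%N.
rewrite !nth_cat size_map ltnNge leq_addr /= addKn !(nth_map (0, 0)) //.
by rewrite nth_index.
Qed.

(* If [f x0 <> 0], finitely many translates of [|f|^2] have a sum bounded below, by
   compactness of the closure of the orbit of the frequencies of an approximant of
   [f]; but each translate has mean zero. *)
Theorem AP_unique f : AP f -> (forall a, bohr_coef f a = 0) -> forall x, f x = 0.
Proof.
move=> hf h0 x0; apply/eqP; apply/negPn/negP => fx0.
pose c := cabs (f x0); have c0 : 0 < c by rewrite /c cabs_gt0.
have c8 : 0 < c / 8 by rewrite divr_gt0.
have [s hs] := AP_ev hf c8.
pose W : R := \sum_(u <- s) cabs u.1.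
have W0 : 0 <= W by rewrite sumr_ge0.
have W1 : 0 < W + 1 by rewrite ltr_wpDl.
have [ts hts] := e_net s (divr_gt0 (divr_gt0 c0 (ltr0Sn _ 3)) W1).
pose V x := \sum_(t <- ts) f (x + t) * conjc (f (x + t)).
have V0 : cmean V 0.
  have -> : 0 = \sum_(t <- ts) 0 :> R[i] by rewrite big1.
  apply: cmean_sum => t.
    by apply: ccontM; [|apply: ccont_conj]; apply: AP_cont; exact: AP_shift.
  apply: (@cmean_sq0 (fun x => f (x + t))); first exact: AP_shift.
  by move=> a; rewrite bohr_coef_shift // h0 mulr0.
have cV : ccont setT V.
  apply: ccont_sum => t.
  by apply: ccontM; [|apply: ccont_conj]; apply: AP_cont; exact: AP_shift.
pose v x := \sum_(t <- ts) cabs (f (x + t)) ^+ 2.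
have VE x : V x = (v x)%:C.
  by rewrite /V /v rmorph_sum /=; apply: eq_bigr => t _; rewrite sqr_cabs.
have [K K0 hK] := AP_bounded hf.
have vK x : v x <= (size ts)%:R * K ^+ 2.
  rewrite /v; apply: (@le_trans _ _ (\sum_(t <- ts) K ^+ 2)).
    by apply: ler_sum => t _; rewrite lerXn2r ?nnegrE // ltW.
  by rewrite big_const_seq count_predT iter_addr_0 -[_ *+ size ts]mulr_natl.
have vc x : (c / 2) ^+ 2 <= v x.
  (* With [t] close to [x0 - x] for all frequencies of [s], the point [x + t] acts like [x0]: the
     losses [c / 8], [c / 4] and [c / 8] leave at least [c / 2]. *)
  have [t tts ht] := hts (x0 - x).
  have H : c / 2 <= cabs (f (x + t)).
    have H1 := hs (x + t); have H2 := hs x0.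
    have H3 : cabs (ev s (x + t)%:C - ev s x0%:C) <= c / 4.
      rewrite /ev -sumrB; apply: le_trans (cabs_sum _ _ _) _.
      apply: (@le_trans _ _ (\sum_(u <- s) cabs u.1 * (c / 4 / (W + 1)))).
        rewrite big_seq [leRHS]big_seq; apply: ler_sum => u us.
        rewrite -mulrBr cabsM ler_wpM2l //.
        have -> : E u.2 x0%:C = E u.2 x%:C * E u.2 (x0 - x)%:C.
          by rewrite -E_addz -rmorphD [x + _]addrC subrK.
        rewrite rmorphD E_addz -mulrBr cabsM [cabs (E _ _)]cabs_E /= mulr0 expR0 mul1r.
        by rewrite !E_real cabsC; exact: ht.
      rewrite -mulr_suml -/W [W * _]mulrA ler_pdivrMr //.
      by rewrite mulrC ler_wpM2l ?divr_ge0 ?(ltW c0) // lerDl.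
    have := cabs_le_dist (f x0) (f x0 - f (x + t)).
    have -> : f x0 - (f x0 - f (x + t)) = f (x + t) by ring.
    rewrite -/c => H4.
    have H5 : cabs (f x0 - f (x + t)) <= c / 8 + c / 4 + c / 8.
      have -> : f x0 - f (x + t) = (f x0 - ev s x0%:C) - (ev s (x + t)%:C - ev s x0%:C)
         - (f (x + t) - ev s (x + t)%:C) by ring.
      apply: le_trans (cabsB _ _) _; apply: lerD => //.
      by apply: le_trans (cabsB _ _) _; exact: lerD.
    lra.
  rewrite /v (big_rem t tts) /=; apply: (@le_trans _ _ (cabs (f (x + t)) ^+ 2)).
    by rewrite lerXn2r ?nnegrE // divr_ge0 // ltW.
  by rewrite lerDl sumr_ge0 // => u _; rewrite exprn_ge0.
(* The contradiction: [K' - V] has mean [K'], although its modulus never exceeds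
   [K' - (c / 2) ^+ 2]. *)
pose K' : R := (size ts)%:R * K ^+ 2.
have := cmeanD (@ccont_cst _ setT K'%:C) (ccontZ (-1) cV) (cmean_cst K'%:C) (cmeanZ (-1) cV V0).
rewrite mulr0 addr0; move/cmean_bound => /(_ (K' - (c / 2) ^+ 2)) H.
have : cabs K'%:C <= K' - (c / 2) ^+ 2.
  apply: H => [|x]; first by apply: ccontD; [exact: ccont_cst|exact: ccontZ].
  rewrite VE mulN1r -rmorphB cabsR ger0_norm; first by rewrite lerD2l lerN2.
  by rewrite subr_ge0.
rewrite cabsR ger0_norm; last by apply: le_trans (vK 0); apply: le_trans (vc 0); rewrite sqr_ge0.
have : 0 < (c / 2) ^+ 2 by rewrite exprn_gt0 // divr_gt0.
lra.
Qed.

End AlmostPeriodicTheory.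

(** * The spectrum of a function of class S *)

Lemma ae_lebesgue_filter (R : realType) : Filter (almost_everywhere (@lebesgue_measure R)).
Proof. exact: ae_filter_ringOfSetsType. Qed.
#[local] Hint Extern 0 (Filter (nbhs (almost_everywhere _))) =>
  exact: ae_lebesgue_filter : typeclass_instances.

Section HardyMeans.
Variable R : realType.
Implicit Types (g : R -> R[i]) (a b x y K : R) (F : R[i] -> R[i]) (U : set R[i]).
Local Open Scope complex_scope.
Local Notation mu := (@lebesgue_measure R).

Lemma Rintegral_dct a b K (u : nat -> R -> R) (v : R -> R) :
  (forall n, mu.-integrable `[a, b] (EFin \o u n)) ->
  mu.-integrable `[a, b] (EFin \o v) ->
  (forall n x, a <= x <= b -> `|u n x| <= K) ->
  {ae mu, forall x, u n x @[n --> \oo] --> v x} ->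
  \int[mu]_(x in `[a, b]) u n x @[n --> \oo] --> \int[mu]_(x in `[a, b]) v x.
Proof.
move=> iu iv uK uv.
have mI : measurable (`[a, b] : set (measurableTypeR R)) by exact: measurable_itv.
have iK : mu.-integrable `[a, b] (EFin \o (fun=> K)).
  by have := @ccont_Re_integrable R a b (fun=> K%:C) (@ccont_cst R _ K%:C).
have fK : {ae mu, forall x n, `[a, b]%classic x -> (`|(u n x)%:E| <= (EFin \o (fun=> K)) x)%E}.
  by apply: aeW => x n; rewrite /= in_itv /= => hx; rewrite lee_fin; exact: uK.
have f_f : {ae mu, forall x, `[a, b]%classic x -> (u n x)%:E @[n --> \oo] --> (v x)%:E}.
  apply: filterS uv => x H _.
  exact: (cvg_comp _ _ H (fun A (hA : nbhs (v x)%:E A) => hA)).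
have [_ _ h] := @dominated_convergence _ _ R mu `[a, b] mI (fun n x => (u n x)%:E)
  (EFin \o v) (EFin \o (fun=> K))
  (fun n => measurable_int _ (iu n)) (measurable_int _ iv) f_f iK fK.
apply: fine_cvg; rewrite fineK; first exact: h.
exact: integrable_fin_num.
Qed.

Lemma cint_dct a b K (f : nat -> R -> R[i]) g :
  (forall n, ccont `[a, b] (f n)) -> ccont `[a, b] g ->
  (forall n x, a <= x <= b -> cabs (f n x) <= K) ->
  {ae mu, forall x, cvgC (fun n => f n x) (g x)} ->
  cvgC (fun n => cint a b (f n)) (cint a b g).
Proof.
move=> cf cg fK fg.
have hRe : \int[mu]_(x in `[a, b]) complex.Re (f n x) @[n --> \oo] -->
    \int[mu]_(x in `[a, b]) complex.Re (g x).
  apply: (@Rintegral_dct a b K (fun n x => complex.Re (f n x)) (fun x => complex.Re (g x))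
    (fun n => ccont_Re_integrable (cf n)) (ccont_Re_integrable cg)).
  - by move=> n x hx; apply: le_trans (Re_cabs _) (fK _ _ hx).
  - apply: filterS fg => x hx; apply/cvgrPdist_le => eps e0.
    have [n0 hn] := hx _ e0; exists n0 => // n /= n0n.
    apply: le_trans (hn _ n0n); move: (Re_cabs (f n x - g x)); rewrite distrC.
    by case: (f n x) (g x) => [p q] [p' q'].
have hIm : \int[mu]_(x in `[a, b]) complex.Im (f n x) @[n --> \oo] -->
    \int[mu]_(x in `[a, b]) complex.Im (g x).
  apply: (@Rintegral_dct a b K (fun n x => complex.Im (f n x)) (fun x => complex.Im (g x))
    (fun n => ccont_Im_integrable (cf n)) (ccont_Im_integrable cg)).
  - by move=> n x hx; apply: le_trans (Im_cabs _) (fK _ _ hx).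
  - apply: filterS fg => x hx; apply/cvgrPdist_le => eps e0.
    have [n0 hn] := hx _ e0; exists n0 => // n /= n0n.
    apply: le_trans (hn _ n0n); move: (Im_cabs (f n x - g x)); rewrite distrC.
    by case: (f n x) (g x) => [p q] [p' q'].
move=> eps e0; have e2 : 0 < eps / 2 by rewrite divr_gt0.
move/cvgrPdist_le: hRe => /(_ _ e2)[n1 _ h1].
move/cvgrPdist_le: hIm => /(_ _ e2)[n2 _ h2].
exists (maxn n1 n2) => n; rewrite geq_max => /andP[/h1 H1 /h2 H2].
rewrite /= distrC in H1; rewrite /= distrC in H2.
apply: le_trans (cabs_ReIm _) _; rewrite [eps]splitr.
exact: lerD H1 H2.
Qed.

Lemma stolz_eps U (F : R[i]^o -> R[i]^o) x (k : R) (l : R[i]) :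
  F z @[z --> within (stolz U x k) (nbhs (x%:C : R[i]^o))] --> (l : R[i]^o) ->
  forall eps : R, 0 < eps -> exists2 dl : R, 0 < dl & forall z, U z ->
    `|complex.Re z - x| <= k * `|complex.Im z| -> cabs (z - x%:C) < dl ->
    cabs (F z - l) <= eps.
Proof.
move=> /cvgrPdist_le h eps e0; have /h : 0 < eps%:C :> R[i] by rewrite ltcR.
rewrite near_withinE => /nbhs_ballP[d /= d0 hd].
have d0' : 0 < complex.Re d by move: d0; rewrite ltcE => /andP[].
have dE : d = (complex.Re d)%:C.
  by case: d d0 {hd d0'} => u v; rewrite ltcE /= => /andP[/eqP -> _].
exists (complex.Re d) => // z Uz hz hzd.
have := hd z; rewrite /ball /= dE.
rewrite ltcR lecR -/(cabs (x%:C - z)) -/(cabs (l - F z)).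
rewrite [cabs (x%:C - z)]cabsC [cabs (l - F z)]cabsC => /(_ hzd).
by apply; split.
Qed.

Definition decays U (k : R) := (U = @upper R /\ 0 < k) \/ (U = @lower R /\ k < 0).

(** A boundary function has no regularity on the real line, so it is replaced by the traces of its
    extension at distance [1 / (n + 1)] from it. These are continuous and uniformly bounded, and
    moving them by a further distance [Y], to where [E k] is small, bounds their integrals uniformly
    in [n]. *)
Lemma Hinf_approach U k (h : R -> R[i]) : decays U k -> Hinf U h ->
  exists (phi : nat -> R -> R[i]) (M : R), [/\ 0 < M,
    forall n A, ccont A (phi n),
    forall n x, cabs (phi n x) <= M,
    {ae mu, forall x, cvgC (fun n => phi n x) (h x * e k x)} &
    forall T Y eta n, 0 < T -> 0 < Y -> expR (- (`|k| * Y)) <= eta ->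
      cabs (cint (- T) T (phi n)) <= M * (eta * (2 * T) + 2 * Y)].
Proof.
move=> dec [F [holF [M0 FM0] Fh]].
pose M := `|M0| + 1; have Mp : 0 < M by rewrite ltr_wpDl.
have FM z : U z -> cabs (F z) <= M.
  by move=> /FM0 H; apply: le_trans H _; rewrite ler_wpDr // ler_norm.
pose sg : R := if k < 0 then -1 else 1.
have sg1 : 0 < k -> sg = 1 by move=> hk; rewrite /sg ltNge (ltW hk).
have sg2 : k < 0 -> sg = -1 by move=> hk; rewrite /sg hk.
have sgA : `|sg| = 1 by rewrite /sg; case: ifP; rewrite ?normrN normr1.
clearbody sg.
pose ht (n : nat) : R := sg * n.+1%:R^-1.
have inv0 n : 0 < n.+1%:R^-1 :> R by rewrite invr_gt0.
have k0 : 0 < `|k| by rewrite normr_gt0; case: dec => -[_]; [move=> /gt_eqF ->|move=> /lt_eqF ->].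
have Uht x n : U (x +i* ht n).
  case: dec => -[-> hk]; rewrite /upper /lower /= /ht.
    by rewrite sg1 // mul1r.
  by rewrite sg2 // mulN1r oppr_lt0.
have EU z : U z -> cabs (E k z) <= 1.
  case: dec => -[-> hk]; rewrite /upper /lower /= cabs_E -expR0 ler_expR => hz; nra.
pose H z := F z * E k z.
have dH z : U z -> cdiff H z.
  move=> Uz; apply: cdiffM; last exact: cdiff_E.
  by apply: cdiff_derivable; exact: holF.
have HM z : U z -> cabs (H z) <= M.
  move=> Uz; rewrite cabsM -[leRHS]mulr1; apply: ler_pM => //; [exact: FM|exact: EU].
exists (fun n x => H (x +i* ht n)), M; split=> //.
- by move=> n A; apply: ccont_h => x _; apply: cdiff_cont; apply: dH.
- by move=> n x; exact: HM.
(* The approach is vertical, so the degenerate Stolz angle of aperture 0 suffices. *)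
- apply: filterS Fh => x /(_ 0)/stolz_eps Fx.
  have htx n : x +i* ht n - x%:C = 'i * (ht n)%:C.
    by apply/eqP; rewrite eq_complex /=; apply/andP; split; apply/eqP; ring.
  have i1 : cabs ('i : R[i]) = 1 by rewrite cabsE expr0n /= add0r expr1n sqrtr1.
  have nht n : cabs (x +i* ht n - x%:C) = n.+1%:R^-1.
    rewrite htx cabsM i1 mul1r cabsR /ht normrM (gtr0_norm (inv0 n)).
    by rewrite sgA mul1r.
  have small (eps : R) : 0 < eps -> exists n0 : nat, forall n, (n0 <= n)%N -> n.+1%:R^-1 < eps.
    move=> e0; exists (Num.bound eps^-1) => n hn.
    rewrite -[eps]invrK ltf_pV2 ?posrE ?invr_gt0 //.
    apply: lt_le_trans (archi_boundP _) _; first by rewrite invr_ge0 ltW.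
    by rewrite ler_nat ltnW.
  apply: cvgCM.
    move=> eps e0; have [dl dl0 hdl] := Fx _ e0; have [n0 hn] := small _ dl0.
    exists n0 => n n0n; apply: hdl => //; first by rewrite /= subrr normr0 mul0r.
    by rewrite nht; exact: hn.
  move=> eps e0; have [dl dl0 hdl] := cdiff_cont (@cdiff_E R k x%:C) e0.
  have [n0 hn] := small _ dl0; exists n0 => n n0n; rewrite -E_real.
  have := hdl (x +i* ht n - x%:C); rewrite nht => /(_ (hn _ n0n)).
  by rewrite [x%:C + _]addrC subrK.
- move=> T Y eta n T0 Y0 hY.
  have TT : - T <= T by lra.
  have -> : M * (eta * (2 * T) + 2 * Y) = M * eta * (T - - T) + 2 * M * Y by ring.
  have hn0 := inv0 n.
  have Hsmall z : U z -> expR (- k * complex.Im z) <= eta -> cabs (H z) <= M * eta.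
    by move=> Uz hz; rewrite cabsM cabs_E; apply: ler_pM => //; exact: FM.
  case: dec => -[UE hk].
    have htE : ht n = n.+1%:R^-1 by rewrite /ht sg1 // mul1r.
    have cd : ht n <= ht n + Y by rewrite lerDl ltW.
    have inU x y : ht n <= y <= ht n + Y -> U (x +i* y).
      by move=> /andP[y1 _]; rewrite UE /upper /=; apply: lt_le_trans y1; rewrite htE.
    have [+ _] := @side_bound R (- T) T (ht n) (ht n + Y) H M (M * eta) TT cd
      (fun x y _ hy => dH _ (inU x y hy)) (fun x y _ hy => HM _ (inU x y hy)).
    have -> : ht n + Y - ht n = Y by ring.
    apply => x _; apply: Hsmall; first by rewrite UE /upper /= htE addr_gt0.
    apply: le_trans hY; rewrite /= ler_expR gtr0_norm // htE mulNr lerN2 ler_pM2l //.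
    by rewrite lerDr ltW.
  have htE : ht n = - n.+1%:R^-1 by rewrite /ht sg2 // mulN1r.
  have cd : ht n - Y <= ht n by rewrite gerBl ltW.
  have inU x y : ht n - Y <= y <= ht n -> U (x +i* y).
    move=> /andP[_ y2]; rewrite UE /lower /=; apply: le_lt_trans y2 _.
    by rewrite htE oppr_lt0.
  have [_] := @side_bound R (- T) T (ht n - Y) (ht n) H M (M * eta) TT cd
    (fun x y _ hy => dH _ (inU x y hy)) (fun x y _ hy => HM _ (inU x y hy)).
  have -> : ht n - (ht n - Y) = Y by ring.
  apply => x _; apply: Hsmall; first by rewrite UE /lower /= htE -opprD oppr_lt0 addr_gt0.
  apply: le_trans hY; rewrite /= ler_expR ltr0_norm // htE.
  by move: hn0; move: (n.+1%:R^-1) => q q0; nra.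
Qed.

(** Continuity is known for [g] but not for the two summands; dominated convergence is therefore
    applied to the sum of their approximations. The two half-planes may differ, since each summand
    is moved separately. *)
Lemma Hinf_mean0 g U1 U2 (h1 h2 : R -> R[i]) k1 k2 : ccont setT g ->
  decays U1 k1 -> decays U2 k2 -> Hinf U1 h1 -> Hinf U2 h2 ->
  {ae mu, forall x, g x = h1 x * e k1 x + h2 x * e k2 x} -> cmean g 0.
Proof.
move=> cg dec1 dec2 H1 H2 gE.
have [p1 [M1 [M10 cp1 pM1 pc1 pb1]]] := Hinf_approach dec1 H1.
have [p2 [M2 [M20 cp2 pM2 pc2 pb2]]] := Hinf_approach dec2 H2.
have k10 : 0 < `|k1|.
  by rewrite normr_gt0; case: dec1 => -[_]; [move=> /gt_eqF ->|move=> /lt_eqF ->].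
have k20 : 0 < `|k2|.
  by rewrite normr_gt0; case: dec2 => -[_]; [move=> /gt_eqF ->|move=> /lt_eqF ->].
have bound T Y eta : 0 < T -> 0 < Y -> expR (- (`|k1| * Y)) <= eta ->
    expR (- (`|k2| * Y)) <= eta ->
    cabs (cint (- T) T g) <= (M1 + M2) * (eta * (2 * T) + 2 * Y).
  move=> T0 Y0 hk1 hk2.
  have L : cvgC (fun n => cint (- T) T (fun x => p1 n x + p2 n x)) (cint (- T) T g).
    apply: (@cint_dct _ _ (M1 + M2)).
    - by move=> n; apply: ccontD; [exact: cp1|exact: cp2].
    - by apply: ccontS cg.
    - by move=> n x _; apply: le_trans (cabsD _ _) (lerD (pM1 _ _) (pM2 _ _)).
    - apply: filterS3 gE pc1 pc2 => x -> c1 c2.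
      exact: cvgCD.
  rewrite -[cint _ _ g]subr0; apply: (cvgC_le (n0 := 0%N) L) => n _.
  rewrite subr0 cintD; [|exact: cp1|exact: cp2].
  apply: le_trans (cabsD _ _) _; rewrite mulrDl.
  by apply: lerD; [exact: pb1|exact: pb2].
move=> eps e0; pose M := M1 + M2; have Mp : 0 < M by rewrite addr_gt0.
have eM : 0 < eps / (2 * M) by rewrite divr_gt0 // mulr_gt0.
have [Y1 Y10 hY1] := expR_small k10 eM; have [Y2 Y20 hY2] := expR_small k20 eM.
pose Y := Num.max Y1 Y2.
have Y0 : 0 < Y by rewrite lt_max Y10.
have hY1' : expR (- (`|k1| * Y)) <= eps / (2 * M).
  by apply: le_trans hY1; rewrite ler_expR lerN2 ler_pM2l // le_max lexx.
have hY2' : expR (- (`|k2| * Y)) <= eps / (2 * M).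
  by apply: le_trans hY2; rewrite ler_expR lerN2 ler_pM2l // le_max lexx orbT.
exists (2 * M * Y / eps); first by rewrite divr_gt0 // !mulr_gt0.
move=> T hT; have T0 : 0 < T by apply: lt_le_trans hT; rewrite divr_gt0 // !mulr_gt0.
rewrite subr0 cabsM cabsR ger0_norm ?invr_ge0 ?mulr_ge0 // ?(ltW T0) //.
rewrite mulrC ler_pdivrMr ?mulr_gt0 //.
apply: le_trans (bound T Y _ T0 Y0 hY1' hY2') _; rewrite -/M.
have : 2 * M * Y <= T * eps by rewrite -ler_pdivrMr.
have -> : M * (eps / (2 * M) * (2 * T) + 2 * Y) = eps * T + 2 * M * Y.
  by field; rewrite gt_eqF.
lra.
Qed.

End HardyMeans.

Section Spectrum.
Variable R : realType.
Implicit Types (g gm gp : R -> R[i]) (a lam : R) (N : nat).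
Local Open Scope complex_scope.
Local Notation mu := (@lebesgue_measure R).
#[local] Hint Extern 0 (Filter (nbhs (almost_everywhere _))) =>
  exact: ae_lebesgue_filter : typeclass_instances.

Lemma bohr_coefD f g a : AP f -> AP g ->
  bohr_coef (fun x => f x + g x) a = bohr_coef f a + bohr_coef g a.
Proof.
move=> hf hg; rewrite /bohr_coef; apply: cmean_bohr.
apply: (@cmean_ext _ (fun x => e (- a) x * f x + e (- a) x * g x)).
  by move=> x; rewrite mulrDr.
apply: cmeanD; [| |exact: bohr_coef_mean|exact: bohr_coef_mean];
  by apply: AP_cont; exact: AP_e.
Qed.

(** The coefficient at [a] vanishes once each summand of [g] has a half-plane where its exponential
    decays after the shift by [- a]. For [am] the lower one serves when [a > - beta], and the
    additional condition of the class opens the upper one when [a < - (beta + beta / (N%:R - 1))];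
    [ap] is symmetric. Only the two intervals escape. *)
Lemma S_class_spectrum lam N g : (1 < N)%N -> AP g -> S_class lam N g ->
  exists beta nu : R, [/\ 0 <= beta, 0 <= nu, N%:R * (nu + beta) = lam &
    forall a, Omega g a ->
      (- (beta + beta / (N%:R - 1)) <= a <= - beta) \/
      (nu <= a <= nu + nu / (N%:R - 1))].
Proof.
move=> N1 hg [_ [am [ap [beta [nu [[Ham Hap /andP[/andP[nu0 _] /andP[be0 _]] nb gE] lamN]]]]]].
move=> /(_ N1)[Ham' Hap']; exists beta, nu; split=> //.
  by rewrite -lamN divfK // gt_eqF.
move=> a ga.
have {gE}gE : {ae mu, forall x, e (- a) x * g x =
    am x * e (- beta - a) x + ap x * e (nu - a) x}.
  by apply: filterS gE => x ->; rewrite !e_add; ring.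
have cg : ccont setT (fun x => e (- a) x * g x) by apply: AP_cont; exact: AP_e.
have zero U1 U2 (h1 h2 : R -> R[i]) k1 k2 : decays U1 k1 -> decays U2 k2 ->
    Hinf U1 h1 -> Hinf U2 h2 ->
    (forall x, am x * e (- beta - a) x = h1 x * e k1 x) ->
    (forall x, ap x * e (nu - a) x = h2 x * e k2 x) -> False.
  move=> d1 d2 H1 H2 E1 E2; move: ga; rewrite /Omega /= /bohr_coef.
  rewrite (cmean_bohr (m := 0)) ?eqxx //.
  apply: (Hinf_mean0 cg d1 d2 H1 H2).
  by apply: filterS gE => x ->; rewrite E1 E2.
have am1 x : am x * e (- beta - a) x = am x * e (- beta - a) x by [].
have am2 x : am x * e (- beta - a) x =
    (e (beta / (N%:R - 1)) x * am x) * e (- (beta + beta / (N%:R - 1)) - a) x.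
  rewrite [e _ x * am x]mulrC -mulrA -e_add; congr (_ * e _ x); ring.
have ap2 x : ap x * e (nu - a) x =
    (e (- (nu / (N%:R - 1))) x * ap x) * e (nu + nu / (N%:R - 1) - a) x.
  rewrite [e _ x * ap x]mulrC -mulrA -e_add; congr (_ * e _ x); ring.
have up k : 0 < k -> decays (@upper R) k by left.
have lo k : k < 0 -> decays (@lower R) k by right.
have N10 : 0 < N%:R - 1 :> R by rewrite subr_gt0 ltr1n.
have bN : 0 <= beta / (N%:R - 1) by rewrite divr_ge0 // ltW.
have nN : 0 <= nu / (N%:R - 1) by rewrite divr_ge0 // ltW.
have [a1|a1] := ltP a (- (beta + beta / (N%:R - 1))).
  exfalso; apply: (zero _ _ _ _ _ (nu - a) (up _ _) (up _ _) Ham' Hap am2) => //; lra.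
have [a2|a2] := ltP (nu + nu / (N%:R - 1)) a.
  exfalso; apply: (zero _ _ _ _ (- beta - a) _ (lo _ _) (lo _ _) Ham Hap' am1 ap2) => //; lra.
have [a3|a3] := leP a (- beta); first by left.
have [a4|a4] := leP nu a; first by right.
exfalso; apply: (zero _ _ _ _ (- beta - a) (nu - a) (lo _ _) (up _ _) Ham Hap am1) => //; lra.
Qed.

(** With 0 excluded, the two spectra lie on opposite open half-lines and cannot cancel: each nonzero
    coefficient of [gm] or [gp] is one of [g]. This carries over the intervals and, later, the
    absolute summability. *)
Lemma split_spectrum lam N g gm gp : (1 < N)%N -> AP g ->
  AP_minus gm -> AP_plus gp -> ~ Omega gm 0 -> ~ Omega gp 0 ->
  (forall x, g x = gm x + gp x) -> S_class lam N g ->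
  exists beta nu : R, [/\ 0 <= beta, 0 <= nu, N%:R * (nu + beta) = lam,
    forall a, Omega gm a ->
      [/\ a < 0, - (beta + beta / (N%:R - 1)) <= a <= - beta & bohr_coef g a = bohr_coef gm a] &
    forall a, Omega gp a ->
      [/\ 0 < a, nu <= a <= nu + nu / (N%:R - 1) & bohr_coef g a = bohr_coef gp a]].
Proof.
move=> N1 hg [hm Om] [hp Op] m0 p0 gE hS.
have [beta [nu [be0 nu0 lamE hO]]] := S_class_spectrum N1 hg hS.
have gD a : bohr_coef g a = bohr_coef gm a + bohr_coef gp a.
  have gE' : g = (fun x => gm x + gp x) by apply/funext => x; exact: gE.
  by rewrite gE' bohr_coefD.
have neg_a a : Omega gm a -> a < 0.
  move=> ha; have h := Om a ha; rewrite lt_neqAle h andbT; apply/negP => /eqP a0.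
  by apply: m0; rewrite -a0.
have pos_a a : Omega gp a -> 0 < a.
  move=> ha; have h := Op a ha; rewrite lt_neqAle h andbT; apply/negP => /eqP a0.
  by apply: p0; rewrite a0.
exists beta, nu; split; [exact: be0|exact: nu0|exact: lamE| |] => a ha.
  have a0 := neg_a a ha.
  have gp0 : bohr_coef gp a = 0.
    apply/eqP/negPn/negP => h; have := pos_a a h; lra.
  have ga : bohr_coef g a = bohr_coef gm a by rewrite gD gp0 addr0.
  split; [exact: a0| |exact: ga].
  have /hO[h|/andP[h _]] : Omega g a by rewrite /Omega /= ga.
    exact: h.
  by exfalso; lra.
have a0 := pos_a a ha.
have gm0 : bohr_coef gm a = 0.
  apply/eqP/negPn/negP => h; have := neg_a a h; lra.
have ga : bohr_coef g a = bohr_coef gp a by rewrite gD gm0 add0r.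
split; [exact: a0| |exact: ga].
have /hO[/andP[_ h]|h] : Omega g a by rewrite /Omega /= ga.
  by exfalso; lra.
exact: h.
Qed.

End Spectrum.

(** * Limits of exponential polynomials and entire functions *)

Section Identity.
Variable R : realType.
Implicit Types (a b c d x y : R) (F H : R[i] -> R[i]).
Local Open Scope complex_scope.

Lemma Re_cint_ge a b (f : R -> R[i]) (m : R) : a <= b -> ccont `[a, b] f ->
  (forall x, a <= x <= b -> m <= complex.Re (f x)) ->
  m * (b - a) <= complex.Re (cint a b f).
Proof.
move=> ab cf h.
have <- : complex.Re (cint a b (fun=> m%:C)) = m * (b - a).
  by rewrite cint_cst // -rmorphM.
rewrite !Re_cint; apply: le_Rintegral.
- exact: measurable_itv.
- apply: (ccont_Re_integrable (f := fun=> m%:C)); exact: ccont_cst.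
- exact: ccont_Re_integrable.
- by move=> x hx; apply: h; move: hx; rewrite /= in_itv.
Qed.

Definition gauss (k : R) (z0 z : R[i]) : R[i] := cexp (- (k%:C) * (z - z0) ^+ 2).

Lemma cdiff_gauss k z0 z : cdiff (gauss k z0) z.
Proof.
apply: cdiff_cexp; apply: cdiffM; first exact: cdiff_cst.
apply: (@cdiff_ext _ (fun w => (w - z0) * (w - z0))); first by move=> w; rewrite expr2.
have h : cdiff (fun w => w - z0) z by apply: cdiffD; [exact: cdiff_id|exact: cdiff_cst].
exact: cdiffM.
Qed.

Lemma cabs_gauss k (x0 y0 x y : R) :
  cabs (gauss k (x0 +i* y0) (x +i* y)) = expR (- k * ((x - x0) ^+ 2 - (y - y0) ^+ 2)).
Proof.
rewrite /gauss cabs_cexp; congr expR.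
by rewrite expr2 /=; ring.
Qed.

Lemma gauss_line k (x0 y0 x : R) :
  gauss k (x0 +i* y0) (x +i* y0) = (expR (- k * (x - x0) ^+ 2))%:C.
Proof.
rewrite /gauss.
have -> : - k%:C * (x +i* y0 - x0 +i* y0) ^+ 2 = (- k * (x - x0) ^+ 2)%:C.
  by apply/eqP; rewrite eq_complex expr2 /=; apply/andP; split; apply/eqP; ring.
by rewrite /cexp /= cos0 sin0 mulr1.
Qed.

(* Against the weight [gauss k z0], whose modulus on the horizontal line through [z0]
   peaks at [z0], Cauchy's theorem leaves only exponentially small contributions of
   the sides when [H] vanishes on the real line. *)
Lemma vanish_entire H : (forall z, ccontz H z) ->
  (forall k z0 a b c d, a <= b -> c <= d -> rint (fun z => H z * gauss k z0 z) a b c d = 0) ->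
  (forall x : R, H (x +i* 0) = 0) -> forall z, H z = 0.
Proof.
move=> cH iH H0 [x0 Y]; set z0 := x0 +i* Y.
apply/eqP; apply/negPn/negP => cn0; pose c := H z0.
have c0 : 0 < cabs c by rewrite cabs_gt0.
(* Wide enough that [(x - x0) ^+ 2 - (y - Y) ^+ 2] is at least 1 on the vertical sides, where the
   weight is then at most [expR (- k)]. *)
pose T : R := `|Y| + 1.
have T1 : 1 <= T by rewrite /T lerDr.
pose A := x0 - T; pose B := x0 + T.
have AB : A <= B by rewrite /A /B; lra.
pose C := Num.min 0 Y; pose D := Num.max 0 Y.
have CD : C <= D by rewrite /C /D ge_min le_max lexx.
have CDY : D - C = `|Y|.
  rewrite /C /D; case: (leP 0 Y) => h; first by rewrite subr0 ger0_norm.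
  by rewrite sub0r ltr0_norm.
have [M1 hM1] : exists M : R, forall x, A <= x <= B -> cabs (H (x +i* Y)) <= M.
  by apply: ccont_bounded; apply: ccont_h => x _; exact: cH.
have [M2 hM2] : exists M : R, forall y, C <= y <= D -> cabs (H (A +i* y)) <= M.
  by apply: ccont_bounded; apply: ccont_v => x _; exact: cH.
have [M3 hM3] : exists M : R, forall y, C <= y <= D -> cabs (H (B +i* y)) <= M.
  by apply: ccont_bounded; apply: ccont_v => x _; exact: cH.
pose M := `|M1| + `|M2| + `|M3|.
have M0 : 0 <= M by rewrite !addr_ge0.
have {}hM1 x : A <= x <= B -> cabs (H (x +i* Y)) <= M.
  move=> /hM1 h; have := ler_norm M1; have := normr_ge0 M2; have := normr_ge0 M3.
  rewrite /M; lra.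
have {}hM2 y : C <= y <= D -> cabs (H (A +i* y)) <= M.
  move=> /hM2 h; have := ler_norm M2; have := normr_ge0 M1; have := normr_ge0 M3.
  rewrite /M; lra.
have {}hM3 y : C <= y <= D -> cabs (H (B +i* y)) <= M.
  move=> /hM3 h; have := ler_norm M3; have := normr_ge0 M1; have := normr_ge0 M2.
  rewrite /M; lra.
have [dl [dl0 dl1 hdl]] : exists dl : R, [/\ 0 < dl, dl <= 1 & forall x, `|x - x0| <= dl ->
    cabs (H (x +i* Y) - c) <= cabs c / 2].
  have [d d0 hd] := cH z0 _ (divr_gt0 c0 (ltr0Sn _ 1)).
  exists (Num.min 1 (d / 2)); split.
  - by rewrite lt_min ltr01 divr_gt0.
  - by rewrite ge_min lexx.
  - move=> x; rewrite le_min => /andP[_ hx].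
    have := hd (x +i* Y - z0); rewrite hpathE [z0 + _]addrC subrK; apply.
    by apply: le_lt_trans hx _; lra.
pose Hk k z := H z * gauss k z0 z.
have cHk k z : ccontz (Hk k) z.
  by apply: ccontzM; [exact: cH|apply: cdiff_cont; exact: cdiff_gauss].
have line k : 0 < k -> cabs (cint A B (fun x => Hk k (x +i* Y))) <= 2 * M * `|Y| * expR (- k).
  move=> k0.
  have := iH k z0 A B C D AB CD; rewrite /rint.
  set Ib := cint C D _; set Ia := cint C D _ => E0.
  have sideE (x : R) : `|x - x0| = T ->
     (forall y, C <= y <= D -> cabs (H (x +i* y)) <= M) ->
     cabs (cint C D (fun y => H (x +i* y) * gauss k z0 (x +i* y))) <= M * expR (- k) * `|Y|.
    move=> xT hM; rewrite -CDY; apply: cint_bound => //.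
      by apply: (ccont_v (F := Hk k)) => y _; exact: cHk.
    move=> y hy; rewrite cabsM cabs_gauss; apply: ler_pM => //; first exact: hM.
    rewrite ler_expR -(real_normK (num_real (x - x0))) xT.
    have yY : `|y - Y| <= `|Y|.
      rewrite -CDY; case/andP: hy; rewrite /C /D.
      case: (leP 0 Y) => h h1 h2; rewrite ler_norml; apply/andP; split; lra.
    rewrite -(real_normK (num_real (y - Y))) mulNr lerN2.
    have : 1 <= T ^+ 2 - `|y - Y| ^+ 2.
      rewrite /T; have := normr_ge0 Y; have := normr_ge0 (y - Y); nra.
    nra.
  have hb : cabs Ib <= M * expR (- k) * `|Y|.
    by apply: sideE => //; rewrite /B addrC addKr gtr0_norm //; lra.
  have ha : cabs Ia <= M * expR (- k) * `|Y|.
    by apply: sideE => //; rewrite /A addrC addKr normrN gtr0_norm //; lra.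
  have i1 : cabs ('i : R[i]) = 1 by rewrite cabsE expr0n /= add0r expr1n sqrtr1.
  have S : cabs ('i * (Ib - Ia)) <= 2 * M * `|Y| * expR (- k).
    rewrite cabsM i1 mul1r; apply: le_trans (cabsB _ _) _.
    rewrite [leRHS](_ : _ = M * expR (- k) * `|Y| + M * expR (- k) * `|Y|); last by ring.
    exact: (lerD hb ha).
  have Z : cint A B (fun x => H (x +i* 0) * gauss k z0 (x +i* 0)) = 0.
    rewrite (@cint_eq _ _ _ _ (fun=> 0)) ?cint_cst // ?mul0r // => x _.
    by rewrite H0 mul0r.
  apply: le_trans S; move: E0; rewrite /C /D.
  case: (leP 0 Y) => h; rewrite Z ?sub0r ?subr0 => E0.
    by rewrite (_ : 'i * _ = cint A B (fun x => Hk k (x +i* Y))) //;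
      apply/esym/eqP; rewrite -subr_eq0 -oppr_eq0 opprB addrC E0.
  rewrite -[leRHS]cabsN (_ : - ('i * _) = cint A B (fun x => Hk k (x +i* Y))) //.
  by apply/esym/eqP; rewrite -subr_eq0 opprK E0.
pose m := M * (T + `|Y|).
have TY0 : 0 < T + `|Y| by rewrite ltr_wpDr //; lra.
have m0 : 0 <= m by rewrite mulr_ge0 // ltW.
(* Multiplication by the conjugate of [c] makes the real part of the integrand nonnegative within
   [dl] of [x0]. Points within [dl / 2] contribute at the order of [p], points beyond [dl] and the
   vertical sides at most at that of [q] (as [dl <= 1]), and [q / p] is exponentially small in
   [k]. *)
have main k : 0 < k -> cabs c * dl / 2 <= 2 * m * expR (- (3 / 4 * dl ^+ 2 * k)).
  move=> k0.
  pose q := expR (- k * dl ^+ 2); pose p := expR (- k * (dl / 2) ^+ 2).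
  have q0 : 0 < q by exact: expR_gt0.
  have p0 : 0 < p by exact: expR_gt0.
  have qE : q = p * expR (- (3 / 4 * dl ^+ 2 * k)).
    by rewrite /q /p -expRD; congr expR; field.
  pose f x := conjc c * Hk k (x +i* Y).
  have cf a b : ccont `[a, b] f.
    by apply: ccontZ; apply: ccont_h => x _; exact: cHk.
  pose rh x := complex.Re (conjc c * H (x +i* Y)).
  have fE x : complex.Re (f x) = expR (- k * (x - x0) ^+ 2) * rh x.
    rewrite /f /Hk gauss_line /rh mulrA [RHS]mulrC.
    by case: (conjc c * _) => u v /=; rewrite mulr0 subr0.
  have rh1 x : `|x - x0| <= dl -> cabs c ^+ 2 / 2 <= rh x.
    move=> /hdl h; have -> : rh x = cabs c ^+ 2 + complex.Re (conjc c * (H (x +i* Y) - c)).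
      have ReD (u v : R[i]) : complex.Re (u + v) = complex.Re u + complex.Re v.
        by case: u v => [? ?] [? ?].
      rewrite /rh.
      have -> : conjc c * H (x +i* Y) = c * conjc c + conjc c * (H (x +i* Y) - c) by ring.
      by rewrite ReD -sqr_cabs.
    have := Re_cabs (conjc c * (H (x +i* Y) - c)); rewrite cabsM cabs_conj => h2.
    have := ler_wpM2l (cabs_ge0 c) h => h3.
    have := le_trans h2 h3; rewrite ler_norml => /andP[h4 _]; nra.
  have rh2 x : A <= x <= B -> - (cabs c * M) <= rh x.
    move=> hx; have := Re_cabs (conjc c * H (x +i* Y)); rewrite cabsM cabs_conj => h2.
    have := le_trans h2 (ler_wpM2l (cabs_ge0 c) (hM1 x hx)).
    by rewrite ler_norml => /andP[].
  have far x : A <= x <= B -> dl <= `|x - x0| -> - (cabs c * M * q) <= complex.Re (f x).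
    move=> hx hd; rewrite fE.
    have hq : expR (- k * (x - x0) ^+ 2) <= q.
      rewrite ler_expR !mulNr lerN2 ler_pM2l // -(real_normK (num_real (x - x0))).
      by rewrite lerXn2r ?nnegrE // ltW.
    have := rh2 x hx; have := expR_gt0 (- k * (x - x0) ^+ 2); have := mulr_ge0 (cabs_ge0 c) M0.
    move: hq q0; move: (expR _) (rh x) (cabs c * M) => w r n; nra.
  have near0 x : `|x - x0| <= dl -> 0 <= complex.Re (f x).
    move=> /rh1 h; rewrite fE mulr_ge0 ?expR_ge0 //; apply: le_trans h.
    by rewrite divr_ge0 // sqr_ge0.
  have near1 x : `|x - x0| <= dl / 2 -> cabs c ^+ 2 / 2 * p <= complex.Re (f x).
    move=> h; rewrite fE mulrC; apply: ler_pM.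
    - exact: expR_ge0.
    - by rewrite divr_ge0 // sqr_ge0.
    - rewrite ler_expR !mulNr lerN2 ler_pM2l // -(real_normK (num_real (x - x0))).
      by rewrite lerXn2r ?nnegrE // divr_ge0 // ltW.
    - by apply: rh1; apply: le_trans h _; lra.
  have s1 : cint A B f = cint A (x0 - dl) f + (cint (x0 - dl) (x0 - dl / 2) f +
     (cint (x0 - dl / 2) (x0 + dl / 2) f + (cint (x0 + dl / 2) (x0 + dl) f + cint (x0 + dl) B f))).
    rewrite -cint_split; [|rewrite /B; lra|exact: cf].
    rewrite -cint_split; [|rewrite /B; lra|exact: cf].
    rewrite -cint_split; [|rewrite /B; lra|exact: cf].
    by rewrite -cint_split //; rewrite /A /B; lra.
  have g1 : - (cabs c * M * q) * (x0 - dl - A) <= complex.Re (cint A (x0 - dl) f).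
    apply: Re_cint_ge => //; first by rewrite /A; lra.
    move=> x hx; apply: far; first by move: hx; rewrite /A /B; lra.
    by rewrite ler0_norm; lra.
  have g2 : 0 * (x0 - dl / 2 - (x0 - dl)) <= complex.Re (cint (x0 - dl) (x0 - dl / 2) f).
    apply: Re_cint_ge => //; first by lra.
    by move=> x hx; apply: near0; rewrite ler_norml; lra.
  have g3 : cabs c ^+ 2 / 2 * p * (x0 + dl / 2 - (x0 - dl / 2)) <=
      complex.Re (cint (x0 - dl / 2) (x0 + dl / 2) f).
    apply: Re_cint_ge => //; first by lra.
    by move=> x hx; apply: near1; rewrite ler_norml; lra.
  have g4 : 0 * (x0 + dl - (x0 + dl / 2)) <= complex.Re (cint (x0 + dl / 2) (x0 + dl) f).
    apply: Re_cint_ge => //; first by lra.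
    by move=> x hx; apply: near0; rewrite ler_norml; lra.
  have g5 : - (cabs c * M * q) * (B - (x0 + dl)) <= complex.Re (cint (x0 + dl) B f).
    apply: Re_cint_ge => //; first by rewrite /B; lra.
    move=> x hx; apply: far; first by move: hx; rewrite /A /B; lra.
    by move: hx => /andP[hx _]; rewrite ger0_norm; move: hx dl0; clear; lra.
  have up : complex.Re (cint A B f) <= cabs c * (2 * M * `|Y| * q).
    rewrite /f cintZ; last by apply: ccont_h => x _; exact: cHk.
    apply: le_trans (ler_norm _) _; apply: le_trans (Re_cabs _) _.
    rewrite cabsM cabs_conj ler_wpM2l //; apply: le_trans (line k k0) _.
    rewrite ler_wpM2l ?mulr_ge0 // ler_expR mulNr lerN2 ler_piMr ?(ltW k0) //.
    by rewrite expr_le1 // ltW.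
  have sumE : complex.Re (cint A B f) = complex.Re (cint A (x0 - dl) f) +
    (complex.Re (cint (x0 - dl) (x0 - dl / 2) f) + (complex.Re (cint (x0 - dl / 2) (x0 + dl / 2) f)
    + (complex.Re (cint (x0 + dl / 2) (x0 + dl) f) + complex.Re (cint (x0 + dl) B f)))).
    by rewrite s1.
  have cM0 : 0 <= cabs c * M * q by rewrite !mulr_ge0 // ltW.
  have fin : cabs c * (cabs c * p * dl / 2) <= cabs c * (2 * m * q).
    have -> : cabs c * (cabs c * p * dl / 2) =
      cabs c ^+ 2 / 2 * p * (x0 + dl / 2 - (x0 - dl / 2)) by field.
    have hAB : - (cabs c * M * q) * (2 * T) <=
        - (cabs c * M * q) * (x0 - dl - A) + - (cabs c * M * q) * (B - (x0 + dl)).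
      rewrite -mulrDr !mulNr lerN2 ler_wpM2l //; rewrite /A /B; move: dl0; clear; lra.
    have -> : cabs c * (2 * m * q) = cabs c * M * q * (2 * T) + cabs c * (2 * M * `|Y| * q).
      by rewrite /m; ring.
    move: up; rewrite sumE; move: g1 g2 g3 g4 g5 hAB; rewrite !mul0r; clear; lra.
  rewrite ler_pM2l // qE in fin.
  have : p * (cabs c * dl / 2) <= p * (2 * m * expR (- (3 / 4 * dl ^+ 2 * k))).
    by move: fin; congr (_ <= _); ring.
  by rewrite ler_pM2l.
have k30 : 0 < 3 / 4 * dl ^+ 2 by rewrite mulr_gt0 // exprn_gt0.
have et0 : 0 < cabs c * dl / (8 * (m + 1)).
  by rewrite divr_gt0 ?mulr_gt0 // ltr_wpDl.
have [k k0 hk] := expR_small k30 et0.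
have := main k k0.
have h2 : 2 * m * expR (- (3 / 4 * dl ^+ 2 * k)) <= 2 * m * (cabs c * dl / (8 * (m + 1))).
  by rewrite ler_wpM2l // mulr_ge0.
move=> h1; have := le_trans h1 h2.
have -> : 2 * m * (cabs c * dl / (8 * (m + 1))) = (m / (m + 1)) * (cabs c * dl) / 4.
  by field; rewrite gt_eqF // ltr_wpDl.
have m1 : m / (m + 1) <= 1 by rewrite ler_pdivrMr ?ltr_wpDl // mul1r lerDl.
have : 0 < cabs c * dl by rewrite mulr_gt0.
nra.
Qed.

(** [A] is a limit of holomorphic functions, uniform on strips, and is not assumed differentiable.
    Continuity and the vanishing of rectangle integrals do pass to the limit, and these are what
    [vanish_entire] asks for. *)
Theorem entire_eq F A (An : nat -> R[i] -> R[i]) : (forall z, cdiff F z) ->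
  (forall n z, cdiff (An n) z) ->
  (forall Y eps : R, 0 < eps -> exists n, forall z, `|complex.Im z| <= Y ->
     cabs (A z - An n z) <= eps) ->
  (forall x : R, F x%:C = A x%:C) -> forall z, F z = A z.
Proof.
move=> dF dA hA FA.
have cA z : ccontz A z.
  move=> eps e0; have e3 : 0 < eps / 3 by rewrite divr_gt0.
  have [n hn] := hA (`|complex.Im z| + 1) _ e3.
  have [dl d0 hd] := cdiff_cont (dA n z) e3.
  exists (Num.min dl 1); first by rewrite lt_min d0 ltr01.
  move=> h; rewrite lt_min => /andP[/hd H h1].
  have H1 : cabs (A (z + h) - An n (z + h)) <= eps / 3.
    apply: hn; have := le_trans (Im_cabs h) (ltW h1).
    case: z h {hd H h1} => x y [u v] /= hv.
    by apply: le_trans (ler_normD _ _) _; rewrite lerD2l.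
  have H2 : cabs (A z - An n z) <= eps / 3 by apply: hn; rewrite lerDl.
  have -> : A (z + h) - A z = (A (z + h) - An n (z + h)) + (An n (z + h) - An n z)
    - (A z - An n z) by ring.
  apply: le_trans (cabsB _ _) _.
  have := cabsD (A (z + h) - An n (z + h)) (An n (z + h) - An n z); lra.
have cH z : ccontz (fun w => F w - A w) z.
  move=> eps e0; have e2 : 0 < eps / 2 by rewrite divr_gt0.
  have [d1 d10 h1] := cdiff_cont (dF z) e2; have [d2 d20 h2] := cA z _ e2.
  exists (Num.min d1 d2); first by rewrite lt_min d10.
  move=> h; rewrite lt_min => /andP[/h1 H1 /h2 H2].
  have -> : F (z + h) - A (z + h) - (F z - A z) =
    (F (z + h) - F z) - (A (z + h) - A z) by ring.
  by apply: le_trans (cabsB _ _) _; rewrite [eps]splitr; exact: lerD.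
suff H0 : forall z, F z - A z = 0 by move=> z; apply/eqP; rewrite -subr_eq0 H0.
apply: (@vanish_entire (fun w => F w - A w)) => // [k z0 a b c d ab cd|x]; last first.
  by rewrite -[x +i* 0]/(x%:C) FA subrr.
have cg z : ccontz (gauss k z0) z by apply: cdiff_cont; exact: cdiff_gauss.
apply/eqP; rewrite -cabs_eq0 eq_le cabs_ge0 andbT; apply/ler_addgt0Pr => eps e0.
rewrite add0r.
pose Yb := `|c| + `|d|.
pose L := (b - a) + (d - c).
have L0 : 0 <= L by rewrite addr_ge0 ?subr_ge0.
have [W hW] : exists W : R, on_rect (fun z => cabs (gauss k z0 z) <= W) a b c d.
  case: z0 {cg} => x0 y0.
  exists (expR (`|k| * ((`|a| + `|b| + `|x0|) ^+ 2 + (`|c| + `|d| + `|y0|) ^+ 2))).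
  move=> x y /andP[x1 x2] /andP[y1 y2]; rewrite cabs_gauss ler_expR.
  have X : `|x - x0| <= `|a| + `|b| + `|x0|.
    apply: le_trans (ler_normB _ _) _; rewrite lerD2r.
    have := ler_norm b; have := ler_norm (- a); rewrite normrN.
    have := normr_ge0 a; have := normr_ge0 b.
    by rewrite ler_norml; lra.
  have Yy : `|y - y0| <= `|c| + `|d| + `|y0|.
    apply: le_trans (ler_normB _ _) _; rewrite lerD2r.
    have := ler_norm d; have := ler_norm (- c); rewrite normrN.
    have := normr_ge0 c; have := normr_ge0 d.
    by rewrite ler_norml; lra.
  apply: le_trans (ler_norm _) _; rewrite normrM normrN ler_wpM2l //.
  apply: le_trans (ler_normB _ _) _; rewrite !normrX.
  by apply: lerD; rewrite lerXn2r ?nnegrE // !addr_ge0.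
pose W' := `|W| + 1; have W0 : 0 < W' by rewrite ltr_wpDl.
have L1 : 0 < L + 1 by rewrite ltr_wpDl.
have e1 : 0 < eps / (2 * W' * (L + 1)) by rewrite divr_gt0 // !mulr_gt0.
have [n hn] := hA Yb _ e1.
pose G z := F z - An n z; pose D z := An n z - A z.
have GE : rint (fun z => G z * gauss k z0 z) a b c d = 0.
  apply: goursat => // x y _ _; apply: cdiffM; last exact: cdiff_gauss.
  apply: (@cdiff_ext _ (fun w => F w + (-1) * An n w)).
    by move=> w; rewrite /G mulN1r.
  by apply: cdiffD => //; apply: cdiffM => //; exact: cdiff_cst.
have cG z : ccontz (fun z => G z * gauss k z0 z) z.
  apply: ccontzM => //; apply: cdiff_cont.
  apply: (@cdiff_ext _ (fun w => F w + (-1) * An n w)).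
    by move=> w; rewrite /G mulN1r.
  by apply: cdiffD => //; apply: cdiffM => //; exact: cdiff_cst.
have cD z : ccontz (fun z => D z * gauss k z0 z) z.
  apply: ccontzM => //; move=> eps' e0'; have e2 : 0 < eps' / 2 by rewrite divr_gt0.
  have [d1 d10 h1] := cdiff_cont (dA n z) e2; have [d2 d20 h2] := cA z _ e2.
  exists (Num.min d1 d2); first by rewrite lt_min d10.
  move=> h; rewrite lt_min => /andP[/h1 H1 /h2 H2].
  have -> : D (z + h) - D z = (An n (z + h) - An n z) - (A (z + h) - A z) by rewrite /D; ring.
  by apply: le_trans (cabsB _ _) _; rewrite [eps']splitr; exact: lerD.
have -> : (fun z => (F z - A z) * gauss k z0 z) =
    (fun z => G z * gauss k z0 z + D z * gauss k z0 z).
  by apply/funext => z; rewrite /G /D; ring.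
rewrite (rintD ab cd (fun x y _ _ => cG (x +i* y)) (fun x y _ _ => cD (x +i* y))) GE add0r.
have DB : on_rect (fun z => cabs (D z * gauss k z0 z) <= eps / (2 * W' * (L + 1)) * W') a b c d.
  move=> x y hx hy; rewrite cabsM; apply: ler_pM => //; last first.
    apply: le_trans (hW x y hx hy) _; apply: le_trans (ler_norm _) _.
    by rewrite /W' lerDl.
  rewrite /D cabsC; apply: hn; rewrite /= /Yb.
  have := ler_norm d; have := ler_norm (- c); rewrite normrN.
  have := normr_ge0 c; have := normr_ge0 d.
  by case/andP: hy; rewrite ler_norml; lra.
have := rint_bound ab cd (fun x y _ _ => cD (x +i* y)) DB; rewrite -/L => H.
apply: le_trans H _.
have -> : 2 * (eps / (2 * W' * (L + 1)) * W') * L = eps * (L / (L + 1)).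
  by field; rewrite !gt_eqF.
by rewrite ler_piMr ?(ltW e0) // ler_pdivrMr // mul1r lerDl.
Qed.

End Identity.

(** * The Wiener algebra *)

Section WienerClass.
Variable R : realType.
Implicit Types (f g F G : R -> R[i]) (a b x y M K : R) (S : pred R).
Implicit Types (p q : nat -> R[i] -> R[i]).
Local Open Scope complex_scope.

Definition w1 : R -> R := fun=> 1.

Definition npos : pred R := fun a => a <= 0.

Lemma w1_weight S : S 0 -> (forall a b, S a -> S b -> S (a + b)) -> weight S w1.
Proof. by move=> S0 SD; split; rewrite /w1 // ?mulr1 // => *; rewrite ?ler01 ?mulr1. Qed.

Lemma w1_weightT : weight predT w1. Proof. exact: w1_weight. Qed.
Lemma w1_nneg : weight nneg w1.
Proof. by apply: w1_weight; rewrite /nneg // => a b; exact: addr_ge0. Qed.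
Lemma w1_npos : weight npos w1.
Proof. by apply: w1_weight; rewrite /npos // => a b /= h1 h2; lra. Qed.

Lemma w1_ge0 a : 0 <= w1 a. Proof. exact: ler01. Qed.

Definition cauchyW S p := forall eps : R, 0 < eps -> exists n0 : nat, forall n m,
  (n0 <= n)%N -> (n0 <= m)%N -> ep S w1 eps (fun z => p n z - p m z).

(* The elements of the completion of exponential sums for the norm of the sum of the
   coefficients, as sequences of such sums. *)
Definition wseq S p := (exists K, forall n, ep S w1 K (p n)) /\ cauchyW S p.

Definition uconv f p := forall eps : R, 0 < eps -> exists n0 : nat, forall n x,
  (n0 <= n)%N -> cabs (f x - p n x%:C) <= eps.

Definition WW S f := exists2 p, wseq S p & uconv f p.

Lemma wseqS S S' p : (forall a, S a -> S' a) -> wseq S p -> wseq S' p.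
Proof.
move=> SS [[K hK] hc]; split; first by exists K => n; apply: ep_mono (hK n).
move=> eps /hc[n0 hn]; exists n0 => n m h1 h2.
by apply: ep_mono (hn n m h1 h2).
Qed.

Lemma WWS S S' f : (forall a, S a -> S' a) -> WW S f -> WW S' f.
Proof. by move=> SS [p hp hf]; exists p => //; exact: wseqS hp. Qed.

Lemma wseq_add S p q : wseq S p -> wseq S q -> wseq S (fun n z => p n z + q n z).
Proof.
move=> [[K hK] hp] [[L hL] hq]; split.
  by exists (K + L) => n; exact: ep_add.
move=> eps e0; have e2 : 0 < eps / 2 by rewrite divr_gt0.
have [n1 h1] := hp _ e2; have [n2 h2] := hq _ e2; exists (maxn n1 n2) => n m.
rewrite !geq_max => /andP[na nb] /andP[ma mb].
rewrite [eps]splitr; apply: ep_ext (ep_add (h1 n m na ma) (h2 n m nb mb)) => z.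
by rewrite addrACA opprD.
Qed.

Lemma wseq_mul S p q : weight S w1 -> wseq S p -> wseq S q ->
  wseq S (fun n z => p n z * q n z).
Proof.
move=> hw [[K hK] hp] [[L hL] hq].
have K0 : 0 <= K by exact: ep_ge0 w1_ge0 (hK 0%N).
have L0 : 0 <= L by exact: ep_ge0 w1_ge0 (hL 0%N).
split; first by exists (K * L) => n; exact: ep_mul.
move=> eps e0; have KL : 0 < K + L + 1 by rewrite ltr_wpDl // addr_ge0.
have e2 := divr_gt0 e0 KL.
have [n1 h1] := hp _ e2; have [n2 h2] := hq _ e2; exists (maxn n1 n2) => n m.
rewrite !geq_max => /andP[na nb] /andP[ma mb].
have H := ep_add (ep_mul hw (hK n) (h2 n m nb mb)) (ep_mul hw (h1 n m na ma) (hL m)).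
apply: ep_le (ep_ext _ H) => [|z]; last by ring.
rewrite [K * _]mulrC -mulrDr mulrAC ler_pdivrMr // ler_wpM2l ?(ltW e0) //.
by rewrite lerDl.
Qed.

Lemma wseq_cst S (c : R[i]) : weight S w1 -> wseq S (fun _ _ => c).
Proof.
move=> hw; split; first by exists (cabs c) => n; exact: ep_cst.
move=> eps e0; exists 0%N => n m _ _.
by apply: ep_le (ltW e0) (ep_ext _ (ep_zero _ _)) => z; rewrite subrr.
Qed.

Lemma ep_shift S S' a M (P : R[i] -> R[i]) : (forall b, S b -> S' (a + b)) ->
  ep S w1 M P -> ep S' w1 M (fun z => E a z * P z).
Proof.
move=> SS [s [h1 h2 h3]]; exists [seq (t.1, a + t.2) | t <- s]; split.
- by rewrite all_map; apply: sub_all h1 => t; exact: SS.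
- by rewrite /wn big_map.
- move=> z; rewrite h3 /ev big_map mulr_sumr; apply: eq_bigr => t _.
  by rewrite E_add /= mulrCA.
Qed.

Lemma wseq_shift S S' a p : (forall b, S b -> S' (a + b)) -> wseq S p ->
  wseq S' (fun n z => E a z * p n z).
Proof.
move=> SS [[K hK] hp]; split; first by exists K => n; exact: ep_shift (hK n).
move=> eps /hp[n0 hn]; exists n0 => n m h1 h2.
by apply: ep_ext (ep_shift SS (hn n m h1 h2)) => z; rewrite mulrBr.
Qed.

Lemma ep_real_bound S M (P : R[i] -> R[i]) x : ep S w1 M P -> cabs (P x%:C) <= M.
Proof.
by move=> h; apply: ep_bound h _ => a _; rewrite /= mulr0 expR0.
Qed.

Lemma uconv_bound S f p : wseq S p -> uconv f p ->
  exists2 K, 0 <= K & forall x, cabs (f x) <= K.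
Proof.
move=> [[K hK] _] /(_ 1 ltr01)[n0 hn].
have K0 : 0 <= K by exact: ep_ge0 w1_ge0 (hK 0%N).
exists (K + 1); first by rewrite addr_ge0.
move=> x; rewrite -[f x](subrK (p n0 x%:C)) addrC; apply: le_trans (cabsD _ _) _.
by apply: lerD; [exact: ep_real_bound (hK n0)|exact: hn].
Qed.

Lemma uconvD p q (f g : R -> R[i]) : uconv f p -> uconv g q ->
  uconv (fun x => f x + g x) (fun k z => p k z + q k z).
Proof.
move=> fp gq eps e0; have e2 : 0 < eps / 2 by rewrite divr_gt0.
have [n1 h1] := fp _ e2; have [n2 h2] := gq _ e2; exists (maxn n1 n2) => n x.
rewrite geq_max => /andP[na nb]; rewrite opprD addrACA [eps]splitr.
by apply: le_trans (cabsD _ _) _; apply: lerD; [exact: h1|exact: h2].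
Qed.

Lemma uconvM S p q (f g : R -> R[i]) : wseq S p -> wseq S q -> uconv f p -> uconv g q ->
  uconv (fun x => f x * g x) (fun k z => p k z * q k z).
Proof.
move=> hp hq fp gq.
have [K K0 hK] := uconv_bound hp fp; have [[L hL] _] := hq.
have L0 : 0 <= L by apply: ep_ge0 (hL 0%N); exact: w1_ge0.
move=> eps e0; have KL : 0 < K + L + 1 by rewrite ltr_wpDl // addr_ge0.
have e2 := divr_gt0 e0 KL.
have [n1 h1] := fp _ e2; have [n2 h2] := gq _ e2; exists (maxn n1 n2) => n x.
rewrite geq_max => /andP[na nb].
have -> : f x * g x - p n x%:C * q n x%:C =
  f x * (g x - q n x%:C) + (f x - p n x%:C) * q n x%:C by ring.
apply: le_trans (cabsD _ _) _; rewrite !cabsM.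
apply: (@le_trans _ _ (K * (eps / (K + L + 1)) + eps / (K + L + 1) * L)).
  by apply: lerD; apply: ler_pM => //; [exact: h2|exact: h1|exact: ep_real_bound (hL n)].
rewrite [K * _]mulrC -mulrDr mulrAC ler_pdivrMr // ler_wpM2l ?(ltW e0) //.
by rewrite lerDl.
Qed.

Lemma uconv_cst (c : R[i]) : uconv (fun=> c) (fun _ _ => c).
Proof. by move=> eps e0; exists 0%N => n x _; rewrite subrr cabs0 ltW. Qed.

Lemma uconv_shift a p (f : R -> R[i]) : uconv f p ->
  uconv (fun x => e a x * f x) (fun k z => E a z * p k z).
Proof.
move=> fp eps /fp[n0 hn]; exists n0 => n x /(hn n x) H.
by rewrite E_real -mulrBr cabsM cabs_e mul1r.
Qed.

Lemma WWD S f g : WW S f -> WW S g -> WW S (fun x => f x + g x).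
Proof.
move=> [p hp fp] [q hq gq]; exists (fun n z => p n z + q n z); first exact: wseq_add.
exact: uconvD.
Qed.

Lemma WWM S f g : weight S w1 -> WW S f -> WW S g -> WW S (fun x => f x * g x).
Proof.
move=> hw [p hp fp] [q hq gq]; exists (fun n z => p n z * q n z); first exact: wseq_mul.
exact: uconvM hp hq fp gq.
Qed.

Lemma WW_cst S (c : R[i]) : weight S w1 -> WW S (fun=> c).
Proof. by move=> hw; exists (fun _ _ => c); [exact: wseq_cst|exact: uconv_cst]. Qed.

Lemma WWZ S (c : R[i]) f : weight S w1 -> WW S f -> WW S (fun x => c * f x).
Proof. by move=> hw; apply: WWM => //; exact: WW_cst. Qed.

Lemma WWN S f : weight S w1 -> WW S f -> WW S (fun x => - f x).
Proof.
move=> hw /(WWZ (-1) hw)[p hp fp]; exists p => // eps /fp[n0 hn].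
by exists n0 => n x /(hn n x); rewrite mulN1r.
Qed.

Lemma WW_ext S f g : f =1 g -> WW S f -> WW S g.
Proof. by move=> /funext ->. Qed.

Lemma WW_shift S S' a f : (forall b, S b -> S' (a + b)) -> WW S f ->
  WW S' (fun x => e a x * f x).
Proof.
move=> SS [p hp fp]; exists (fun n z => E a z * p n z); first exact: wseq_shift hp.
exact: uconv_shift.
Qed.

Lemma WW_e S a : S a -> WW S (e a).
Proof.
move=> Sa; have h0 : WW (pred1 0) (fun=> 1 : R[i]).
  apply: WW_cst; apply: w1_weight; rewrite /= ?eqxx // => b c.
  by move=> /= /eqP -> /eqP ->; rewrite addr0.
apply: (@WW_ext _ (fun x => e a x * 1)); first by move=> x; rewrite mulr1.
by apply: WW_shift h0 => b /= /eqP ->; rewrite addr0.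
Qed.

Lemma wseq_cvg S p : wseq S p -> exists f, uconv f p.
Proof.
move=> [_ hp]; have /choice[f hf] : forall x : R, exists l, cvgC (fun n => p n x%:C) l.
  move=> x; apply: cauchyC_cvg => eps /hp[n0 hn]; exists n0 => n m h1 h2.
  exact: ep_real_bound (hn n m h1 h2).
exists f => eps /hp[n0 hn]; exists n0 => n x n0n.
apply: (cvgC_le (n0 := n0) (hf x)) => m n0m.
exact: ep_real_bound (hn m n n0m n0n).
Qed.

(** Truncation is linear on functions by [ev_filter] and does not raise the norm, so the truncated
    sequences remain Cauchy, although the list representing each [p n] is chosen arbitrarily. *)
Lemma cauchyW_split S p : cauchyW predT p -> (exists K, forall n, ep predT w1 K (p n)) ->
  exists q r, [/\ wseq S q, wseq (predC S) r & forall n z, p n z = q n z + r n z].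
Proof.
move=> hp [K hK].
have /choice[s hs] := hK.
pose q n := ev [seq t <- s n | S t.2]; pose r n := ev [seq t <- s n | predC S t.2].
have pE n z : p n z = q n z + r n z.
  have [_ _ ->] := hs n; rewrite /q /r /ev !big_filter (bigID (fun t => S t.2)) /=.
  by [].
pose neg_s (l : seq (R[i] * R)) := [seq (- t.1, t.2) | t <- l].
have part (U : pred R) : wseq U (fun n => ev [seq t <- s n | U t.2]).
  split.
    exists K => n; have [_ h _] := hs n.
    by apply: ep_le (ep_ev _ (filter_all _ _)); exact: le_trans (wn_filter _ _ w1_ge0) h.
  move=> eps /hp[n0 hn]; exists n0 => n m h1 h2.
  have [l [_ l2 l3]] := hn n m h1 h2.
  have evN (l' : seq (R[i] * R)) z : ev (neg_s l') z = - ev l' z.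
    by rewrite /ev big_map -sumrN; apply: eq_bigr => t _; rewrite mulNr.
  exists [seq t <- l | U t.2]; split.
  - exact: filter_all.
  - exact: le_trans (wn_filter _ _ w1_ge0) l2.
  - move=> z; rewrite -(@ev_filter _ U (s n ++ neg_s (s m)) l).
      rewrite filter_cat ev_cat filter_map -[map _ _]/(neg_s _) evN.
      by [].
    move=> x; rewrite ev_cat evN -l3.
    by have [_ _ ->] := hs n; have [_ _ ->] := hs m.
by exists q, r; split => //; exact: part.
Qed.

Lemma WW_split S f : WW predT f -> exists f1 f2,
  [/\ WW S f1, WW (predC S) f2 & forall x, f x = f1 x + f2 x].
Proof.
move=> [p [pK hp] fp]; have [q [r [hq hr pE]]] := cauchyW_split S hp pK.
have [f1 h1] := wseq_cvg hq; have [f2 h2] := wseq_cvg hr.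
exists f1, f2; split; [by exists q|by exists r|].
move=> x; apply: (@cvgC_uniq _ (fun n => p n x%:C)).
  move=> eps /fp[n0 hn]; exists n0 => n /(hn n x); by rewrite cabsC.
have -> : (fun n => p n x%:C) = (fun n => q n x%:C + r n x%:C) by apply/funext.
apply: cvgCD => eps e0.
  by have [n0 hn] := h1 _ e0; exists n0 => n /(hn n x); rewrite cabsC.
by have [n0 hn] := h2 _ e0; exists n0 => n /(hn n x); rewrite cabsC.
Qed.

Lemma WW_AP S f : WW S f -> AP f.
Proof.
move=> [p [[K hK] _] fp] eps /fp[n0 hn].
have [s [_ _ hs]] := hK n0; exists (fun x => ev s x%:C); first exact: ev_trig_poly.
by move=> x; rewrite -hs; exact: hn.
Qed.

Lemma uconv_coef f p s a : AP f -> uconv f p -> (forall n z, p n z = ev (s n) z) ->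
  cvgC (fun n => coefl (s n) a) (bohr_coef f a).
Proof.
move=> hf fp ps eps /fp[n0 hn]; exists n0 => n n0n; rewrite cabsC.
by apply: bohr_coef_near => // x; rewrite -ps; exact: hn.
Qed.

Lemma WW_Omega S f a : WW S f -> Omega f a -> S a.
Proof.
move=> hf; have hA := WW_AP hf; move: hf => [p [[K /choice[s hs]] _] fp] fa.
apply/negPn/negP => Sa; move: fa; rewrite /Omega /= => /negP; apply.
have h : cvgC (fun n => coefl (s n) a) (bohr_coef f a).
  by apply: uconv_coef hA fp _ => n z; have [_ _] := hs n.
apply/eqP; apply: cvgC_uniq h _.
rewrite (_ : (fun n => _) = fun=> 0); first exact: cvgC_cst.
apply/funext => n; rewrite /coefl big_seq_cond big_pred0 // => t.
apply/negbTE/negP => /andP[ts /eqP ta].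
by have [/allP /(_ t ts)] := hs n; rewrite ta (negPf Sa).
Qed.

Lemma WW_sum S f : WW S f -> exists K, forall X : seq R, uniq X ->
  \sum_(a <- X) cabs (bohr_coef f a) <= K.
Proof.
move=> hf; have hA := WW_AP hf; move: hf => [p [[K /choice[s hs]] _] fp].
exists K => X uX; apply/ler_addgt0Pr => eps e0.
have N0 : 0 < (size X)%:R + 1 :> R by rewrite ltr_wpDl.
have [n0 hn] := fp _ (divr_gt0 e0 N0); have [_ s2 s3] := hs n0.
apply: (@le_trans _ _ (\sum_(a <- X) (cabs (coefl (s n0) a) * w1 a + eps / ((size X)%:R + 1)))).
  apply: ler_sum => a _; rewrite mulr1 -lerBlDl; apply: le_trans (cabs_le_dist _ _) _.
  by apply: bohr_coef_near => // x; rewrite -s3; exact: hn.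
rewrite big_split /=; apply: lerD.
  by apply: le_trans s2; apply: wn_coefl => //; exact: w1_ge0.
rewrite big_const_seq count_predT iter_addr_0 -[_ *+ size X]mulr_natl.
rewrite mulrA ler_pdivrMr // [_ * eps]mulrC ler_wpM2l ?(ltW e0) //.
by rewrite lerDl.
Qed.

Lemma esum_bounded (A : set R) (u : R -> R) K :
  (forall X : seq R, uniq X -> {in X, forall a, A a} -> \sum_(a <- X) u a <= K) ->
  (\esum_(a in A) (u a)%:E < +oo)%E.
Proof.
move=> hK; apply: le_lt_trans (ltry K).
apply: ge_ereal_sup => _ [X [/finite_seqP[s ->] sA] <-].
have -> : [set` s] = [set` undup s] by apply/seteqP; split=> x /=; rewrite mem_undup.
rewrite -fsbig_seq ?undup_uniq // sumEFin lee_fin; apply: hK; first exact: undup_uniq.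
by move=> a; rewrite mem_undup => /sA.
Qed.

Lemma bounded_esum (A : set R) (u : R -> R) : (forall a, 0 <= u a) ->
  (\esum_(a in A) (u a)%:E < +oo)%E ->
  exists K, forall X : seq R, uniq X -> {in X, forall a, A a} -> \sum_(a <- X) u a <= K.
Proof.
move=> u0 h; exists (fine (\esum_(a in A) (u a)%:E)) => X uX XA.
rewrite -lee_fin fineK; last first.
  by rewrite ge0_fin_numE // esum_ge0 // => a _; rewrite lee_fin.
rewrite -sumEFin; apply: esum_ge; exists [set` X]; last by rewrite -fsbig_seq.
by split; [exact: finite_seq|move=> a; exact: XA].
Qed.

Lemma WW_APW S f : WW S f -> APW f.
Proof.
move=> hf; split; first exact: WW_AP hf.
have [K hK] := WW_sum hf; apply: (esum_bounded (K := K)) => X uX _.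
exact: hK.
Qed.

Lemma WW_APW_plus f : WW nneg f -> APW_plus f.
Proof.
move=> hf; split; last exact: WW_APW hf.
by split; [exact: WW_AP hf|move=> a; exact: WW_Omega hf].
Qed.

Lemma WW_APW_minus f : WW npos f -> APW_minus f.
Proof.
move=> hf; split; last exact: WW_APW hf.
by split; [exact: WW_AP hf|move=> a; exact: WW_Omega hf].
Qed.

Lemma AP_sub f g : AP f -> AP g -> AP (fun x => f x - g x).
Proof.
move=> hf hg eps e0; have e2 : 0 < eps / 2 by rewrite divr_gt0.
have [s hs] := AP_ev hf e2; have [r hr] := AP_ev hg e2.
exists (fun x => ev (s ++ [seq (- t.1, t.2) | t <- r]) x%:C); first exact: ev_trig_poly.
move=> x; rewrite ev_cat.
have -> : ev [seq (- t.1, t.2) | t <- r] x%:C = - ev r x%:C.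
  by rewrite /ev big_map -sumrN; apply: eq_bigr => t _; rewrite mulNr.
have -> : f x - g x - (ev s x%:C - ev r x%:C) = (f x - ev s x%:C) - (g x - ev r x%:C) by ring.
by apply: le_trans (cabsB _ _) _; rewrite [eps]splitr; exact: lerD.
Qed.

Lemma AP_eq f g : AP f -> AP g -> (forall a, bohr_coef f a = bohr_coef g a) -> f =1 g.
Proof.
move=> hf hg h; have hfg := AP_sub hf hg.
suff h0 x : f x - g x = 0 by move=> x; apply/eqP; rewrite -subr_eq0 h0.
apply: (AP_unique hfg) => a.
have E : bohr_coef f a = bohr_coef (fun x => f x - g x) a + bohr_coef g a.
  have fE : (fun x => f x - g x + g x) = f by apply/funext => y; rewrite subrK.
  by rewrite -(bohr_coefD a hfg hg) fE.
by apply: (addIr (bohr_coef g a)); rewrite -E add0r h.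
Qed.

(** The spectrum is not enumerated: [X n] is any finite part whose sum comes within [1 / (n + 1)] of
    the supremum. Two partial sums differ on a symmetric difference, of weight at most the two
    defects. The limit has the coefficients of [f], hence is [f] by uniqueness. *)
Theorem AP_series f S K : AP f -> (forall a, Omega f a -> S a) ->
  (forall X : seq R, uniq X -> {in X, forall a, Omega f a} ->
    \sum_(a <- X) cabs (bohr_coef f a) <= K) ->
  exists s : nat -> seq (R[i] * R), [/\ wseq S (fun n => ev (s n)),
    uconv f (fun n => ev (s n)) & forall a, cvgC (fun n => coefl (s n) a) (bohr_coef f a)].
Proof.
move=> hf OS hK.
pose c a := bohr_coef f a.
pose Z := [set y | exists X : seq R, [/\ uniq X, {in X, forall a, Omega f a} &
  y = \sum_(a <- X) cabs (c a)]].
have supZ : has_sup Z.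
  split; first by exists 0, [::]; split => //; rewrite big_nil.
  by exists K => _ [X [uX XO ->]]; exact: hK.
have inv0 n : 0 < n.+1%:R^-1 :> R by rewrite invr_gt0.
have /choice[X hX] : forall n : nat, exists X : seq R, [/\ uniq X,
    {in X, forall a, Omega f a} & sup Z - n.+1%:R^-1 <= \sum_(a <- X) cabs (c a)].
  move=> n; have [_ [X [uX XO ->]] h] := sup_adherent (inv0 n) supZ.
  by exists X; split => //; exact: ltW.
have tail n (Y : seq R) : uniq Y -> {in Y, forall a, Omega f a} ->
    {in Y, forall a, a \notin X n} -> \sum_(a <- Y) cabs (c a) <= n.+1%:R^-1.
  move=> uY YO YX; have [uX XO hs] := hX n.
  have : \sum_(a <- X n ++ Y) cabs (c a) <= sup Z.
    apply: (sup_upper_bound supZ); exists (X n ++ Y); split => //.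
      rewrite cat_uniq uX uY andbT; apply/hasPn => a aY; exact: YX.
    by move=> a; rewrite mem_cat => /orP[/XO|/YO].
  rewrite big_cat /=; move: hs; move: (n.+1%:R^-1) (sup Z) => u v; lra.
pose s n := [seq (c a, a) | a <- X n].
have sS n : all (fun t => S t.2) (s n).
  rewrite all_map; apply/allP => a aX /=; apply: OS; have [_ XO _] := hX n.
  exact: XO.
have small (eps : R) : 0 < eps -> exists n0 : nat, forall n, (n0 <= n)%N -> n.+1%:R^-1 <= eps.
  move=> e0; exists (Num.bound eps^-1) => n hn.
  rewrite -[eps]invrK lef_pV2 ?posrE ?invr_gt0 //.
  apply: ltW; apply: lt_le_trans (archi_boundP _) _; first by rewrite invr_ge0 ltW.
  by rewrite ler_nat ltnW.
have cau : cauchyW S (fun n => ev (s n)).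
  move=> eps e0; have e2 : 0 < eps / 2 by rewrite divr_gt0.
  have [n0 hn] := small _ e2; exists n0 => n m h1 h2.
  pose dn := [seq a <- X n | a \notin X m]; pose dm := [seq a <- X m | a \notin X n].
  exists ([seq (c a, a) | a <- dn] ++ [seq (- c a, a) | a <- dm]).
  have [un On _] := hX n; have [um Om _] := hX m.
  split.
  - rewrite all_cat !all_map; apply/andP; split; apply/allP => a; rewrite mem_filter /=.
      by move=> /andP[_ /On]; exact: OS.
    by move=> /andP[_ /Om]; exact: OS.
  - rewrite wn_cat [eps]splitr; apply: lerD; rewrite /wn big_map /=.
      apply: le_trans (hn m h2); apply: le_trans (tail m dn _ _ _).
      + by apply: ler_sum => a _; rewrite mulr1.
      + exact: filter_uniq.
      + by move=> a; rewrite mem_filter => /andP[_ /On].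
      + by move=> a; rewrite mem_filter => /andP[].
    apply: le_trans (hn n h1); apply: le_trans (tail n dm _ _ _).
    + by apply: ler_sum => a _; rewrite mulr1 cabsN.
    + exact: filter_uniq.
    + by move=> a; rewrite mem_filter => /andP[_ /Om].
    + by move=> a; rewrite mem_filter => /andP[].
  - move=> z; rewrite ev_cat /ev !big_map /dn /dm !big_filter /=.
    rewrite (bigID (fun a => a \in X m)) /= [X in _ - X](bigID (fun a => a \in X n)) /=.
    have -> : \sum_(i <- X n | i \in X m) c i * E i z =
        \sum_(i <- X m | i \in X n) c i * E i z.
      rewrite -big_filter -[RHS]big_filter; apply: perm_big; apply: uniq_perm; rewrite ?filter_uniq //.
      by move=> a; rewrite !mem_filter andbC.
    rewrite opprD addrACA subrr add0r -sumrN; congr (_ + _).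
    by apply: eq_bigr => a _; rewrite mulNr.
have hw : wseq S (fun n => ev (s n)).
  split => //; exists K => n; apply: ep_le (ep_ev _ (sS n)).
  have [uX XO _] := hX n; apply: le_trans (hK _ uX XO).
  by rewrite /wn big_map /=; apply: ler_sum => a _; rewrite mulr1.
have coefs a : cvgC (fun n => coefl (s n) a) (c a).
  move=> eps eps0; have [n0 hn] := small _ eps0; exists n0 => n n0n; rewrite cabsC.
  have [uX XO _] := hX n.
  have -> : coefl (s n) a = if a \in X n then c a else 0.
    rewrite /coefl big_map /=; case: ifP => aX.
      rewrite big_mkcond (bigD1_seq a) //= eqxx big1 ?addr0 // => b /negPf ->.
      by [].
    rewrite big_seq_cond big_pred0 // => b; apply/negbTE/negP => /andP[bX /eqP ba].
    by rewrite -ba bX in aX.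
  case: ifP => aX; first by rewrite subrr cabs0 ltW.
  rewrite subr0; have [->|ca] := eqVneq (c a) 0; first by rewrite cabs0 ltW.
  apply: le_trans (hn n n0n); have H := tail n [:: a] isT; rewrite big_seq1 in H.
  by apply: H => b; rewrite inE => /eqP ->; [exact: ca|rewrite aX].
have [F hF] := wseq_cvg hw.
have AF : AP F by apply: (@WW_AP S); exists (fun n => ev (s n)).
have fF : f =1 F.
  apply: (AP_eq hf AF) => a; apply: (cvgC_uniq (coefs a)).
  exact: uconv_coef AF hF _.
exists s; split=> // eps /hF[n0 hn]; exists n0 => n x n0n.
by rewrite fF; exact: hn.
Qed.

End WienerClass.
Arguments w1 {R}.
Arguments npos {R}.

(** * The corona theorem *)

Section Corona.
Variable R : realType.
Implicit Types (a b c d x y eta rho : R) (S : pred R) (w : R -> R).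
Implicit Types (P Q : R[i] -> R[i]) (n m k : nat).
Local Open Scope complex_scope.

Lemma expr_small (q eps : R) : 0 <= q < 1 -> 0 < eps ->
  exists n0 : nat, forall n, (n0 <= n)%N -> q ^+ n <= eps.
Proof.
move=> /andP[q0 q1] e0; have qn : `|q| < 1 by rewrite ger0_norm.
have /cvgrPdist_le/(_ _ e0)[n0 _ hn] := cvg_expr qn.
by exists n0 => n /hn /=; rewrite sub0r normrN ger0_norm // exprn_ge0.
Qed.

Lemma poly_expr_small (d : nat) (q eps : R) : 0 <= q < 1 -> 0 < eps ->
  exists n, (n.+1 ^ d)%:R * q ^+ n <= eps.
Proof.
move=> /andP[q0 q1] e0; have [->|qn0] := eqVneq q 0.
  by exists 1%N; rewrite expr1 mulr0 ltW.
have {qn0}q0 : 0 < q by rewrite lt_def qn0.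
pose r := q^-1 - 1; have r0 : 0 < r by rewrite subr_gt0 invf_gt1.
have qr : q = (1 + r)^-1 by rewrite /r addrC subrK invrK.
(* (1 + r)^(k * d.+1) >= (1 + k r)^(d.+1), so compare along multiples of d.+1. *)
have bern (k : nat) : 1 + k%:R * r <= (1 + r) ^+ k.
  elim: k => [|k IH]; first by rewrite mul0r addr0 expr0.
  rewrite exprS -natr1; apply: le_trans (ler_wpM2l _ IH); last by rewrite addr_ge0 // ltW.
  have : 0 <= k%:R * r * r by rewrite !mulr_ge0 // ltW.
  nra.
(* [A] bounds the [d]-th power of the ratio of [k * d.+1 + 1] to [1 + k * r]; one factor [1 + k * r]
   is left over to beat [A / eps]. *)
pose A := ((d.+2)%:R / Num.min 1 r) ^+ d; have m0 : 0 < Num.min 1 r by rewrite lt_min ltr01.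
have A0 : 0 <= A by rewrite exprn_ge0 // divr_ge0 // ltW.
pose k := Num.bound (A / eps / r).
exists (k * d.+1)%N.
have kb : A / eps <= 1 + k%:R * r.
  have h0 : 0 <= A / eps / r by rewrite divr_ge0 ?(ltW r0) // divr_ge0 // ltW.
  have := archi_boundP h0; rewrite -/k ltr_pdivrMr // => h.
  by apply: le_trans (ltW h) _; rewrite lerDr.
have p0 : 0 < 1 + k%:R * r by rewrite ltr_wpDr // mulr_ge0 // ltW.
have h1 : (k * d.+1).+1%:R <= (d.+2)%:R / Num.min 1 r * (1 + k%:R * r).
  rewrite mulrAC ler_pdivlMr //.
  apply: (@le_trans _ _ ((d.+2)%:R * (1 + k%:R) * Num.min 1 r)).
    rewrite ler_wpM2r ?(ltW m0) // -natr1 natrM -[d.+2%:R]natr1.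
    have : 0 <= k%:R :> R by []. have : 0 <= d.+1%:R :> R by []. nra.
  rewrite -mulrA ler_wpM2l //; have : Num.min 1 r <= 1 by rewrite ge_min lexx.
  have : Num.min 1 r <= r by rewrite ge_min lexx orbT.
  have : 0 <= k%:R :> R by []. nra.
rewrite qr exprVn natrX.
apply: (@le_trans _ _ ((A * (1 + k%:R * r) ^+ d) / (1 + k%:R * r) ^+ d.+1)).
  have r1 : 0 < 1 + r by rewrite ltr_wpDl.
  apply: ler_pM.
  - by apply: exprn_ge0; exact: ler0n.
  - by rewrite invr_ge0; apply: exprn_ge0; exact: ltW.
  - rewrite /A -exprMn; apply: lerXn2r; rewrite ?nnegrE; [exact: ler0n| |exact: h1].
    by rewrite mulr_ge0 ?(ltW p0) // divr_ge0 // ltW.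
  - rewrite lef_pV2 ?posrE; [|exact: exprn_gt0|exact: exprn_gt0].
    rewrite exprM; apply: lerXn2r; rewrite ?nnegrE; [exact: ltW|exact: exprn_ge0 (ltW r1)|exact: bern].
rewrite exprS -mulf_div divff ?mulr1; last by rewrite expf_neq0 // gt_eqF.
by rewrite ler_pdivrMr // mulrC -ler_pdivrMr.
Qed.

Lemma sw_mid y0 y1 u v a : y0 <= u -> u <= y1 -> y0 <= v -> v <= y1 ->
  sw u v a <= sw y0 y1 a.
Proof.
move=> h1 h2 h3 h4; rewrite /sw ge_max !le_max !ler_expR.
by have [a0|a0] := leP 0 a; apply/andP; split; apply/orP; [left|left|right|right];
  rewrite !mulNr lerN2; nra.
Qed.

Lemma sw_le1 y0 y1 a : 0 <= y0 -> 0 <= y1 -> 0 <= a -> sw y0 y1 a <= w1 a.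
Proof.
move=> h0 h1 a0; rewrite /sw /w1 ge_max -expR0 !ler_expR !mulNr !oppr_le0.
by rewrite !mulr_ge0.
Qed.

Lemma star_sub y P Q z : star y (fun z => P z - Q z) z = star y P z - star y Q z.
Proof.
rewrite /star; move: (P _) (Q _) => [u v] [u' v'].
by simpc; congr (_ +i* _); ring.
Qed.

(** Only finitely many frequencies occur, bounded by [L], so a change of height by [d] costs at most
    a factor [expR (L * d)]. *)
Lemma ep_strip y M P tau : ep predT (sw y y) M P -> 0 < tau ->
  exists2 d0 : R, 0 < d0 & forall d, d <= d0 -> 0 <= d ->
    ep predT (sw (y - d) (y + d)) (M + tau) P.
Proof.
move=> hP t0; have M0 : 0 <= M by apply: ep_ge0 hP; exact: sw_ge0.
have [s [s1 s2 s3]] := hP.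
pose L := \sum_(t <- s) `|t.2|.
have L0 : 0 <= L by rewrite sumr_ge0.
have LM t : t \in s -> `|t.2| <= L.
  by move=> ts; rewrite /L (big_rem t ts) /= lerDl sumr_ge0.
pose r := tau / (M + 1); have M1 : 0 < M + 1 by rewrite ltr_wpDl.
have r0 : 0 < r by rewrite divr_gt0.
have L1 : 0 < L + 1 by rewrite ltr_wpDl.
exists (ln (1 + r) / (L + 1)); first by rewrite divr_gt0 // ln_gt0 // ltrDl.
move=> d dd0 d0; exists s; split => //.
have eL : expR (L * d) <= 1 + r.
  rewrite -[leRHS]lnK ?posrE ?addr_gt0 // ler_expR.
  rewrite ler_pdivlMr // in dd0; apply: le_trans dd0.
  by rewrite [L * d]mulrC ler_wpM2l // lerDl.
apply: (@le_trans _ _ (expR (L * d) * wn (sw y y) s)).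
  rewrite /wn mulr_sumr big_seq [leRHS]big_seq; apply: ler_sum => t ts.
  rewrite mulrCA ler_wpM2l // /sw maxxx -expRD ge_max !ler_expR.
  have := LM t ts; rewrite ler_norml => /andP[h1 h2].
  by apply/andP; split; nra.
apply: (@le_trans _ _ ((1 + r) * M)).
  by apply: ler_pM => //; apply: wn_ge0 => a; exact: sw_ge0.
rewrite mulrDl mul1r lerD2l /r mulrAC ler_pdivrMr // ler_wpM2l ?(ltW t0) //.
by rewrite lerDl.
Qed.

Variables f1 f2 : nat -> R[i] -> R[i].
Hypotheses (hf1 : wseq nneg f1) (hf2 : wseq nneg f2).

Definition residual n P1 P2 z := f1 n z * P1 z + f2 n z * P2 z - 1.

(** [C] comes before [eps] because [glue] chooses its precision from the size of the multipliers.
    The residual is required to be small for all late indices at once, so that the same multipliers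
    also serve the limit functions. *)
Definition solv S w := exists C, forall eps : R, 0 < eps -> exists P1 P2 n0,
  [/\ ep S w C P1, ep S w C P2 &
    forall n, (n0 <= n)%N -> ep S w eps (residual n P1 P2)].

Lemma f_bound : exists2 K, 0 <= K & forall n, ep nneg w1 K (f1 n) /\ ep nneg w1 K (f2 n).
Proof.
have [[K1 h1] _] := hf1; have [[K2 h2] _] := hf2.
have K10 : 0 <= K1 by apply: ep_ge0 (h1 0%N); exact: w1_ge0.
have K20 : 0 <= K2 by apply: ep_ge0 (h2 0%N); exact: w1_ge0.
exists (K1 + K2); first exact: addr_ge0.
by move=> n; split; [apply: ep_le (h1 n); rewrite lerDl|apply: ep_le (h2 n); rewrite lerDr].
Qed.

Lemma f_cauchy eps : 0 < eps -> exists n0, forall n m, (n0 <= n)%N -> (n0 <= m)%N ->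
  ep nneg w1 eps (fun z => f1 n z - f1 m z) /\ ep nneg w1 eps (fun z => f2 n z - f2 m z).
Proof.
move=> e0; have [_ h1] := hf1; have [_ h2] := hf2.
have [n1 H1] := h1 _ e0; have [n2 H2] := h2 _ e0; exists (maxn n1 n2) => n m.
rewrite !geq_max => /andP[na nb] /andP[ma mb].
by split; [exact: H1|exact: H2].
Qed.

Section Boost.
Variables (S : pred R) (w : R -> R).
Hypotheses (hw : weight S w) (nS : forall a, nneg a -> S a)
  (w_le1 : forall a, 0 <= a -> w a <= w1 a).

Lemma ep_nneg M P : ep nneg w1 M P -> ep S w M P.
Proof. by apply: ep_mono => // a; exact: w_le1. Qed.

Lemma residual_diff n m eta C P1 P2 :
  ep nneg w1 eta (fun z => f1 n z - f1 m z) -> ep nneg w1 eta (fun z => f2 n z - f2 m z) ->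
  ep S w C P1 -> ep S w C P2 ->
  ep S w (2 * eta * C) (fun z => residual n P1 P2 z - residual m P1 P2 z).
Proof.
move=> h1 h2 H1 H2.
have H := ep_add (ep_mul hw (ep_nneg h1) H1) (ep_mul hw (ep_nneg h2) H2).
apply: ep_le (ep_ext _ H) => [|z]; first by rewrite -mulrDl -mulr2n mulr_natl.
by rewrite /residual; ring.
Qed.

(** Multiplying by a partial Neumann series for the inverse of [1 + residual] turns the residual
    into its [k]-th power, up to sign. The series is formed at one index [m]; later indices differ
    from it by a Cauchy error. *)
Lemma boost P1 P2 C q n0 : q < 1 -> ep S w C P1 -> ep S w C P2 ->
  (forall n, (n0 <= n)%N -> ep S w q (residual n P1 P2)) -> solv S w.
Proof.
move=> q1 H1 H2 Hq; have [_ _ w0 _ _] := hw.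
have q0 : 0 <= q by apply: ep_ge0 w0 (Hq n0 (leqnn _)).
have C0 : 0 <= C by apply: ep_ge0 w0 H1.
have q1' : 0 < 1 - q by rewrite subr_gt0.
exists (C * (1 - q)^-1) => eps e0; have e2 : 0 < eps / 2 by rewrite divr_gt0.
have [k hk] := expr_small (introT andP (conj q0 q1)) e2.
have D0 : 0 < 2 * (C + 1) / (1 - q) by rewrite divr_gt0 ?mulr_gt0 // ltr_wpDl.
have [n1 hn1] := f_cauchy (divr_gt0 e2 D0).
pose m := maxn n0 n1.
pose G z := \sum_(j < k) (- residual m P1 P2 z) ^+ j.
have hG : ep S w (1 - q)^-1 G.
  apply: ep_geom => //; last by rewrite q0 q1.
  by apply: ep_opp; apply: Hq; exact: leq_maxl.
exists (fun z => P1 z * G z), (fun z => P2 z * G z), m; split.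
- exact: ep_mul.
- exact: ep_mul.
- move=> n mn.
  have [d1 d2] := hn1 n m (leq_trans (leq_maxr _ _) mn) (leq_maxr _ _).
  have D := ep_mul hw (residual_diff d1 d2 H1 H2) hG.
  have X := ep_opp (ep_exp hw k (ep_opp (Hq m (leq_maxl _ _)))).
  apply: ep_le (ep_ext _ (ep_add X D)) => [|z].
    rewrite [leRHS]splitr; apply: lerD; first exact: hk.
    have -> : 2 * (eps / 2 / (2 * (C + 1) / (1 - q))) * C / (1 - q) =
       (C / (C + 1)) * (eps / 2).
      by field; rewrite !gt_eqF // ltr_wpDl.
    by rewrite ler_piMl ?(ltW e2) // ler_pdivrMr ?ltr_wpDl // mul1r lerDl.
  have hG1 : (1 + residual m P1 P2 z) * G z = 1 - (- residual m P1 P2 z) ^+ k.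
    have := subrX1 (- residual m P1 P2 z) k; rewrite -/(G z) => E1.
    by rewrite -[RHS]opprB E1 -mulNr; congr (_ * _); ring.
  have -> : residual n (fun z => P1 z * G z) (fun z => P2 z * G z) z =
    (1 + residual m P1 P2 z) * G z - 1 + (residual n P1 P2 z - residual m P1 P2 z) * G z.
    by rewrite /residual; ring.
  by rewrite hG1; ring.
Qed.

End Boost.

(** Let [p] be the solution with nonnegative frequencies and [q] the one on the strip. Up to
    residuals, [p - q] is [k] times [(f2, - f1)] with [k = p1 * q2 - p2 * q1]. Removing the share of
    [kp] from [p] or adding that of [km] to [q] gives the same pair: the first form shows
    nonnegative frequencies, the second is bounded down to [y0], since a negative part grows upwards
    only. *)
Lemma glue y0 y1 y2 : 0 <= y0 -> y0 <= y1 -> y1 <= y2 ->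
  solv nneg (sw y1 y1) -> solv predT (sw y0 y2) -> solv nneg (sw y0 y0).
Proof.
move=> y00 y01 y12 [C1 S1] [C2 S2].
have y02 : y0 <= y2 by exact: le_trans y12.
have [K K0 hK] := f_bound.
have w0 (u v a : R) : 0 <= sw u v a by exact: sw_ge0.
have hT (u v : R) : weight predT (sw u v) by exact: sw_weightT.
have C10 : 0 <= C1.
  by have [P1 [_ [_ [h _ _]]]] := S1 1 ltr01; exact: ep_ge0 (w0 _ _) h.
have C20 : 0 <= C2.
  by have [P1 [_ [_ [h _ _]]]] := S2 1 ltr01; exact: ep_ge0 (w0 _ _) h.
have up M P : ep nneg (sw y1 y1) M P -> ep predT (sw y1 y2) M P.
  apply: ep_mono => // a a0.
  by rewrite (sw_nneg y12 a0) (sw_nneg (lexx y1) a0).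
have mid M P : ep predT (sw y0 y2) M P -> ep predT (sw y1 y2) M P.
  by apply: ep_mono => // a _; exact: sw_mid.
have down M P : ep (predC nneg) (sw y1 y2) M P -> ep predT (sw y0 y2) M P.
  apply: ep_mono => // a; rewrite /= /nneg -ltNge => /ltW a0.
  by rewrite (sw_neg y12 a0) (sw_neg y02 a0).
have fT M P : ep nneg w1 M P -> ep predT (sw y0 y2) M P.
  apply: ep_mono => // a a0; apply: sw_le1 => //; exact: le_trans y02.
have fP M P : ep nneg w1 M P -> ep nneg (sw y1 y2) M P.
  by apply: ep_mono => // a a0; apply: sw_le1 => //; apply: le_trans y00 _ => //; exact: le_trans y12.
have hN := @sw_weight R y1 y2.
pose B := 1 + 2 * K * (C1 + C2); have B0 : 0 < B by rewrite ltr_wpDr // !mulr_ge0 // addr_ge0.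
exists (C2 + 2 * C1 * C2 * K + (C1 + C2)) => eps e0.
have e2 : 0 < eps / 2 by rewrite divr_gt0.
pose e' := Num.min 1 (eps / 2 / B).
have e'0 : 0 < e' by rewrite lt_min ltr01 divr_gt0.
have e'1 : e' <= 1 by rewrite ge_min lexx.
have e'B : B * e' <= eps / 2.
  by rewrite mulrC -ler_pdivlMr // ge_min lexx orbT.
have [p1 [p2 [n1 [hp1 hp2 hE1]]]] := S1 _ e'0.
have [q1 [q2 [n2 [hq1 hq2 hE2]]]] := S2 _ e'0.
have J0 : 0 < 4 * C1 * C2 * K + 1 by rewrite ltr_wpDl // !mulr_ge0.
pose eta := eps / 2 / (4 * C1 * C2 * K + 1).
have eta0 : 0 < eta by rewrite divr_gt0.
have [n3 hn3] := f_cauchy eta0.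
pose m := maxn n1 (maxn n2 n3).
have [mn1 mn2 mn3] : [/\ (n1 <= m)%N, (n2 <= m)%N & (n3 <= m)%N].
  by rewrite /m !leq_max !leqnn !orbT.
have [F1 F2] := hK m.
pose k z := p1 z * q2 z - p2 z * q1 z.
have hk : ep predT (sw y1 y2) (2 * C1 * C2) k.
  have H := ep_sub (ep_mul (hT _ _) (up _ _ hp1) (mid _ _ hq2))
                   (ep_mul (hT _ _) (up _ _ hp2) (mid _ _ hq1)).
  apply: ep_le H.
  by rewrite -mulr2n -mulrA mulr_natl.
have [kp [km [hkp /down hkm kE]]] := ep_split nneg (w0 _ _) hk.
have hE1m := up _ _ (hE1 m mn1); have hE2m := mid _ _ (hE2 m mn2).
pose E1 := residual m p1 p2; pose E2 := residual m q1 q2.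
(* The residuals enter the difference of the solutions through [d1] and [d2], of size proportional
   to [e']; these are split in the same way as [k]. *)
pose d1 z := p1 z * E2 z - q1 z * E1 z; pose d2 z := p2 z * E2 z - q2 z * E1 z.
have hd1 : ep predT (sw y1 y2) ((C1 + C2) * e') d1.
  rewrite mulrDl; apply: ep_sub; apply: ep_mul => //; [exact: up|exact: mid].
have hd2 : ep predT (sw y1 y2) ((C1 + C2) * e') d2.
  rewrite mulrDl; apply: ep_sub; apply: ep_mul => //; [exact: up|exact: mid].
have [d1p [d1m [hd1p /down hd1m d1E]]] := ep_split nneg (w0 _ _) hd1.
have [d2p [d2m [hd2p /down hd2m d2E]]] := ep_split nneg (w0 _ _) hd2.
pose G1 z := q1 z + km z * f2 m z - d1m z.
pose G2 z := q2 z - km z * f1 m z - d2m z.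
have hG1 : ep predT (sw y0 y2) (C2 + 2 * C1 * C2 * K + (C1 + C2) * e') G1.
  apply: ep_sub => //; apply: ep_add => //; apply: ep_mul => //; exact: fT.
have hG2 : ep predT (sw y0 y2) (C2 + 2 * C1 * C2 * K + (C1 + C2) * e') G2.
  apply: ep_sub => //; apply: ep_sub => //; apply: ep_mul => //; exact: fT.
have upP M P : ep nneg (sw y1 y1) M P -> ep nneg (sw y1 y2) M P.
  by apply: ep_mono => // a a0; rewrite (sw_nneg y12 a0) (sw_nneg (lexx y1) a0).
have G1E z : G1 z = p1 z - kp z * f2 m z + d1p z.
  have h1 : d1m z = p1 z * E2 z - q1 z * E1 z - d1p z.
    by rewrite -[_ - q1 z * _]/(d1 z) d1E addrC addKr.
  have h2 : km z = p1 z * q2 z - p2 z * q1 z - kp z.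
    by rewrite -[_ - p2 z * _]/(k z) kE addrC addKr.
  by rewrite /G1 h1 h2 /E1 /E2 /residual; ring.
have G2E z : G2 z = p2 z + kp z * f1 m z + d2p z.
  have h1 : d2m z = p2 z * E2 z - q2 z * E1 z - d2p z.
    by rewrite -[_ - q2 z * _]/(d2 z) d2E addrC addKr.
  have h2 : km z = p1 z * q2 z - p2 z * q1 z - kp z.
    by rewrite -[_ - p2 z * _]/(k z) kE addrC addKr.
  by rewrite /G2 h1 h2 /E1 /E2 /residual; ring.
have hG1P : exists M, ep nneg (sw y1 y2) M G1.
  eexists; apply: (@ep_ext _ _ _ _ (fun z => p1 z - kp z * f2 m z + d1p z)) => [z|].
    by rewrite G1E.
  by apply: ep_add hd1p; apply: ep_sub (upP _ _ hp1) _; apply: ep_mul hkp (fP _ _ F2).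
have hG2P : exists M, ep nneg (sw y1 y2) M G2.
  eexists; apply: (@ep_ext _ _ _ _ (fun z => p2 z + kp z * f1 m z + d2p z)) => [z|].
    by rewrite G2E.
  by apply: ep_add hd2p; apply: ep_add (upP _ _ hp2) _; apply: ep_mul hkp (fP _ _ F1).
have [MG1 hG1N] := hG1P; have [MG2 hG2N] := hG2P.
(* Here [ep_cap] joins the bound from one form with the frequencies from the other; on nonnegative
   frequencies the strip norm is the norm at [y0]. *)
have toN M M' P : ep predT (sw y0 y2) M P -> ep nneg (sw y1 y2) M' P -> ep nneg (sw y0 y0) M P.
  move=> h h'; apply: ep_mono (ep_cap (w0 _ _) h h') => // a a0.
  by rewrite (sw_nneg y02 a0) (sw_nneg (lexx y0) a0).
exists G1, G2, m; split.
- by apply: ep_le (toN _ _ _ hG1 hG1N); rewrite lerD2l ler_piMr // addr_ge0.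
- by apply: ep_le (toN _ _ _ hG2 hG2N); rewrite lerD2l ler_piMr // addr_ge0.
- move=> n mn; have [h1 h2] := hn3 n m (leq_trans mn3 mn) mn3; have [Fn1 Fn2] := hK n.
  have HN := ep_sub (ep_add (ep_mul hN (fP _ _ Fn1) hG1N) (ep_mul hN (fP _ _ Fn2) hG2N))
    (ep_cst hN 1).
  apply: toN HN.
  have T1 := hE2 n (leq_trans mn2 mn).
  have T2 := ep_mul (hT _ _) hkm (ep_sub (ep_mul (hT _ _) (fT _ _ h1) (fT _ _ F2))
     (ep_mul (hT _ _) (fT _ _ h2) (fT _ _ F1))).
  have T3 := ep_add (ep_mul (hT _ _) (fT _ _ Fn1) hd1m) (ep_mul (hT _ _) (fT _ _ Fn2) hd2m).
  apply: ep_le (ep_ext _ (ep_sub (ep_add T1 T2) T3)) => [|z]; last first.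
    by rewrite /residual /G1 /G2; ring.
  have -> : e' + 2 * C1 * C2 * (eta * K + eta * K) + (K * ((C1 + C2) * e') + K * ((C1 + C2) * e'))
    = B * e' + 4 * C1 * C2 * K * eta by rewrite /B; ring.
  rewrite [leRHS]splitr; apply: lerD => //.
  rewrite /eta mulrC mulrAC ler_pdivrMr // ler_wpM2l ?(ltW e2) //.
  by rewrite lerDl.
Qed.

End Corona.

Section CoronaMain.
Variable R : realType.
Variables f1 f2 : nat -> R[i] -> R[i].
Hypotheses (hf1 : wseq nneg f1) (hf2 : wseq nneg f2).
Local Open Scope complex_scope.

(* Adjoints on the line of height [y] give the Bezout multipliers: [T] is
   [1 - (|f1|^2 + |f2|^2) / C], which is less than [1] on the line, so that its
   powers become small in norm. *)
Lemma solv_line (y delta : R) n0 : 0 <= y -> 0 < delta ->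
  (forall n x, (n0 <= n)%N -> delta <= cabs (f1 n (x +i* y)) + cabs (f2 n (x +i* y))) ->
  exists P1 P2 n1 C, [/\ ep predT (sw y y) C P1, ep predT (sw y y) C P2 &
    forall n, (n1 <= n)%N -> ep predT (sw y y) (1 / 2) (residual f1 f2 n P1 P2)].
Proof.
move=> y0 dl0 hdl.
have [K K0 hK] := f_bound hf1 hf2.
have w0 (u v a : R) : 0 <= sw u v a by exact: sw_ge0.
have hT : weight predT (sw y y) by exact: sw_weightT.
have fT M P : ep nneg w1 M P -> ep predT (sw y y) M P.
  by apply: ep_mono => // a a0; exact: sw_le1.
(* A normalization: [c] bounds the norm of [Q] and its values on the line, so [T] has norm at most 2
   and, for late indices, values in [[0, rho]]. *)
pose c : R := 2 * K ^+ 2 + 1; have c0 : 0 < c by rewrite ltr_wpDl // mulr_ge0 // sqr_ge0.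
pose Q m z := f1 m z * star y (f1 m) z + f2 m z * star y (f2 m) z.
pose T m z := 1 - c^-1%:C * Q m z.
have hb m x : cabs (f1 m (x +i* y)) <= K /\ cabs (f2 m (x +i* y)) <= K.
  have [h1 h2] := hK m.
  split; [apply: (ep_bound h1)|apply: (ep_bound h2)] => a a0 /=;
    by rewrite /w1 -expR0 ler_expR mulNr oppr_le0 mulr_ge0.
pose rho := 1 - delta ^+ 2 / (2 * c).
have d2 : 0 < delta ^+ 2 / (2 * c) by rewrite divr_gt0 ?exprn_gt0 // mulr_gt0.
have rho1 : rho < 1 by rewrite /rho; lra.
have hrho m x : (n0 <= m)%N -> cabs (T m (x +i* y)) <= rho.
  move=> mn; have [b1 b2] := hb m x; have hd := hdl m x mn.
  rewrite /T /Q !star_line -!sqr_cabs -rmorphD -rmorphM.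
  move: b1 b2 hd; move: (cabs_ge0 (f1 m (x +i* y))) (cabs_ge0 (f2 m (x +i* y))).
  move: (cabs (f1 _ _)) (cabs (f2 _ _)) => u v u0 v0 uK vK uv.
  rewrite -[1]/(1%:C) -rmorphB cabsR.
  have h1 : u ^+ 2 + v ^+ 2 <= c by rewrite /c; nra.
  have h2 : delta ^+ 2 / 2 <= u ^+ 2 + v ^+ 2.
    have h3 : delta ^+ 2 <= (u + v) ^+ 2 by apply: lerXn2r; rewrite ?nnegrE; [exact: ltW|exact: addr_ge0|lra].
    by rewrite ler_pdivrMr //; have := sqr_ge0 (u - v); nra.
  rewrite ger0_norm; last by rewrite subr_ge0 [_^-1 * _]mulrC ler_pdivrMr // mul1r.
  rewrite /rho lerD2l lerN2 invfM mulrA [leRHS]mulrC ler_wpM2r // ?invr_ge0 ?(ltW c0) //.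
have rho0 : 0 <= rho by apply: le_trans (hrho n0 0 (leqnn _)).
pose th := (1 + rho) / 2.
have th0 : 0 <= th by rewrite divr_ge0 // addr_ge0.
have th1 : th < 1 by rewrite /th; lra.
pose tau := (1 - rho) / 2; have tau0 : 0 < tau by rewrite /tau; lra.
have K41 : 0 < 4 * K + 1 by rewrite ltr_wpDl // mulr_ge0.
pose eta := tau * c / (4 * K + 1).
have eta0 : 0 < eta by rewrite divr_gt0 // mulr_gt0.
have [nM hM] := f_cauchy hf1 hf2 eta0.
(* The exponent [d] of [ep_pow_sup] depends on the number of frequencies, hence on the index, and is
   fixed once at [M]. For later [m] the powers of [T m] are expanded around [T M]: the difference
   has norm at most [tau], and [rho + tau = th] is still below 1. *)
pose M := maxn n0 nM.
have Mn0 : (n0 <= M)%N by exact: leq_maxl.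
have MnM : (nM <= M)%N by exact: leq_maxr.
have hQ m : ep predT (sw y y) (2 * K ^+ 2) (Q m).
  have [h1 h2] := hK m.
  have H := ep_add (ep_mul hT (fT _ _ h1) (ep_star (fT _ _ h1)))
    (ep_mul hT (fT _ _ h2) (ep_star (fT _ _ h2))).
  by apply: ep_le H; rewrite -expr2 -mulr2n mulr_natl.
have ci : cabs (c^-1%:C) = c^-1 by rewrite cabsR ger0_norm // invr_ge0 ltW.
have hTm m : ep predT (sw y y) 2 (T m).
  have H := ep_sub (ep_cst hT 1) (ep_scale (c^-1%:C) (hQ m)).
  apply: ep_le H; rewrite cabs1 ci -[leRHS]/(1 + 1) lerD2l mulrC ler_pdivrMr // mul1r.
  by rewrite /c lerDl.
have hD m : (M <= m)%N -> ep predT (sw y y) tau (fun z => T m z - T M z).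
  move=> Mm; have [e1 e2] := hM m M (leq_trans MnM Mm) MnM.
  have [h1 h2] := hK m; have [k1 k2] := hK M.
  have H1 := ep_add (ep_mul hT (fT _ _ e1) (ep_star (fT _ _ h1)))
    (ep_mul hT (fT _ _ k1) (ep_star (fT _ _ e1))).
  have H2 := ep_add (ep_mul hT (fT _ _ e2) (ep_star (fT _ _ h2)))
    (ep_mul hT (fT _ _ k2) (ep_star (fT _ _ e2))).
  have H := ep_scale (- c^-1%:C) (ep_add H1 H2).
  apply: ep_le (ep_ext _ H) => [|z]; last by rewrite /T /Q !star_sub; ring.
  rewrite cabsN ci; have -> : c^-1 * (eta * K + K * eta + (eta * K + K * eta)) =
    (4 * K / (4 * K + 1)) * tau by rewrite /eta; field; rewrite !gt_eqF.
  by rewrite ler_piMl ?(ltW tau0) // ler_pdivrMr // mul1r lerDl.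
have [d hd] := ep_pow_sup (hTm M) (fun x => hrho M x Mn0).
have pow k m : (M <= m)%N -> ep predT (sw y y) ((k.+1 ^ d)%:R * th ^+ k) (fun z => T m z ^+ k).
  move=> Mm.
  have H := ep_sum (index_enum 'I_k.+1) (fun i : 'I_k.+1 =>
    ep_scale ('C(k, i)%:R) (ep_mul hT (hd (k - i)%N) (ep_exp hT i (hD m Mm)))).
  apply: ep_le (ep_ext _ H) => [|z]; last first.
    have -> : T m z ^+ k = (T M z + (T m z - T M z)) ^+ k by congr (_ ^+ _); ring.
    rewrite exprDn; apply: eq_bigr => i _.
    by rewrite mulr_natl.
  have -> : th = rho + tau by rewrite /th /tau; lra.
  rewrite exprDn mulr_sumr; apply: ler_sum => i _.
  have -> : cabs ('C(k, i)%:R : R[i]) = 'C(k, i)%:R.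
    have -> : 'C(k, i)%:R = ('C(k, i)%:R : R)%:C :> R[i] by rewrite rmorph_nat.
    by rewrite cabsR normr_nat.
  rewrite -[X in _ <= _ * X]mulr_natl [leRHS]mulrCA; apply: ler_wpM2l; first exact: ler0n.
  rewrite -mulrA; apply: ler_wpM2r.
    by rewrite mulr_ge0 ?exprn_ge0 // ltW.
  rewrite ler_nat; case: (d) => [|d']; first by rewrite !expn0.
  by rewrite leq_exp2r // ltnS leq_subr.
have q4 : 0 < 4^-1 :> R by rewrite invr_gt0.
have [k hk] := poly_expr_small d (introT andP (conj th0 th1)) q4.
(* A partial Neumann series for the inverse of [Q m]: the product of [Q m] and [G m] is
   [1 - T m ^+ k]. *)
pose G m z := c^-1%:C * \sum_(j < k) T m z ^+ j.
pose B : R := \sum_(j <- index_enum 'I_k) 2 ^+ j.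
have B0 : 0 <= B by rewrite sumr_ge0.
have hG m : ep predT (sw y y) (c^-1 * B) (G m).
  by rewrite -ci; apply: ep_scale; apply: ep_sum => j; exact: ep_exp.
pose U := K * (c^-1 * B).
have U0 : 0 <= U by rewrite !mulr_ge0 // invr_ge0 ltW.
have e8 : 0 < (8 * (U + 1))^-1 by rewrite invr_gt0 mulr_gt0 // ltr_wpDl.
have [n2 hn2] := f_cauchy hf1 hf2 e8.
(* The index of the multipliers is chosen last: it depends on their bound [U], thus on [k], on [d]
   and on [M]. *)
pose m := maxn M n2.
have Mm : (M <= m)%N by exact: leq_maxl.
have m2 : (n2 <= m)%N by exact: leq_maxr.
pose P1 z := star y (f1 m) z * G m z; pose P2 z := star y (f2 m) z * G m z.
have [k1 k2] := hK m.
have hP1 : ep predT (sw y y) U P1 by apply: ep_mul => //; apply: ep_star; exact: fT.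
have hP2 : ep predT (sw y y) U P2 by apply: ep_mul => //; apply: ep_star; exact: fT.
exists P1, P2, m, U; split => // n mn.
have [h1 h2] := hn2 n m (leq_trans m2 mn) m2.
have wl a : 0 <= a -> sw y y a <= w1 a by move=> a0; exact: sw_le1.
have D := residual_diff hT (fun _ _ => isT) wl h1 h2 hP1 hP2.
have X := ep_opp (pow k m Mm).
apply: ep_le (ep_ext _ (ep_add X D)) => [|z].
  apply: (@le_trans _ _ (4^-1 + 4^-1)); last by lra.
  apply: lerD => //.
  have -> : 2 * (8 * (U + 1))^-1 * U = (U / (U + 1)) * 4^-1.
    by field; rewrite gt_eqF // ltr_wpDl.
  by rewrite ler_piMl ?(ltW q4) // ler_pdivrMr ?ltr_wpDl // mul1r lerDl.
have E1 : residual f1 f2 m P1 P2 z = - T m z ^+ k.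
  have := subrX1 (T m z) k.
  have -> : T m z - 1 = - (c^-1%:C * Q m z) by rewrite /T; ring.
  rewrite mulNr => /eqP; rewrite subr_eq => /eqP ->.
  by rewrite /residual /P1 /P2 /G /Q; ring.
by rewrite -E1; ring.
Qed.

(** Thickening the line costs 1/8 in the residual and passing to later indices another 1/8, so 1/2
    becomes 3/4, still below 1. The strip is cut at height 0, below which [w1] no longer dominates
    the weight of nonnegative frequencies. *)
Lemma solv_strip (y delta : R) n0 : 0 <= y -> 0 < delta ->
  (forall n x, (n0 <= n)%N -> delta <= cabs (f1 n (x +i* y)) + cabs (f2 n (x +i* y))) ->
  exists2 d : R, 0 < d & solv f1 f2 predT (sw (Num.max (y - d) 0) (y + d)).
Proof.
move=> y0 dl0 hdl.
have [P1 [P2 [n1 [C [H1 H2 HE]]]]] := solv_line y0 dl0 hdl.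
have C0 : 0 <= C by apply: ep_ge0 H1; exact: sw_ge0.
have [e1 e10 s1] := ep_strip H1 ltr01; have [e2 e20 s2] := ep_strip H2 ltr01.
have C10 : 0 < C + 1 by rewrite ltr_wpDl.
have t0 : 0 < (16 * (C + 1))^-1 by rewrite invr_gt0 mulr_gt0.
have [n2 hn2] := f_cauchy hf1 hf2 t0.
pose m := maxn n1 n2.
have e80 : 0 < 8^-1 :> R by rewrite invr_gt0.
have [e3 e30 s3] := ep_strip (HE m (leq_maxl _ _)) e80.
pose d := Num.min e1 (Num.min e2 e3).
have d0 : 0 < d by rewrite !lt_min e10 e20.
have d1 : d <= e1 by rewrite ge_min lexx.
have d2 : d <= e2 by rewrite /d !ge_min lexx orbT.
have d3 : d <= e3 by rewrite /d !ge_min lexx !orbT.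
exists d => //; set u := Num.max _ _.
have u0 : 0 <= u by rewrite le_max lexx orbT.
have uy : u <= y + d by rewrite ge_max; apply/andP; split; [lra|rewrite addr_ge0 // ltW].
have yu : y - d <= u by rewrite le_max lexx.
have mid M P : ep predT (sw (y - d) (y + d)) M P -> ep predT (sw u (y + d)) M P.
  by apply: ep_mono => // a _; apply: sw_mid => //; lra.
have hT : weight predT (sw u (y + d)) by exact: sw_weightT.
have yd : 0 <= y + d by rewrite addr_ge0 // ltW.
have wl a : 0 <= a -> sw u (y + d) a <= w1 a by move=> a0; exact: sw_le1.
have h1 := mid _ _ (s1 d d1 (ltW d0)); have h2 := mid _ _ (s2 d d2 (ltW d0)).
have h3 := mid _ _ (s3 d d3 (ltW d0)).
apply: (@boost _ _ _ hf1 hf2 _ _ hT (fun _ _ => isT) wl P1 P2 (C + 1) (3 / 4) m) => //.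
  by lra.
move=> n mn; have [g1 g2] := hn2 n m (leq_trans (leq_maxr _ _) mn) (leq_maxr _ _).
have D := residual_diff hT (fun _ _ => isT) wl g1 g2 h1 h2.
apply: ep_le (ep_ext _ (ep_add h3 D)) => [|z]; last by ring.
have -> : 2 * (16 * (C + 1))^-1 * (C + 1) = 8^-1 by field; rewrite gt_eqF.
lra.
Qed.

(** The infimum of the good heights need not be known to be good: the strip around it contains a
    good height, from which gluing descends to the lower edge. This contradicts the infimum unless
    the edge is 0. *)
Theorem corona : (forall y : R, 0 <= y -> exists (delta : R) n0, 0 < delta /\
    forall n x, (n0 <= n)%N -> delta <= cabs (f1 n (x +i* y)) + cabs (f2 n (x +i* y))) ->
  (exists2 Y : R, 0 <= Y & solv f1 f2 nneg (sw Y Y)) ->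
  solv f1 f2 nneg (sw 0 0).
Proof.
move=> hline [Y Y0 hY].
pose X := [set y : R | 0 <= y /\ solv f1 f2 nneg (sw y y)].
have iX : has_inf X.
  by split; [exists Y; split|exists 0 => y []].
have inf0 : 0 <= inf X by apply: lb_le_inf; [exact: iX.1|move=> y []].
have [dl [n0 [dl0 hdl]]] := hline _ inf0.
have [d d0 hd] := solv_strip inf0 dl0 hdl.
have [y1 [y10 hy1] y1d] := inf_adherent d0 iX.
have iy1 : inf X <= y1 by apply: (inf_lbound iX.2); split.
set u := Num.max (inf X - d) 0 in hd.
have u0 : 0 <= u by rewrite le_max lexx orbT.
have uy : u <= y1 by rewrite ge_max y10 andbT; lra.
have hu := glue hf1 hf2 u0 uy (ltW y1d) hy1 hd.
have hXu : inf X <= u by apply: (inf_lbound iX.2); split.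
have h0 : inf X - d <= 0.
  rewrite leNgt; apply/negP => h; move: hXu.
  by rewrite /u max_l ?(ltW h) // leNgt ltrBlDr ltrDl d0.
have u00 : u = 0 by exact: max_r.
by rewrite u00 in hu.
Qed.

End CoronaMain.

Section CoronaFunctions.
Variable R : realType.
Local Open Scope complex_scope.

(** A diagonal Neumann series: the approximant and the number of terms grow together, with an error
    of norm at most [(1 / 2) ^+ n]. *)
Lemma WW_inv S p (f : R -> R[i]) : weight S w1 -> wseq S p -> uconv f p ->
  (forall n, ep S w1 (1 / 2) (p n)) ->
  exists g, WW S g /\ forall x, (1 + f x) * g x = 1.
Proof.
move=> hw [_ hp] fp h2.
pose q n z := \sum_(j < n) (- p n z) ^+ j.
have h12 : 0 <= (1 / 2 : R) < 1 by apply/andP; split; lra.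
have hq n : ep S w1 2 (q n).
  have H := ep_geom hw n (ep_opp (h2 n)) h12.
  by apply: ep_le H; rewrite -[leRHS]invrK lef_pV2 ?posrE ?invr_gt0 //; lra.
have hE n z : (1 + p n z) * q n z = 1 - (- p n z) ^+ n.
  have := subrX1 (- p n z) n; rewrite -/(q n z) => E1.
  by rewrite -[RHS]opprB E1 -mulNr; congr (_ * _); ring.
have hr n : ep S w1 ((1 / 2) ^+ n) (fun z => (- p n z) ^+ n).
  by apply: ep_exp => //; exact: ep_opp.
have cq : cauchyW S q.
  move=> eps e0; have e12 : 0 < eps / 12 by rewrite divr_gt0.
  have [n1 hn1] := hp _ e12; have [n2 hn2] := expr_small h12 e12.
  exists (maxn n1 n2) => n m; rewrite !geq_max => /andP[na nb] /andP[ma mb].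
  (* The difference [q n - q m] is [q n * q m * (p m - p n) + q n * (- p m) ^+ m - q m * (- p n) ^+
     n]. Since [q] has norm at most 2, the terms cost 4, 2 and 2 twelfths of [eps]. *)
  have A1 := ep_mul hw (ep_mul hw (hq n) (hq m)) (hn1 m n ma na).
  have A2 := ep_mul hw (hq n) (hr m); have A3 := ep_mul hw (hq m) (hr n).
  apply: ep_le (ep_ext _ (ep_sub (ep_add A1 A2) A3)) => [|z].
    by have := hn2 n nb; have := hn2 m mb; lra.
  have En := hE n z; have Em := hE m z.
  have -> : (- p m z) ^+ m = 1 - (1 + p m z) * q m z by rewrite Em; ring.
  have -> : (- p n z) ^+ n = 1 - (1 + p n z) * q n z by rewrite En; ring.
  ring.
have wq : wseq S q by split => //; exists 2.
have [g hg] := wseq_cvg wq.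
exists g; split; first by exists q.
move=> x; apply: (@cvgC_uniq _ (fun n => (1 + p n x%:C) * q n x%:C)).
  apply: cvgCM.
    apply: cvgCD; first exact: cvgC_cst.
    by move=> eps /fp[n0 hn]; exists n0 => n /(hn n x); rewrite cabsC.
  by move=> eps /hg[n0 hn]; exists n0 => n /(hn n x); rewrite cabsC.
move=> eps e0; have [n0 hn] := expr_small h12 e0; exists n0 => n n0n.
have -> : (1 + p n x%:C) * q n x%:C - 1 = - (- p n x%:C) ^+ n by rewrite hE; ring.
rewrite cabsN; apply: le_trans (hn n n0n).
exact: ep_real_bound (hr n).
Qed.

(** One approximate solution of residual 1/2 yields an exact one: in the limit the combination is
    [1 + f], which [WW_inv] inverts. The shift of the index by [n0] makes the bound 1/2 hold along
    the whole sequence. *)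
Theorem corona_functions f1 f2 (F1 F2 : R -> R[i]) : wseq nneg f1 -> wseq nneg f2 ->
  uconv F1 f1 -> uconv F2 f2 -> solv f1 f2 nneg (sw 0 0) ->
  exists g1 g2, [/\ WW nneg g1, WW nneg g2 & forall x, F1 x * g1 x + F2 x * g2 x = 1].
Proof.
move=> hf1 hf2 c1 c2 [C]; have h2 : 0 < 1 / 2 :> R by lra.
move=> /(_ _ h2)[P1 [P2 [n0 [H1 H2 HE]]]].
have to1 (M : R) (P : R[i] -> R[i]) : ep nneg (sw 0 0) M P -> ep nneg w1 M P.
  by apply: ep_mono => // a _; rewrite sw0.
have wP (P : R[i] -> R[i]) : ep nneg (sw 0 0) C P -> wseq nneg (fun=> P).
  move=> h; split; first by exists C => n; exact: to1.
  move=> eps e0; exists 0%N => n m _ _.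
  by apply: ep_le (ltW e0) (ep_ext _ (ep_zero _ _)) => z; rewrite subrr.
have cP (P : R[i] -> R[i]) : uconv (fun x => P x%:C) (fun=> P).
  by move=> eps e0; exists 0%N => n x _; rewrite subrr cabs0 ltW.
have hw := @w1_nneg R.
pose p n z := residual f1 f2 (n + n0)%N P1 P2 z.
have W1 := wseq_mul hw hf1 (wP _ H1); have W2 := wseq_mul hw hf2 (wP _ H2).
have W := wseq_add (wseq_add W1 W2) (wseq_cst (- 1) hw).
have wp : wseq nneg p.
  case: W => [[K hK] hc]; split; first by exists K => n; exact: hK.
  move=> eps /hc[n1 hn]; exists n1 => n m h1 h3.
  by apply: hn; exact: leq_trans (leq_addr _ _).
pose f x := F1 x * P1 x%:C + F2 x * P2 x%:C - 1.
have U : uconv f p.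
  have [K1 K10 hK1] := uconv_bound (wP _ H1) (cP P1).
  have [K2 K20 hK2] := uconv_bound (wP _ H2) (cP P2).
  move=> eps e0; have K0 : 0 < K1 + K2 + 1 by rewrite ltr_wpDl // addr_ge0.
  have [n1 hn1] := c1 _ (divr_gt0 e0 K0); have [n2 hn2] := c2 _ (divr_gt0 e0 K0).
  exists (maxn n1 n2) => n x; rewrite geq_max => /andP[na nb].
  have -> : f x - p n x%:C = (F1 x - f1 (n + n0)%N x%:C) * P1 x%:C +
    (F2 x - f2 (n + n0)%N x%:C) * P2 x%:C by rewrite /f /p /residual; ring.
  apply: le_trans (cabsD _ _) _; rewrite !cabsM.
  have T1 := hn1 (n + n0)%N x (leq_trans na (leq_addr _ _)).
  have T2 := hn2 (n + n0)%N x (leq_trans nb (leq_addr _ _)).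
  apply: le_trans (lerD (ler_pM (cabs_ge0 _) (cabs_ge0 _) T1 (hK1 x))
    (ler_pM (cabs_ge0 _) (cabs_ge0 _) T2 (hK2 x))) _.
  rewrite -mulrDr mulrAC ler_pdivrMr // ler_wpM2l ?(ltW e0) //.
  by rewrite lerDl.
have [g [Wg hg]] := WW_inv hw wp U (fun n => to1 _ _ (HE (n + n0)%N (leq_addl _ _))).
exists (fun x => P1 x%:C * g x), (fun x => P2 x%:C * g x); split.
- by apply: WWM => //; exists (fun=> P1); [exact: wP|exact: cP].
- by apply: WWM => //; exists (fun=> P2); [exact: wP|exact: cP].
- move=> x; rewrite -(hg x) /f; ring.
Qed.

End CoronaFunctions.

(** * Bezout identities for geometric sums *)

Section Bezout.
Variable R : realType.
Implicit Types (a b y K : R) (P Q : R[i] -> R[i]) (p q : nat -> R[i] -> R[i]).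
Local Open Scope complex_scope.

Definition geomS (n : nat) (A B : R[i]) : R[i] := \sum_(i < n.+1) A ^+ (n - i) * (- B) ^+ i.

Lemma geomSE n A B : (A + B) * geomS n A B = A ^+ n.+1 - (- B) ^+ n.+1.
Proof. by rewrite subrXX opprK. Qed.

(** Needed for the reflection, which exchanges the two functions: the sum common to both columns
    survives up to sign. *)
Lemma geomS_sym n A B : geomS n B A = (- 1) ^+ n * geomS n A B.
Proof.
rewrite /geomS (reindex_inj rev_ord_inj) mulr_sumr; apply: eq_bigr => i _ /=.
rewrite subSS subKn; last by rewrite -ltnS.
rewrite [(- A) ^+ _]exprNn [(- B) ^+ _]exprNn.
have -> : (- 1) ^+ n = (- 1) ^+ (n - i) * (- 1) ^+ i :> R[i].
  by rewrite -exprD subnK // -ltnS.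
have -> : (- 1) ^+ (n - i) * (- 1) ^+ i * (A ^+ (n - i) * ((- 1) ^+ i * B ^+ i)) =
  ((- 1) ^+ i * (- 1) ^+ i) * (B ^+ i * ((- 1) ^+ (n - i) * A ^+ (n - i))) :> R[i] by ring.
by rewrite -expr2 sqrr_sign mul1r.
Qed.

(** Either [B] exceeds a threshold [sg], or [A] is at least [delta / 2] and the leading term
    [A ^+ n] dominates the others, all of which contain [B]. *)
Lemma geomS_lower n K (delta : R) : 0 < delta -> exists2 tau : R, 0 < tau &
  forall A B : R[i], cabs A <= K -> cabs B <= K -> delta <= cabs A + cabs B ->
    tau <= cabs (geomS n A B) + cabs B ^+ n.+1.
Proof.
move=> d0; pose K1 := `|K| + 1.
have K11 : 1 <= K1 by rewrite lerDr.
have K10 : 0 < K1 by exact: lt_le_trans K11.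
pose D := (delta / 2) ^+ n; have D0 : 0 < D by rewrite exprn_gt0 // divr_gt0.
pose L := 2 * (n.+1%:R * K1 ^+ n); have L0 : 0 < L by rewrite !mulr_gt0 // exprn_gt0.
(* Below this threshold the [n] terms containing [B] add up to at most [D / 2], half of the lower
   bound [D] for the leading term. *)
pose sg := Num.min (delta / 2) (D / L).
have s0 : 0 < sg by rewrite lt_min !divr_gt0.
have s1 : sg <= delta / 2 by rewrite ge_min lexx.
have s2 : sg * L <= D by rewrite -ler_pdivlMr // ge_min lexx orbT.
exists (Num.min (sg ^+ n.+1) (D / 2)); first by rewrite lt_min exprn_gt0 // divr_gt0.
move=> A B hA hB hAB.
have [hs|hs] := leP sg (cabs B).
  rewrite ge_min; apply/orP; left; apply: ler_wpDl => //.
  by rewrite lerXn2r ?nnegrE // ltW.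
rewrite ge_min; apply/orP; right; apply: ler_wpDr; first exact: exprn_ge0.
have AK : cabs A <= K1 by rewrite (le_trans hA) // (le_trans (ler_norm _)) // lerDl.
have BK : cabs B <= K1 by rewrite (le_trans hB) // (le_trans (ler_norm _)) // lerDl.
rewrite /geomS big_ord_recl /= subn0 expr0 mulr1.
set S1 := \sum_(i < n) _.
have hS1 : cabs S1 <= D / 2.
  apply: le_trans (cabs_sum _ _ _) _.
  apply: (@le_trans _ _ (\sum_(i < n) sg * K1 ^+ n)).
    apply: ler_sum => i _; rewrite cabsM !cabsX cabsN /bump /= add1n.
    rewrite exprS mulrCA; apply: ler_pM => //; [by rewrite mulr_ge0 ?exprn_ge0|exact: ltW|].
    have -> : K1 ^+ n = K1 ^+ (n - i.+1) * K1 ^+ i.+1 by rewrite -exprD subnK.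
    apply: ler_pM; rewrite ?exprn_ge0 //.
      by rewrite lerXn2r ?nnegrE // ltW.
    apply: (@le_trans _ _ (K1 ^+ i)); first by rewrite lerXn2r ?nnegrE // ltW.
    by rewrite exprS ler_peMl // exprn_ge0 // ltW.
  rewrite sumr_const card_ord -[_ *+ n]mulr_natl.
  have : sg * (2 * (n%:R * K1 ^+ n)) <= D.
    apply: le_trans s2; rewrite ler_wpM2l ?(ltW s0) // ler_wpM2l //.
    by rewrite ler_wpM2r ?ler_nat // exprn_ge0 // ltW.
  move: (K1 ^+ n) (n%:R : R) => u v; lra.
have hA2 : D <= cabs A ^+ n.
  by rewrite lerXn2r ?nnegrE ?divr_ge0 ?(ltW d0) //; lra.
have := cabs_le_dist (A ^+ n) (- S1); rewrite cabsX cabsN opprK; lra.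
Qed.

Lemma wseq_exp S p n : weight S w1 -> wseq S p -> wseq S (fun k z => p k z ^+ n).
Proof.
move=> hw hp; elim: n => [|n IH]; first exact: (wseq_cst 1 hw).
have -> : (fun k z => p k z ^+ n.+1) = (fun k z => p k z * p k z ^+ n).
  by apply/funext => k; apply/funext => z; rewrite exprS.
exact: wseq_mul.
Qed.

Lemma wseq_sum S (I : Type) (r : seq I) (p : I -> nat -> R[i] -> R[i]) : weight S w1 ->
  (forall i, wseq S (p i)) -> wseq S (fun k z => \sum_(i <- r) p i k z).
Proof.
move=> hw h; elim: r => [|i r IH].
  have -> : (fun k z => \sum_(j <- [::]) p j k z) = (fun _ _ => 0).
    by apply/funext => k; apply/funext => z; rewrite big_nil.
  exact: wseq_cst.
have -> : (fun k z => \sum_(j <- i :: r) p j k z) = (fun k z => p i k z + \sum_(j <- r) p j k z).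
  by apply/funext => k; apply/funext => z; rewrite big_cons.
exact: wseq_add.
Qed.

Lemma uconv_exp S p (f : R -> R[i]) n : weight S w1 -> wseq S p -> uconv f p ->
  uconv (fun x => f x ^+ n) (fun k z => p k z ^+ n).
Proof.
move=> hw hp fp; elim: n => [|n IH]; first exact: uconv_cst.
have -> : (fun k z => p k z ^+ n.+1) = (fun k z => p k z * p k z ^+ n).
  by apply/funext => k; apply/funext => z; rewrite exprS.
have -> : (fun x => f x ^+ n.+1) = (fun x => f x * f x ^+ n).
  by apply/funext => x; rewrite exprS.
exact: (uconvM hp (wseq_exp n hw hp) fp IH).
Qed.

Lemma uconv_sum (I : Type) (r : seq I) (p : I -> nat -> R[i] -> R[i]) (f : I -> R -> R[i]) :
  (forall i, uconv (f i) (p i)) ->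
  uconv (fun x => \sum_(i <- r) f i x) (fun k z => \sum_(i <- r) p i k z).
Proof.
move=> h; elim: r => [|i r IH].
  have -> : (fun k z => \sum_(j <- [::]) p j k z) = (fun _ _ => 0).
    by apply/funext => k; apply/funext => z; rewrite big_nil.
  have -> : (fun x => \sum_(j <- [::]) f j x) = (fun=> 0).
    by apply/funext => x; rewrite big_nil.
  exact: uconv_cst.
have -> : (fun k z => \sum_(j <- i :: r) p j k z) = (fun k z => p i k z + \sum_(j <- r) p j k z).
  by apply/funext => k; apply/funext => z; rewrite big_cons.
have -> : (fun x => \sum_(j <- i :: r) f j x) = (fun x => f i x + \sum_(j <- r) f j x).
  by apply/funext => x; rewrite big_cons.
exact: uconvD.
Qed.

Lemma wn_decay (s : seq (R[i] * R)) (eps : R) : 0 < eps -> all (fun t => 0 < t.2) s ->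
  exists2 Y0 : R, 0 <= Y0 & forall Y, Y0 <= Y -> wn (sw Y Y) s <= eps.
Proof.
elim: s eps => [|t s IH] eps e0.
  by move=> _; exists 0 => // Y _; rewrite /wn big_nil ltW.
case/andP => t0 hs; have e2 : 0 < eps / 2 by rewrite divr_gt0.
have [Y1 Y10 h1] := IH _ e2 hs.
have c0 : 0 < cabs t.1 + 1 by rewrite ltr_wpDl.
have [Y2 Y20 h2] := expR_small t0 (divr_gt0 e2 c0).
exists (Num.max Y1 Y2); first by rewrite le_max Y10.
move=> Y; rewrite ge_max => /andP[/h1 H1 hY].
rewrite /wn big_cons -/(wn _ s) [eps]splitr; apply: lerD => //.
have H2 : sw Y Y t.2 <= eps / 2 / (cabs t.1 + 1).
  apply: le_trans h2; rewrite /sw maxxx ler_expR mulNr lerN2.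
  by rewrite ler_pM2l.
apply: le_trans (ler_wpM2l (cabs_ge0 _) H2) _.
rewrite mulrA ler_pdivrMr // [_ * (eps / 2)]mulrC ler_wpM2l ?(ltW e2) //.
by rewrite lerDl.
Qed.

(** Positive frequencies die out upwards. Seeing this for one approximant [m] is enough, since at
    nonnegative heights the later ones are at least as close to it as in the norm [w1]. *)
Lemma const_at_infinity (s : nat -> seq (R[i] * R)) p (c : R[i]) : wseq nneg p ->
  (forall n z, p n z = ev (s n) z) -> cvgC (fun n => coefl (s n) 0) c ->
  forall eps : R, 0 < eps -> exists2 Y0 : R, 0 <= Y0 & exists n0, forall Y n,
    Y0 <= Y -> (n0 <= n)%N -> ep nneg (sw Y Y) eps (fun z => p n z - c).
Proof.
move=> [[K hK] hp] ps hc eps e0; have e3 : 0 < eps / 3 by rewrite divr_gt0.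
have [n1 h1] := hp _ e3; have [n2 h2] := hc _ e3.
pose m := maxn n1 n2.
have [r [r1 _ r3]] := hK m.
have cr : coefl (s m) 0 = coefl r 0 by apply: coefl_eq => x; rewrite -ps r3.
pose r' := [seq t <- r | predC1 0 t.2].
have r'0 : all (fun t => 0 < t.2) r'.
  apply/allP => t; rewrite mem_filter => /andP[/= t0 tr].
  by rewrite lt_def t0; move/allP: r1 => /(_ t tr).
have [Y0 Y00 hY] := wn_decay e3 r'0.
exists Y0 => //; exists n1 => Y n hY0 hn.
have Yp : 0 <= Y by exact: le_trans hY0.
have hw := @sw_weight R Y Y.
have H1 : ep nneg (sw Y Y) (eps / 3) (fun z => p n z - p m z).
  apply: ep_mono (h1 n m hn (leq_maxl _ _)) => // a a0.
  by apply: sw_le1.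
have H2 : ep nneg (sw Y Y) (eps / 3) (ev r').
  exists r'; split => //; last exact: hY.
  by apply: sub_all r'0 => t; exact: ltW.
have H3 := ep_cst hw (coefl (s m) 0 - c).
have E1 z : p m z = coefl (s m) 0 + ev r' z.
  rewrite r3 cr /ev /coefl (bigID (fun t => t.2 == 0)) /= big_filter; congr (_ + _).
  by apply: eq_bigr => t /eqP ->; rewrite E0 mulr1.
apply: ep_le (ep_ext _ (ep_add (ep_add H1 H2) H3)) => [|z]; last by rewrite E1; ring.
have := h2 m (leq_maxr _ _); lra.
Qed.

Lemma pow_near n (eps : R) : 0 < eps -> exists2 tau : R, 0 < tau & forall S w P,
  weight S w -> ep S w tau (fun z => P z - 1) -> ep S w eps (fun z => P z ^+ n - 1).
Proof.
move=> e0; pose L : R := \sum_(i <- index_enum 'I_n) 2 ^+ i.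
have L0 : 0 <= L by rewrite sumr_ge0.
have L1 : 0 < L + 1 by rewrite ltr_wpDl.
exists (Num.min 1 (eps / (L + 1))); first by rewrite lt_min ltr01 divr_gt0.
move=> S w P hw h.
have h1 : ep S w 2 P.
  have H := ep_add h (ep_cst hw 1); rewrite cabs1 in H.
  apply: ep_le (ep_ext _ H) => [|z]; last by rewrite subrK.
  by rewrite -[leRHS]/(1 + 1) lerD2r ge_min lexx.
have h2 := ep_sum (index_enum 'I_n) (fun i : 'I_n => ep_exp hw i h1).
apply: ep_le (ep_ext _ (ep_mul hw h h2)) => [|z]; last by rewrite -subrX1.
rewrite -/L; apply: (@le_trans _ _ (eps / (L + 1) * L)).
  by rewrite ler_wpM2r // ge_min lexx orbT.
by rewrite mulrAC ler_pdivrMr // ler_wpM2l ?(ltW e0) // lerDl.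
Qed.

Lemma pow_at_infinity (s : nat -> seq (R[i] * R)) p (c : R[i]) k : wseq nneg p ->
  (forall n z, p n z = ev (s n) z) -> cvgC (fun n => coefl (s n) 0) c -> c != 0 ->
  forall eps : R, 0 < eps -> exists2 Y0 : R, 0 <= Y0 & exists n0, forall Y n,
    Y0 <= Y -> (n0 <= n)%N -> ep nneg (sw Y Y) eps (fun z => p n z ^+ k * c ^- k - 1).
Proof.
move=> hp ps hc c0 eps e0; have [tau t0 ht] := pow_near k e0.
have cc : 0 < cabs c by rewrite cabs_gt0.
have [Y0 Y00 [n0 hn]] := const_at_infinity hp ps hc (mulr_gt0 t0 cc).
exists Y0 => //; exists n0 => Y n hY hn0.
have H := ep_scale c^-1 (hn Y n hY hn0).
apply: (@ep_ext _ _ _ _ (fun z => (c^-1 * p n z) ^+ k - 1)).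
  by move=> z; rewrite exprMn exprVn mulrC.
apply: (ht _ _ _ (@sw_weight R Y Y)).
apply: ep_le (ep_ext _ H) => [|z]; last by rewrite mulrBr mulVf.
by rewrite cabsV mulrCA mulVf ?mulr1 // gt_eqF.
Qed.


Lemma wseq_line (S : pred R) p y : (forall a, S a -> 0 <= a) -> wseq S p -> 0 <= y ->
  exists2 K : R, 0 <= K & forall k x, cabs (p k (x +i* y)) <= K.
Proof.
move=> SS [[K hK] _] y0; exists K; first by apply: ep_ge0 (hK 0%N); exact: w1_ge0.
move=> k x; apply: ep_bound (hK k) _ => a /SS a0 /=.
by rewrite -[leRHS]expR0 ler_expR mulNr oppr_le0 mulr_ge0.
Qed.

Lemma ev_shift b (s : seq (R[i] * R)) z :
  E b z * ev s z = ev [seq (t.1, b + t.2) | t <- s] z.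
Proof.
rewrite /ev big_map mulr_sumr; apply: eq_bigr => t _.
by rewrite E_add mulrCA.
Qed.

Lemma coefl_shift b (s : seq (R[i] * R)) a :
  coefl [seq (t.1, b + t.2) | t <- s] (b + a) = coefl s a.
Proof.
rewrite /coefl big_map /=; apply: eq_bigl => t.
by rewrite (inj_eq (addrI b)).
Qed.

Section BezoutPower.
Variables (A B : nat -> R[i] -> R[i]) (sa sb : nat -> seq (R[i] * R)).
Variables (FA FB : R -> R[i]) (n : nat) (a1 b2 s t : R).
Hypotheses (hA : wseq (fun a => - b2 <= a) A) (hB : wseq (fun a => a1 <= a) B).
Hypotheses (Aev : forall k z, A k z = ev (sa k) z) (Bev : forall k z, B k z = ev (sb k) z).
Hypotheses (FA_A : uconv FA A) (FB_B : uconv FB B).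
Hypotheses (kappa0 : 0 < a1 + b2) (s_ge : n%:R * b2 <= s) (t_ge : - (n.+1%:R * a1) <= t).
Hypothesis lines : forall y : R, 0 <= y -> exists (delta : R) n0, 0 < delta /\
  forall k x, (n0 <= k)%N -> delta <= cabs (A k (x +i* y)) + cabs (B k (x +i* y)).
Hypothesis infinity : exists2 c : R[i], c != 0 &
  (t = - (n.+1%:R * a1) /\ cvgC (fun k => coefl (sb k) a1) c) \/
  (s = n%:R * b2 /\ cvgC (fun k => coefl (sa k) (- b2)) c).

(** [A'] and [B'] have their spectra shifted to start at 0 or above; their constant coefficients are
    those of [A] at [- b2] and of [B] at [a1], the ones named in [infinity]. *)
Let A' k z := E b2 z * A k z.
Let B' k z := E (- a1) z * B k z.
Let f1 k z := E s z * geomS n (A k z) (B k z).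
Let f2 k z := E t z * B k z ^+ n.+1.

Let hA' : wseq nneg A'.
Proof. by apply: wseq_shift hA => a; rewrite /nneg /= => h; lra. Qed.

Let hB' : wseq nneg B'.
Proof. by apply: wseq_shift hB => a; rewrite /nneg /= => h; lra. Qed.

Let A'E k z : A k z = E (- b2) z * A' k z.
Proof. by rewrite /A' mulrA -E_add addNr E0 mul1r. Qed.

Let B'E k z : B k z = E a1 z * B' k z.
Proof. by rewrite /B' mulrA -E_add addrN E0 mul1r. Qed.

Let term (r : R) (i : 'I_n.+1) k z := E (r - n%:R * b2 + i%:R * (a1 + b2)) z *
  (A' k z ^+ (n - i) * ((- 1) ^+ i * B' k z ^+ i)).

Let f1E k z : f1 k z = \sum_(i < n.+1) term s i k z.
Proof.
rewrite /f1 /geomS mulr_sumr; apply: eq_bigr => i _; rewrite /term.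
rewrite A'E B'E.
have alg (u v x y : R[i]) m j :
  (u * x) ^+ m * (- (v * y)) ^+ j = u ^+ m * v ^+ j * (x ^+ m * ((- 1) ^+ j * y ^+ j)).
  rewrite [(- (v * y)) ^+ j]exprNn !exprMn.
  by move: (u ^+ m) (x ^+ m) (v ^+ j) (y ^+ j) ((- 1) ^+ j) => ? ? ? ? ?; ring.
rewrite alg mulrA -(E_natmul (- b2)) -(E_natmul a1) -!E_add; congr (E _ z * _).
rewrite -[(- b2) *+ _]mulr_natl -[a1 *+ _]mulr_natl natrB; last by rewrite -ltnS.
ring.
Qed.

Let f2E k z : f2 k z = E (t + n.+1%:R * a1) z * B' k z ^+ n.+1.
Proof.
rewrite /f2 B'E exprMn.
by rewrite -(E_natmul a1) mulrA -E_add -[a1 *+ _]mulr_natl.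
Qed.

Let wseq_term r i : n%:R * b2 <= r -> wseq nneg (term r i).
Proof.
move=> hr; have i0 : 0 <= r - n%:R * b2 + i%:R * (a1 + b2).
  by rewrite addr_ge0 ?subr_ge0 // mulr_ge0 // ltW.
have SS b : nneg b -> nneg (r - n%:R * b2 + i%:R * (a1 + b2) + b) by exact: addr_ge0.
have H := wseq_mul (w1_nneg R) (wseq_exp (n - i) (w1_nneg R) hA')
  (wseq_mul (w1_nneg R) (wseq_cst ((- 1) ^+ i) (w1_nneg R)) (wseq_exp i (w1_nneg R) hB')).
exact: (wseq_shift SS H).
Qed.

Let hf1 : wseq nneg f1.
Proof.
have -> : f1 = fun k z => \sum_(i < n.+1) term s i k z.
  by apply/funext => k; apply/funext => z; exact: f1E.
by apply: wseq_sum; [exact: w1_nneg|move=> i; exact: wseq_term].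
Qed.

Let hf2 : wseq nneg f2.
Proof.
have -> : f2 = fun k z => E (t + n.+1%:R * a1) z * B' k z ^+ n.+1.
  by apply/funext => k; apply/funext => z; exact: f2E.
apply: (@wseq_shift _ nneg nneg); last by apply: wseq_exp => //; exact: w1_nneg.
by move=> b; apply: addr_ge0; rewrite -lerBlDr sub0r.
Qed.

Let lower_bound y : 0 <= y -> exists (delta : R) n0, 0 < delta /\
  forall k x, (n0 <= k)%N -> delta <= cabs (f1 k (x +i* y)) + cabs (f2 k (x +i* y)).
Proof.
move=> y0; have [delta [n0 [d0 hd]]] := lines y0.
have [K K0 hK] := wseq_line (fun _ h => h) hA' y0.
have [L L0 hL] := wseq_line (fun _ h => h) hB' y0.
pose M := expR (b2 * y) * K + expR (- (a1 * y)) * L.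
have [tau tau0 ht] := geomS_lower n M d0.
pose m := Num.min (expR (- (s * y))) (expR (- (t * y))).
have m0 : 0 < m by rewrite lt_min !expR_gt0.
exists (m * tau), n0; split; first exact: mulr_gt0.
move=> k x hk.
have -> : cabs (f1 k (x +i* y)) =
    expR (- (s * y)) * cabs (geomS n (A k (x +i* y)) (B k (x +i* y))).
  by rewrite /f1 cabsM cabs_E /= mulNr.
have -> : cabs (f2 k (x +i* y)) = expR (- (t * y)) * cabs (B k (x +i* y)) ^+ n.+1.
  by rewrite /f2 cabsM cabs_E cabsX /= mulNr.
have hAM : cabs (A k (x +i* y)) <= M.
  rewrite A'E cabsM cabs_E /= opprK; apply: ler_wpDr; first by rewrite mulr_ge0 ?expR_ge0.
  by rewrite ler_wpM2l ?expR_ge0.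
have hBM : cabs (B k (x +i* y)) <= M.
  rewrite B'E cabsM cabs_E /= mulNr; apply: ler_wpDl; first by rewrite mulr_ge0 ?expR_ge0.
  by rewrite ler_wpM2l ?expR_ge0.
have H := ht _ _ hAM hBM (hd k x hk).
apply: (@le_trans _ _ (m * (cabs (geomS n (A k (x +i* y)) (B k (x +i* y))) +
   cabs (B k (x +i* y)) ^+ n.+1))); first by rewrite ler_wpM2l // ltW.
rewrite mulrDr; apply: lerD; apply: ler_wpM2r => //; rewrite ?exprn_ge0 //.
  by rewrite ge_min lexx.
by rewrite ge_min lexx orbT.
Qed.

Let hsw Y := @sw_weight R Y Y.

(** Constant multipliers suffice high up. If [t] is extremal, [f2] tends to [c ^+ n.+1]. If [s] is,
    the leading term of [f1] tends to [c ^+ n], while all others carry the factor [E (a1 + b2)],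
    which decays because [a1 + b2] is strictly positive. *)
Let solv_infinity : exists2 Y : R, 0 <= Y & solv f1 f2 nneg (sw Y Y).
Proof.
have [c c0 [[tE cB]|[sE cA]]] := infinity.
  have B'ev k z : B' k z = ev [seq (u.1, - a1 + u.2) | u <- sb k] z.
    by rewrite /B' Bev ev_shift.
  have cB' : cvgC (fun k => coefl [seq (u.1, - a1 + u.2) | u <- sb k] 0) c.
    apply: (eq_ind _ (fun F => cvgC F c) cB); apply/funext => k.
    by rewrite -{1}(coefl_shift (- a1)) addNr.
  have h2 : 0 < 1 / 2 :> R by lra.
  have [Y Y0 [n0 hn]] := pow_at_infinity n.+1 hB' B'ev cB' c0 h2.
  exists Y => //.
  apply: (boost hf1 hf2 (hsw Y) (fun _ h => h) (fun a => sw_le1 Y0 Y0)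
    (P1 := fun=> 0) (P2 := fun=> c ^- n.+1) (C := cabs (c ^- n.+1)) (q := 1 / 2) (n0 := n0)).
  - by lra.
  - by apply: ep_le (ep_zero _ _); exact: cabs_ge0.
  - exact: ep_cst.
  - move=> k hk; apply: ep_ext (hn Y k (lexx _) hk) => z.
    by rewrite /residual f2E tE addNr E0 mul1r mulr0 add0r.
have A'ev k z : A' k z = ev [seq (u.1, b2 + u.2) | u <- sa k] z.
  by rewrite /A' Aev ev_shift.
have cA' : cvgC (fun k => coefl [seq (u.1, b2 + u.2) | u <- sa k] 0) c.
  apply: (eq_ind _ (fun F => cvgC F c) cA); apply/funext => k.
  by rewrite -{1}(coefl_shift b2) addrN.
have h4 : 0 < 1 / 4 :> R by lra.
have [Y1 Y10 [n0 hn]] := pow_at_infinity n hA' A'ev cA' c0 h4.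
pose T i k z := E (i%:R * (a1 + b2)) z * (A' k z ^+ (n - i.+1) * ((- 1) ^+ i.+1 * B' k z ^+ i.+1)).
pose tail k z := \sum_(i < n) T i k z.
have hT : wseq nneg tail.
  apply: wseq_sum; first exact: w1_nneg.
  move=> i; have SS b : nneg b -> nneg (i%:R * (a1 + b2) + b).
    by apply: addr_ge0; rewrite mulr_ge0 // ltW.
  have H := wseq_mul (w1_nneg R) (wseq_exp (n - i.+1) (w1_nneg R) hA')
    (wseq_mul (w1_nneg R) (wseq_cst ((- 1) ^+ i.+1) (w1_nneg R)) (wseq_exp i.+1 (w1_nneg R) hB')).
  exact: (wseq_shift SS H).
have f1A k z : f1 k z = A' k z ^+ n + E (a1 + b2) z * tail k z.
  rewrite f1E big_ord_recl /term sE subrr add0r mul0r E0 mul1r subn0 !expr0 !mulr1.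
  congr (_ + _).
  rewrite mulr_sumr; apply: eq_bigr => i _; rewrite /T /= -[bump 0 i]/i.+1 add0r [RHS]mulrA -E_add.
  by rewrite -[in LHS]natr1 mulrDl mul1r [i%:R * _ + _]addrC.
have [[K hK] _] := hT.
have K0 : 0 <= K by apply: ep_ge0 (hK 0%N); exact: w1_ge0.
have L0 : 0 < K * cabs (c ^- n) + 1 by rewrite ltr_wpDl // mulr_ge0.
have [Y2 Y20 h2] := expR_small kappa0 (divr_gt0 h4 L0).
pose Y := Num.max Y1 Y2; have Y0 : 0 <= Y by rewrite le_max Y10.
exists Y => //.
apply: (boost hf1 hf2 (hsw Y) (fun _ h => h) (fun a => sw_le1 Y0 Y0)
  (P1 := fun=> c ^- n) (P2 := fun=> 0) (C := cabs (c ^- n)) (q := 1 / 2) (n0 := n0)).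
- by lra.
- exact: ep_cst.
- by apply: ep_le (ep_zero _ _); exact: cabs_ge0.
move=> k hk.
have H1 := hn Y k _ hk.
have Sk : nneg (a1 + b2) by exact: ltW.
have hKY : ep nneg (sw Y Y) K (tail k).
  by apply: ep_mono (hK k) => // a a0; exact: sw_le1.
have H2 := ep_mul (hsw Y) (ep_E (sw Y Y) (c ^- n) Sk) hKY.
have YY : Y1 <= Y by rewrite le_max lexx.
apply: ep_le (ep_ext _ (ep_add (H1 YY) H2)) => [|z]; last by rewrite /residual f1A; ring.
have H3 : sw Y Y (a1 + b2) <= 1 / 4 / (K * cabs (c ^- n) + 1).
  apply: le_trans h2; rewrite /sw maxxx ler_expR mulNr lerN2 ler_pM2l //.
  by rewrite le_max lexx orbT.
have H4 : cabs (c ^- n) * sw Y Y (a1 + b2) * K <= 1 / 4.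
  rewrite mulrAC mulrC [_ * K]mulrC; apply: le_trans (ler_wpM2r _ H3) _.
    by rewrite mulr_ge0.
  by rewrite mulrAC ler_pdivrMr // ler_wpM2l ?(ltW h4) // lerDl.
lra.
Qed.

Theorem bezout_power :
  [/\ WW nneg (fun x => e s x * geomS n (FA x) (FB x)), WW nneg (fun x => e t x * FB x ^+ n.+1) &
   exists h1 h2, [/\ WW nneg h1, WW nneg h2 &
     forall x, e s x * geomS n (FA x) (FB x) * h1 x + e t x * FB x ^+ n.+1 * h2 x = 1]].
Proof.
have hAT := wseqS (S' := predT) (fun _ _ => isT) hA.
have hBT := wseqS (S' := predT) (fun _ _ => isT) hB.
have c1 : uconv (fun x => e s x * geomS n (FA x) (FB x)) f1.
  apply: uconv_shift; apply: uconv_sum => i.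
  apply: (@uconvM _ predT).
  - exact: (wseq_exp _ (w1_weightT R) hAT).
  - apply: (wseq_exp _ (w1_weightT R)).
    have := wseq_mul (w1_weightT R) (wseq_cst (-1) (w1_weightT R)) hBT.
    congr wseq; apply/funext => k; apply/funext => z; exact: mulN1r.
  - exact: uconv_exp (w1_weightT R) hAT FA_A.
  - have hN := wseq_mul (w1_weightT R) (wseq_cst (-1) (w1_weightT R)) hBT.
    have uN : uconv (fun x => - FB x) (fun k z => - 1 * B k z).
      move=> eps /FB_B[n0 h0]; exists n0 => k x /(h0 k x).
      by rewrite mulN1r -opprD cabsN.
    have := uconv_exp (i : nat) (w1_weightT R) hN uN.
    congr uconv; apply/funext => k; apply/funext => z; by rewrite mulN1r.
have c2 : uconv (fun x => e t x * FB x ^+ n.+1) f2.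
  by apply: uconv_shift; exact: uconv_exp (w1_weightT R) hBT FB_B.
split; [by exists f1|by exists f2|].
exact: (corona_functions hf1 hf2 c1 c2 (corona hf1 hf2 lower_bound solv_infinity)).
Qed.

End BezoutPower.
End Bezout.

(** * Factorization *)

Section TriangularFactorization.
Variable R : realType.
Implicit Types (X : (R -> R[i]) -> Prop).

Lemma mx2_mul (a b c d a' b' c' d' : R[i]) : mx2 a b c d *m mx2 a' b' c' d' =
  mx2 (a * a' + b * c') (a * b' + b * d') (c * a' + d * c') (c * b' + d * d').
Proof.
apply/matrixP => i j; rewrite mxE big_ord_recl big_ord1 !mxE /=.
by case: (i == 0); case: (j == 0).
Qed.

Lemma mx2_1 : mx2 (1 : R[i]) 0 0 1 = 1%:M.
Proof.
apply/matrixP => i j; rewrite !mxE.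
by case: i => [[|[|i]] // hi]; case: j => [[|[|j]] // hj].
Qed.

Lemma mx2_inv (a b c d : R[i]) : a * d - b * c = 1 ->
  mx2 a b c d \in unitmx /\ invmx (mx2 a b c d) = mx2 d (- b) (- c) a.
Proof.
move=> h.
have E1 : mx2 a b c d *m mx2 d (- b) (- c) a = 1%:M.
  rewrite mx2_mul -mx2_1; congr mx2; first by rewrite mulrN.
  - by rewrite mulrN mulrC addNr.
  - by rewrite mulrN mulrC subrr.
  - by rewrite mulrN [c * b]mulrC addrC [d * a]mulrC.
have [u _] := mulmx1_unit E1; split => //.
by rewrite -[invmx _]mulmx1 -E1 mulKmx.
Qed.

Lemma mx2_unit_over X (a b c d : R -> R[i]) : (forall x, a x * d x - b x * c x = 1) ->
  X a -> X b -> X c -> X d -> X (fun x => - b x) -> X (fun x => - c x) ->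
  mx_unit_over X (fun x => mx2 (a x) (b x) (c x) (d x)).
Proof.
move=> h Xa Xb Xc Xd Xb' Xc'; have hx x := mx2_inv (h x).
have ext f f' : X f' -> f =1 f' -> X f by move=> Xf /funext ->.
split=> [x|i j|i j]; first by have [] := hx x.
  by case: i => [[|[|i]] // hi]; case: j => [[|[|j]] // hj];
    [apply: ext Xa _|apply: ext Xb _|apply: ext Xc _|apply: ext Xd _] => x; rewrite mxE.
by case: i => [[|[|i]] // hi]; case: j => [[|[|j]] // hj];
  [apply: ext Xd _|apply: ext Xb' _|apply: ext Xc' _|apply: ext Xa _] => x;
  rewrite (proj2 (hx x)) mxE.
Qed.

(* The columns [Gp] and [Gm] are completed by Bezout, which reduces the matrix to
   [mx2 m 0 (fp + fm) m']; the two halves of the corner entry are absorbed in the factors. *)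
Lemma corner_algebra (L L' m m' g p1 p2 q1 q2 u1 u2 k1 k2 fp fm : R[i]) :
  L * L' = 1 -> m * m' = 1 -> L' * p1 = m' * q1 -> g * p1 + L * p2 = m' * q2 ->
  p1 * u1 + p2 * u2 = 1 -> q1 * k1 + q2 * k2 = 1 ->
  k1 * (L' * u2) + k2 * (g * u2 - L * u1) = fp + fm ->
  mx2 L' 0 g L *m mx2 (u2 - p1 * (m * fp)) p1 (- u1 - p2 * (m * fp)) p2 =
  mx2 (k2 + q1 * (m' * fm)) q1 (- k1 + q2 * (m' * fm)) q2 *m mx2 m 0 0 m'.
Proof.
move=> hL hm h1 h2 hp hq hf; rewrite !mx2_mul !mul0r !mulr0 !addr0 !add0r.
pose w1 := L' * u2; pose w2 := g * u2 - L * u1.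
have det : q2 * w1 - q1 * w2 = m.
  have : m' * (q2 * w1 - q1 * w2) = 1.
    have -> : m' * (q2 * w1 - q1 * w2) = (m' * q2) * w1 - (m' * q1) * w2 by ring.
    rewrite -h1 -h2 /w1 /w2.
    have -> : (g * p1 + L * p2) * (L' * u2) - L' * p1 * (g * u2 - L * u1) =
      L * L' * (p1 * u1 + p2 * u2) by ring.
    by rewrite hL hp mulr1.
  move=> h; have : m * (m' * (q2 * w1 - q1 * w2)) = m by rewrite h mulr1.
  by rewrite mulrA hm mul1r.
have hw1 : w1 = k2 * m + (fp + fm) * q1.
  rewrite -det -hf -/w1 -/w2.
  have -> : k2 * (q2 * w1 - q1 * w2) + (k1 * w1 + k2 * w2) * q1 = (q1 * k1 + q2 * k2) * w1.
    by ring.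
  by rewrite hq mul1r.
have hw2 : w2 = - k1 * m + (fp + fm) * q2.
  rewrite -det -hf -/w1 -/w2.
  have -> : - k1 * (q2 * w1 - q1 * w2) + (k1 * w1 + k2 * w2) * q2 = (q1 * k1 + q2 * k2) * w2.
    by ring.
  by rewrite hq mul1r.
congr mx2 => //; [|by rewrite h1 mulrC| |by rewrite h2 mulrC].
- have -> : L' * (u2 - p1 * (m * fp)) = w1 - (L' * p1) * m * fp by rewrite /w1; ring.
  rewrite h1 hw1.
  have -> : (k2 + q1 * (m' * fm)) * m = k2 * m + q1 * fm * (m * m') by ring.
  have -> : m' * q1 * m * fp = (m * m') * q1 * fp by ring.
  by rewrite hm; ring.
- have -> : g * (u2 - p1 * (m * fp)) + L * (- u1 - p2 * (m * fp)) =
    w2 - (g * p1 + L * p2) * m * fp by rewrite /w2; ring.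
  rewrite h2 hw2.
  have -> : (- k1 + q2 * (m' * fm)) * m = - k1 * m + q2 * fm * (m * m') by ring.
  have -> : m' * q2 * m * fp = (m * m') * q2 * fp by ring.
  by rewrite hm; ring.
Qed.

Theorem triangular_factorization (lam mu : R) (g p1 p2 q1 q2 : R -> R[i]) :
  0 <= mu -> WW predT g -> WW nneg p1 -> WW nneg p2 -> WW npos q1 -> WW npos q2 ->
  (forall x, e (- lam) x * p1 x = e (- mu) x * q1 x) ->
  (forall x, g x * p1 x + e lam x * p2 x = e (- mu) x * q2 x) ->
  (exists u1 u2, [/\ WW nneg u1, WW nneg u2 & forall x, p1 x * u1 x + p2 x * u2 x = 1]) ->
  (exists k1 k2, [/\ WW npos k1, WW npos k2 & forall x, q1 x * k1 x + q2 x * k2 x = 1]) ->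
  APW_factorization (Gmx lam g) mu (- mu).
Proof.
move=> mu0 hg hp1 hp2 hq1 hq2 h1 h2 [u1 [u2 [hu1 hu2 hu]]] [k1 [k2 [hk1 hk2 hk]]].
have wT := w1_weightT R; have wp := w1_nneg R; have wn := w1_npos R.
have up (f : R -> R[i]) : WW nneg f -> WW predT f by apply: WWS.
have un (f : R -> R[i]) : WW npos f -> WW predT f by apply: WWS.
(* With the completed matrices [Gp0 = mx2 u2 p1 (- u1) p2] and [Gm0 = mx2 k2 q1 (- k1) q2], this is
   the lower left entry of [invmx Gm0 *m G *m Gp0]. *)
pose f x := k1 x * (e (- lam) x * u2 x) + k2 x * (g x * u2 x - e lam x * u1 x).
have he (b : R) : WW predT (e b) by exact: WW_e.
have hf : WW predT f.
  have H1 := WWM wT (un _ hk1) (WWM wT (he (- lam)) (up _ hu2)).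
  have H2 := WWN wT (WWM wT (he lam) (up _ hu1)).
  exact: (WWD H1 (WWM wT (un _ hk2) (WWD (WWM wT hg (up _ hu2)) H2))).
have [fp [fm [hfp hfm fE]]] := WW_split nneg hf.
(* Moving a half of the corner entry past the diagonal multiplies it by [e mu] or [e (- mu)]; as
   [mu] is nonnegative, each half stays on its side. *)
pose u x := e mu x * fp x; pose v x := e (- mu) x * fm x.
have hU : WW nneg u by apply: WW_shift hfp => b; exact: addr_ge0.
have hV : WW npos v.
  apply: WW_shift hfm => b; rewrite /= /nneg /npos -ltNge => b0; lra.
pose a x := u2 x - p1 x * u x; pose c x := - u1 x - p2 x * u x.
pose a' x := k2 x + q1 x * v x; pose c' x := - k1 x + q2 x * v x.
have ha : WW nneg a by exact: WWD hu2 (WWN wp (WWM wp hp1 hU)).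
have hc : WW nneg c by exact: WWD (WWN wp hu1) (WWN wp (WWM wp hp2 hU)).
have ha' : WW npos a' by exact: WWD hk2 (WWM wn hq1 hV).
have hc' : WW npos c' by exact: WWD (WWN wn hk1) (WWM wn hq2 hV).
have detp x : a x * p2 x - p1 x * c x = 1.
  by rewrite -(hu x) /a /c; ring.
have detm x : a' x * q2 x - q1 x * c' x = 1.
  by rewrite -(hk x) /a' /c'; ring.
exists (fun x => mx2 (a' x) (q1 x) (c' x) (q2 x)), (fun x => mx2 (a x) (p1 x) (c x) (p2 x)).
split.
- by apply: mx2_unit_over => //; apply: WW_APW_minus => //; apply: (WWN wn).
- by apply: mx2_unit_over => //; apply: WW_APW_plus => //; apply: (WWN wp).
move=> x; have [unit_p _] := mx2_inv (detp x).
have H := corner_algebra (e_mulN lam x) (e_mulN mu x) (h1 x) (h2 x) (hu x) (hk x) (fE x).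
by rewrite /a' /c' /v -H -/(u x) -/(a x) -/(c x) mulmxK.
Qed.

End TriangularFactorization.

Section PairFactorization.
Variable R : realType.
Implicit Types (f : R -> R[i]) (p : nat -> R[i] -> R[i]) (S : pred R).
Local Open Scope complex_scope.

Definition flip (s : seq (R[i] * R)) := [seq (t.1, - t.2) | t <- s].

Lemma ev_flip s z : ev (flip s) z = ev s (- z).
Proof. by rewrite /ev big_map; apply: eq_bigr => t _; rewrite E_oppz. Qed.

Lemma coefl_flip s a : coefl (flip s) a = coefl s (- a).
Proof. by rewrite /coefl big_map /=; apply: eq_bigl => t; rewrite eqr_oppLR. Qed.

Lemma ep_reflect S S' M (P : R[i] -> R[i]) : (forall a, S a -> S' (- a)) ->
  ep S w1 M P -> ep S' w1 M (fun z => P (- z)).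
Proof.
move=> SS [s [h1 h2 h3]]; exists (flip s); split.
- by rewrite all_map; apply: sub_all h1 => t; exact: SS.
- by rewrite /wn big_map.
- by move=> z; rewrite ev_flip.
Qed.

Lemma wseq_reflect S S' p : (forall a, S a -> S' (- a)) -> wseq S p ->
  wseq S' (fun k z => p k (- z)).
Proof.
move=> SS [[K hK] hp]; split; first by exists K => k; exact: ep_reflect SS (hK k).
by move=> eps /hp[n0 hn]; exists n0 => k m hk hm; exact: (ep_reflect SS (hn k m hk hm)).
Qed.

Lemma uconv_reflect f p : uconv f p -> uconv (fun x => f (- x)) (fun k z => p k (- z)).
Proof.
by move=> fp eps /fp[n0 hn]; exists n0 => k x /(hn k (- x)); rewrite rmorphN.
Qed.

Lemma WW_reflect S S' f : (forall a, S a -> S' (- a)) -> WW S f -> WW S' (fun x => f (- x)).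
Proof.
move=> SS [p hp fp]; exists (fun k z => p k (- z)); first exact: wseq_reflect hp.
exact: uconv_reflect.
Qed.

Lemma nneg_opp (a : R) : nneg a -> npos (- a).
Proof. by rewrite /nneg /npos oppr_le0. Qed.

Variables (lam mu s a1 a2 b1 b2 : R) (n : nat) (gm gp : R -> R[i]) (ca cb : R -> R[i]).
Variables sa sb : nat -> seq (R[i] * R).
Hypotheses (hA : wseq (fun a => - b2 <= a <= - b1) (fun k => ev (sa k)))
  (hB : wseq (fun a => a1 <= a <= a2) (fun k => ev (sb k))).
Hypotheses (uA : uconv gm (fun k => ev (sa k))) (uB : uconv gp (fun k => ev (sb k))).
Hypotheses (cA : forall a, cvgC (fun k => coefl (sa k) a) (ca a))
  (cB : forall a, cvgC (fun k => coefl (sb k) a) (cb a)).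
Hypothesis lines : forall y : R, exists (delta : R) n0, 0 < delta /\
  forall k x, (n0 <= k)%N -> delta <= cabs (ev (sa k) (x +i* y)) + cabs (ev (sb k) (x +i* y)).
Hypotheses (mu0 : 0 <= mu) (kp : 0 < a1 + b2) (km : 0 < b1 + a2).
Hypotheses (s1 : n%:R * b2 <= s) (s2 : lam - n.+1%:R * a1 <= s)
  (s3 : n%:R * a2 <= lam - mu - s) (s4 : - (n.+1%:R * b1) <= - mu - s).
Hypothesis inf_p : (s = lam - n.+1%:R * a1 /\ cb a1 != 0) \/ (s = n%:R * b2 /\ ca (- b2) != 0).
Hypothesis inf_m : (- mu - s = - (n.+1%:R * b1) /\ ca (- b1) != 0) \/
  (lam - mu - s = n%:R * a2 /\ cb a2 != 0).

(** [s1] to [s4] place the spectra of [p1], [p2], [q1], [q2] in the right half-lines. [inf_p] and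
    [inf_m] ask that in each column one of the two inequalities be an equality, at a frequency with
    nonzero coefficient: that entry then has a nonzero limit at infinity. *)
Theorem pair_factorization : APW_factorization (Gmx lam (fun x => gm x + gp x)) mu (- mu).
Proof.
have wT := w1_weightT R; have wN := w1_npos R; have wP := w1_nneg R.
have hA1 : wseq (fun a => - b2 <= a) (fun k => ev (sa k)).
  by apply: wseqS hA => a /andP[].
have hB1 : wseq (fun a => a1 <= a) (fun k => ev (sb k)).
  by apply: wseqS hB => a /andP[].
have hA2 : wseq (fun a => b1 <= a) (fun k z => ev (sa k) (- z)).
  by apply: wseq_reflect hA => a /andP[_]; rewrite lerNr.
have hB2 : wseq (fun a => - a2 <= a) (fun k z => ev (sb k) (- z)).
  by apply: wseq_reflect hB => a /andP[_]; rewrite lerN2.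
have t1 : - (n.+1%:R * a1) <= s - lam by rewrite lerBrDr addrC.
have lines_p y : 0 <= y -> exists (delta : R) n0, 0 < delta /\ forall k x, (n0 <= k)%N ->
    delta <= cabs (ev (sa k) (x +i* y)) + cabs (ev (sb k) (x +i* y)) by move=> _; exact: lines.
have lines_m y : 0 <= y -> exists (delta : R) n0, 0 < delta /\ forall k x, (n0 <= k)%N ->
    delta <= cabs (ev (sb k) (- (x +i* y))) + cabs (ev (sa k) (- (x +i* y))).
  move=> _; have [delta [n0 [d0 hd]]] := lines (- y).
  by exists delta, n0; split => // k x hk; rewrite addrC; exact: hd.
have inf_p' : exists2 c : R[i], c != 0 &
    (s - lam = - (n.+1%:R * a1) /\ cvgC (fun k => coefl (sb k) a1) c) \/
    (s = n%:R * b2 /\ cvgC (fun k => coefl (sa k) (- b2)) c).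
  case: inf_p => [[sE c0]|[sE c0]].
    by exists (cb a1) => //; left; split; [rewrite sE addrAC subrr add0r|exact: cB].
  by exists (ca (- b2)) => //; right; split; [|exact: cA].
have cvg_flip (r : nat -> seq (R[i] * R)) a c :
    cvgC (fun k => coefl (r k) a) c -> cvgC (fun k => coefl (flip (r k)) (- a)) c.
  move=> h; apply: (eq_ind _ (fun F => cvgC F c) h); apply/funext => k.
  by rewrite coefl_flip opprK.
have inf_m' : exists2 c : R[i], c != 0 &
    (- mu - s = - (n.+1%:R * b1) /\ cvgC (fun k => coefl (flip (sa k)) b1) c) \/
    (lam - mu - s = n%:R * a2 /\ cvgC (fun k => coefl (flip (sb k)) (- a2)) c).
  case: inf_m => [[sE c0]|[sE c0]].
    exists (ca (- b1)) => //; left; split => //.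
    by have := cvg_flip sa (- b1) _ (cA (- b1)); rewrite opprK.
  exists (cb a2) => //; right; split => //.
  exact: (cvg_flip sb a2 _ (cB a2)).
have [hp1 hp2 [h1 [h2 [hh1 hh2 hp]]]] := bezout_power hA1 hB1 (fun _ _ => erefl)
  (fun _ _ => erefl) uA uB kp s1 t1 lines_p inf_p'.
(* The column for the lower half-plane is that of the reflected functions for the upper one, with
   [gp] in the role of [A] and [gm] in that of [B]. *)
have [hm1 hm2 [k1 [k2 [hk1 hk2 hm]]]] := bezout_power hB2 hA2
  (fun k z => esym (ev_flip (sb k) z)) (fun k z => esym (ev_flip (sa k) z))
  (uconv_reflect uB) (uconv_reflect uA) km s3 s4 lines_m inf_m'.
have refl (f : R -> R[i]) : WW nneg f -> WW npos (fun x => f (- x)).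
  by apply: WW_reflect; exact: nneg_opp.
have WWgm : WW predT gm by exists (fun k => ev (sa k)) => //; apply: wseqS hA.
have WWgp : WW predT gp by exists (fun k => ev (sb k)) => //; apply: wseqS hB.
pose p1 x := e s x * geomS n (gm x) (gp x).
pose p2 x := (- 1) ^+ n.+1 * (e (s - lam) x * gp x ^+ n.+1).
pose q1 x := e (s - lam + mu) x * geomS n (gm x) (gp x).
pose q2 x := e (s + mu) x * gm x ^+ n.+1.
have sq k : (- 1) ^+ k * (- 1) ^+ k = 1 :> R[i] by rewrite -expr2 sqrr_sign.
have q1E x : q1 x = (- 1) ^+ n * (e (lam - mu - s) (- x) * geomS n (gp (- - x)) (gm (- - x))).
  rewrite opprK geomS_sym e_oppx mulrCA [_ * (_ * geomS _ _ _)]mulrA sq mul1r /q1.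
  by congr (e _ _ * _); ring.
have q2E x : q2 x = e (- mu - s) (- x) * gm (- - x) ^+ n.+1.
  by rewrite opprK e_oppx /q2; congr (e _ _ * _); ring.
have hp2' : WW nneg p2 by exact: WWZ wP hp2.
apply: (triangular_factorization (p1 := p1) (p2 := p2) (q1 := q1) (q2 := q2)
  mu0 (WWD WWgm WWgp) hp1 hp2').
- by apply: (WW_ext (fun x => esym (q1E x))); apply: (WWZ _ wN); exact: refl hm1.
- by apply: (WW_ext (fun x => esym (q2E x))); exact: refl hm2.
- move=> x; rewrite /p1 /q1 !mulrA -!e_add; congr (e _ _ * _); ring.
- move=> x; rewrite /p1 /p2 /q2.
  have -> : e lam x * ((- 1) ^+ n.+1 * (e (s - lam) x * gp x ^+ n.+1)) =
    (e lam x * e (s - lam) x) * (- gp x) ^+ n.+1 by rewrite [(- gp x) ^+ _]exprNn; ring.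
  rewrite [e (- mu) x * _]mulrA -!e_add.
  have -> : lam + (s - lam) = s by ring.
  have -> : - mu + (s + mu) = s by ring.
  by rewrite mulrCA geomSE -mulrDr subrK.
- exists h1, (fun x => (- 1) ^+ n.+1 * h2 x); split => //; first exact: WWZ.
  move=> x; rewrite -[RHS](hp x) /p1 /p2; congr (_ + _).
  have -> : (- 1) ^+ n.+1 * (e (s - lam) x * gp x ^+ n.+1) * ((- 1) ^+ n.+1 * h2 x) =
    ((- 1) ^+ n.+1 * (- 1) ^+ n.+1) * (e (s - lam) x * gp x ^+ n.+1 * h2 x) by ring.
  by rewrite sq mul1r.
- exists (fun x => (- 1) ^+ n * k1 (- x)), (fun x => k2 (- x)); split.
  + by apply: (WWZ _ wN); exact: refl hk1.
  + exact: refl hk2.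
  + move=> x; rewrite -[RHS](hm (- x)) q1E q2E; congr (_ + _).
    set u := e _ _ * _.
    have -> : (- 1) ^+ n * u * ((- 1) ^+ n * k1 (- x)) =
      ((- 1) ^+ n * (- 1) ^+ n) * (u * k1 (- x)) by ring.
    by rewrite sq mul1r.
Qed.

End PairFactorization.

(** * Series of the entire extensions, and the four cases *)

Section Conclusion.
Variable R : realType.
Local Open Scope complex_scope.

(** As the spectrum is bounded, the coefficient norm controls the series on each horizontal strip up
    to the factor [C Y]. The sum agrees with [f] on the real line, and [entire_eq] identifies it
    with the given [F], so that lower bounds for [F] pass to the approximants. *)
Lemma AP_entire_series (f : R -> R[i]) (F : R[i]^o -> R[i]^o) (l u K : R) : AP f ->
  (forall a, Omega f a -> l <= a <= u) ->
  (forall X : seq R, uniq X -> {in X, forall a, Omega f a} ->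
     \sum_(a <- X) cabs (bohr_coef f a) <= K) ->
  entire_extension f F ->
  exists s, [/\ wseq (fun a => l <= a <= u) (fun k => ev (s k)), uconv f (fun k => ev (s k)),
    forall a, cvgC (fun k => coefl (s k) a) (bohr_coef f a) &
    forall y eps : R, 0 < eps -> exists n0, forall k x, (n0 <= k)%N ->
      cabs (F (x +i* y) - ev (s k) (x +i* y)) <= eps].
Proof.
move=> hf hO hK [hF Ff].
have [s [hs us cs]] := AP_series (S := fun a => l <= a <= u) hf hO hK.
exists s; split => //; have [_ hc] := hs.
pose C Y := expR ((`|l| + `|u|) * Y).
have near Y eps : 0 <= Y -> 0 < eps -> exists n0, forall k m z, (n0 <= k)%N -> (n0 <= m)%N ->
    `|complex.Im z| <= Y -> cabs (ev (s k) z - ev (s m) z) <= eps.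
  move=> Y0 e0; have [n0 hn] := hc _ (divr_gt0 e0 (expR_gt0 ((`|l| + `|u|) * Y))).
  exists n0 => k m z hk hm hz; have [r [r1 r2 r3]] := hn k m hk hm.
  have : cabs (ev (s k) z - ev (s m) z) <= C Y * wn w1 r.
    apply: (@ep_bound _ (fun a => l <= a <= u) (fun=> C Y) _
      (fun z => ev (s k) z - ev (s m) z)) => [|a /andP[la au]].
      exists r; split => //.
      by rewrite /wn mulr_sumr; apply: ler_sum => t _; rewrite /w1 mulr1 mulrC.
    rewrite /= /C ler_expR; apply: le_trans (ler_norm _) _; rewrite normrM normrN.
    apply: ler_pM => //; rewrite ler_norml; apply/andP; split.
      by have := ler_norm (- l); rewrite normrN; have := normr_ge0 u; lra.
    by have := ler_norm u; have := normr_ge0 l; lra.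
  move=> /le_trans; apply; rewrite mulrC -ler_pdivlMr ?expR_gt0 //.
have /choice[G hG] : forall z : R[i], exists w, cvgC (fun k => ev (s k) z) w.
  move=> z; apply: cauchyC_cvg => eps e0.
  have [n0 hn] := near _ _ (normr_ge0 (complex.Im z)) e0.
  by exists n0 => k m hk hm; exact: hn.
have nearG Y eps : 0 <= Y -> 0 < eps -> exists n0, forall k z, (n0 <= k)%N ->
    `|complex.Im z| <= Y -> cabs (G z - ev (s k) z) <= eps.
  move=> Y0 e0; have [n0 hn] := near _ _ Y0 e0; exists n0 => k z hk hz.
  by apply: (cvgC_le (n0 := n0) (hG z)) => m hm; exact: hn.
have FG : forall z, F z = G z.
  apply: (entire_eq (An := fun k => ev (s k))).
  - by move=> z; apply: cdiff_derivable; exact: hF.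
  - by move=> k z; exact: cdiff_ev.
  - move=> Y eps e0; have [n0 hn] := nearG _ _ (normr_ge0 Y) e0; exists n0 => z hz.
    by apply: hn => //; exact: le_trans (ler_norm _).
  - move=> x; rewrite Ff; apply: cvgC_uniq (hG _) => eps /us[n0 hn].
    by exists n0 => k hk; rewrite cabsC; exact: hn.
move=> y eps e0; have [n0 hn] := nearG _ _ (normr_ge0 y) e0.
by exists n0 => k x hk; rewrite FG; exact: hn.
Qed.

Lemma strip_line (Fm Fp : R[i]^o -> R[i]^o) :
  (forall eps1 eps2 : R, 0 <= eps1 -> 0 <= eps2 ->
     (0 < ereal_inf [set (cabs (Fp z) + cabs (Fm z))%:E | z in strip eps1 eps2])%E) ->
  forall y : R, exists2 delta : R, 0 < delta &
    forall x : R, delta <= cabs (Fm (x +i* y)) + cabs (Fp (x +i* y)).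
Proof.
move=> h y; have Y0 : 0 <= `|y| + 1 by rewrite addr_ge0.
have := h _ _ Y0 Y0; set I := ereal_inf _ => I0.
have hI x : (I <= (cabs (Fm (x +i* y)) + cabs (Fp (x +i* y)))%:E)%E.
  apply: ereal_inf_lbound; exists (x +i* y); last by rewrite addrC.
  rewrite /strip /=; apply/andP; split.
    by have := ler_norm (- y); rewrite normrN; lra.
  by have := ler_norm y; lra.
have If : I \is a fin_num.
  by apply/fin_numPlt; rewrite (lt_trans _ I0) ?ltNyr //= (le_lt_trans (hI 0)) // ltry.
exists (fine I); first by rewrite -lte_fin fineK.
by move=> x; rewrite -lee_fin fineK.
Qed.

(** Carries absolute summability from [g] to [gm] and [gp], whose nonzero coefficients are
    coefficients of [g]. *)
Lemma same_values_sum (c c' : R -> R[i]) K :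
  (forall a, c' a != 0 -> c a = c' a) ->
  (forall X : seq R, uniq X -> {in X, forall a, c a != 0} -> \sum_(a <- X) cabs (c a) <= K) ->
  forall X : seq R, uniq X -> {in X, forall a, c' a != 0} -> \sum_(a <- X) cabs (c' a) <= K.
Proof.
move=> cc hK X uX hX.
have -> : \sum_(a <- X) cabs (c' a) = \sum_(a <- X) cabs (c a).
  by rewrite big_seq [RHS]big_seq; apply: eq_bigr => a /hX /cc ->.
by apply: hK => // a /[dup] /hX ca' /hX /cc ->.
Qed.

Lemma set_bounds (A : set R) (c d : R) : (forall a, A a -> c <= a <= d) ->
  forall a, A a -> [/\ inf A <= a, a <= sup A, c <= inf A & sup A <= d].
Proof.
move=> h a Aa; have ne : A !=set0 by exists a.
have ubd : ubound A d by move=> b /h /andP[].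
have lbc : lbound A c by move=> b /h /andP[].
split.
- by apply: ge_inf Aa; exists c.
- by apply: ub_le_sup Aa; exists d.
- exact: lb_le_inf.
- exact: ge_sup.
Qed.

(* [sup set0 = inf set0 = 0], so the two signs also hold for an empty spectrum. *)
Lemma pos_spectrum (A : set R) (c d e1 e2 : R) : 0 <= c ->
  (forall a, A a -> 0 < a /\ c <= a <= d) -> e1 = inf A -> e2 = sup A ->
  [/\ 0 <= e1, 0 <= e2, forall a, A a -> e1 <= a <= e2 & forall a, A a -> c <= e1 /\ e2 <= d].
Proof.
move=> c0 h -> ->; have h' a : A a -> c <= a <= d by case/h.
have hb := set_bounds h'.
have [[a Aa]|hA] := pselect (exists a, A a); last first.
  have -> : A = set0 by apply/seteqP; split => // a Aa; case: hA; exists a.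
  by rewrite inf0 sup0; split.
have [a0 _] := h a Aa; have [_ h2 h3 h4] := hb a Aa.
split; [exact: le_trans h3|exact: le_trans (ltW a0) h2| |by []].
by move=> b /hb[-> ->].
Qed.

Lemma neg_spectrum (A : set R) (c d e1 e2 : R) : 0 <= c ->
  (forall a, A a -> a < 0 /\ - d <= a <= - c) -> e1 = - sup A -> e2 = - inf A ->
  [/\ 0 <= e1, 0 <= e2, forall a, A a -> - e2 <= a <= - e1 & forall a, A a -> c <= e1 /\ e2 <= d].
Proof.
move=> c0 h -> ->; have h' a : A a -> - d <= a <= - c by case/h.
have hb := set_bounds h'.
have [[a Aa]|hA] := pselect (exists a, A a); last first.
  have -> : A = set0 by apply/seteqP; split => // a Aa; case: hA; exists a.
  by rewrite inf0 sup0 oppr0; split.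
have [a0 _] := h a Aa; have [h1 h2 h3 h4] := hb a Aa.
have [k1 k2 k3] : [/\ 0 <= - sup A, 0 <= - inf A & c <= - sup A /\ - inf A <= d].
  by move: (inf A) (sup A) h1 h2 h3 h4 => u v *; split; lra.
split => // b /hb[]; move: (inf A) (sup A) => u v h1' h2' _ _; apply/andP; split; lra.
Qed.

End Conclusion.

Theorem theorem5p6 (R : realType) (lam : R) (N : nat)
    (g gm gp : R -> R[i]) (Fm Fp : R[i]^o -> R[i]^o)
    (eta1m eta2m eta1p eta2p : R) :
  0 < lam ->
  (1 < N)%N ->
  APW g ->
  AP_minus gm -> AP_plus gp ->
  ~ Omega gm 0 -> ~ Omega gp 0 ->
  (forall x, g x = gm x + gp x) ->
  S_class lam N g ->
  eta1m = - sup (Omega gm) -> eta2m = - inf (Omega gm) ->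
  eta1p = inf (Omega gp) -> eta2p = sup (Omega gp) ->
  entire_extension gm Fm -> entire_extension gp Fp ->
  (forall eps1 eps2 : R, 0 <= eps1 -> 0 <= eps2 ->
     (0 < ereal_inf [set (cabs (Fp z) + cabs (Fm z))%:E
                    | z in strip eps1 eps2])%E) ->
  [/\ (Omega gp eta1p -> Omega gm (- eta1m) ->
       Num.max (N%:R * eta1p + (N%:R - 1) * eta2m)
               (N%:R * eta1m + (N%:R - 1) * eta2p) <= lam ->
       let mu := N%:R * (eta1p + eta1m) - lam in
       APW_factorization (Gmx lam g) mu (- mu)),
      (Omega gp eta1p -> Omega gp eta2p ->
       N%:R * eta1p + (N%:R - 1) * eta2m <= lam
         <= N%:R * eta1m + (N%:R - 1) * eta2p ->
       let mu := N%:R * eta1p - (N%:R - 1) * eta2p in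
       APW_factorization (Gmx lam g) mu (- mu)),
      (Omega gm (- eta1m) -> Omega gm (- eta2m) ->
       N%:R * eta1m + (N%:R - 1) * eta2p <= lam
         <= N%:R * eta1p + (N%:R - 1) * eta2m ->
       let mu := N%:R * eta1m - (N%:R - 1) * eta2m in
       APW_factorization (Gmx lam g) mu (- mu)) &
      (Omega gp eta2p -> Omega gm (- eta2m) ->
       lam <= Num.min (N%:R * eta1p + (N%:R - 1) * eta2m)
                      (N%:R * eta1m + (N%:R - 1) * eta2p) ->
       let mu := lam - (N%:R - 1) * (eta2p + eta2m) in
       APW_factorization (Gmx lam g) mu (- mu))].
Proof.
move=> lam0 N1 hg hgm hgp gm0 gp0 gE hS E1m E2m E1p E2p hFm hFp hstrip.
have [beta [nu [beta0 nu0 hlam hOm hOp]]] := split_spectrum N1 (proj1 hg) hgm hgp gm0 gp0 gE hS.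
have [n nE] : exists n, N = n.+1.
  by case: N N1 {hS hlam hOm hOp hstrip gm0 gp0} => // n _; exists n.
subst N; have q0 : 0 < n%:R :> R by rewrite ltr0n.
have qE : n.+1%:R - 1 = n%:R :> R by rewrite -natr1 addrK.
rewrite qE in hOm hOp *.
(* Here [n] is [N - 1], the exponent in [geomS]; this clears the denominators in the spectral
   intervals. *)
have mulq (b : R) : n%:R * (b + b / n%:R) = n.+1%:R * b.
  by rewrite mulrDr mulrCA divff ?gt_eqF // mulr1 -natr1 mulrDl mul1r.
have bm a : Omega gm a -> a < 0 /\ - (beta + beta / n%:R) <= a <= - beta.
  by move=> fa; have [h1 h2 _] := hOm a fa; exact: (conj h1 h2).
have bp a : Omega gp a -> 0 < a /\ nu <= a <= nu + nu / n%:R.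
  by move=> fa; have [h1 h2 _] := hOp a fa; exact: (conj h1 h2).
have [m1 m2 Om m_eta0] := neg_spectrum beta0 bm E1m E2m.
have [p1 p2 Op p_eta0] := pos_spectrum nu0 bp E1p E2p.
have m_eta a : Omega gm a -> beta <= eta1m /\ n%:R * eta2m <= n.+1%:R * beta.
  move=> fa; have [h1 h2] := m_eta0 a fa; split; first exact: h1.
  rewrite -mulq; exact: (ler_wpM2l (ltW q0) h2).
have p_eta a : Omega gp a -> nu <= eta1p /\ n%:R * eta2p <= n.+1%:R * nu.
  move=> fa; have [h1 h2] := p_eta0 a fa; split; first exact: h1.
  rewrite -mulq; exact: (ler_wpM2l (ltW q0) h2).
have m_pos a (fa : Omega gm a) : a < 0 := proj1 (bm a fa).
have p_pos a (fa : Omega gp a) : 0 < a := proj1 (bp a fa).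
have [K hK] := bounded_esum (fun a => cabs_ge0 (bohr_coef g a)) (proj2 hg).
have sum_m := same_values_sum (fun a fa => let: And3 _ _ h := hOm a fa in h) hK.
have sum_p := same_values_sum (fun a fa => let: And3 _ _ h := hOp a fa in h) hK.
have [sa [wA uA cA lA]] := AP_entire_series (proj1 hgm) Om sum_m hFm.
have [sb [wB uB cB lB]] := AP_entire_series (proj1 hgp) Op sum_p hFp.
have lines (y : R) : exists (delta : R) n0, 0 < delta /\ forall k (x : R), (n0 <= k)%N ->
    delta <= cabs (ev (sa k) (Complex x y)) + cabs (ev (sb k) (Complex x y)).
  have [delta d0 hd] := strip_line hstrip y.
  have d4 : 0 < delta / 4 by rewrite divr_gt0.
  have [na ha] := lA y _ d4; have [nb hb] := lB y _ d4.
  exists (delta / 2), (maxn na nb); split; first by rewrite divr_gt0.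
  move=> k x; rewrite geq_max => /andP[ka kb].
  have Ha := ha k x ka; have Hb := hb k x kb.
  have Hd := hd x.
  have H1 := le_trans (cabs_le_dist _ _) Ha; have H2 := le_trans (cabs_le_dist _ _) Hb.
  clear - Hd H1 H2; lra.
have gfun : g = fun x => gm x + gp x := funext gE.
(* The choice of [s] keeps a constant term in the upper column: [lam - N * eta1p] in (i) and (ii),
   where [gp] has the frequency [eta1p], and [(N - 1) * eta2m] in (iii) and (iv), where [gm] has
   [- eta2m]. The same demand on the lower column then determines [mu]. *)
have fact (mu s : R) := @pair_factorization R lam mu s eta1p eta2p eta1m eta2m n gm gp
  (bohr_coef gm) (bohr_coef gp) sa sb wA wB uA uB cA cB lines.
(* The source of [mu >= 0] in (i), where [eta1p >= nu] and [eta1m >= beta], and in (iv), where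
   [(N - 1) * eta2p <= N * nu] and [(N - 1) * eta2m <= N * beta]. In (ii) and (iii) the two ends of
   a single spectrum are compared instead. *)
have hlam' : n.+1%:R * nu + n.+1%:R * beta = lam by rewrite -mulrDr; exact: hlam.
have N0 : 0 <= n.+1%:R :> R := ler0n R n.+1.
rewrite gfun; split.
- move=> c1 c2; rewrite ge_max => /andP[l1 l2] mu.
  have k1 := p_pos _ c1; have k2 := m_pos _ c2.
  have [h1 _] := p_eta _ c1; have [h2 _] := m_eta _ c2.
  have h1' := ler_wpM2l N0 h1; have h2' := ler_wpM2l N0 h2.
  have muE : mu = n.+1%:R * eta1p + n.+1%:R * eta1m - lam by rewrite /mu mulrDr; exact: erefl.
  clearbody mu.
  apply: (fact mu (lam - n.+1%:R * eta1p)).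
  + clear - muE h1' h2' hlam'; lra.
  + clear - k1 m2; lra.
  + clear - k2 p2; lra.
  + clear - l1; lra.
  + clear - l1; lra.
  + clear - l2 muE; lra.
  + clear - muE; lra.
  + left; exact: (conj erefl c1).
  + left; split; [clear - muE; lra|exact: c2].
- move=> c1 c2 /andP[l1 l2] mu.
  have k1 := p_pos _ c1; have k2 := p_pos _ c2.
  have [h1 h2] := p_eta _ c1; have h1' := ler_wpM2l N0 h1.
  have muE : mu = n.+1%:R * eta1p - n%:R * eta2p := erefl.
  clearbody mu.
  apply: (fact mu (lam - n.+1%:R * eta1p)).
  + clear - muE h1' h2; lra.
  + clear - k1 m2; lra.
  + clear - k2 m1; lra.
  + clear - l1; lra.
  + clear - l1; lra.
  + clear - muE; lra.
  + clear - muE l2; lra.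
  + left; exact: (conj erefl c1).
  + right; split; [clear - muE; lra|exact: c2].
- move=> c1 c2 /andP[l1 l2] mu.
  have k1 := m_pos _ c1; have k2 := m_pos _ c2.
  have [h1 h2] := m_eta _ c1; have h1' := ler_wpM2l N0 h1.
  have muE : mu = n.+1%:R * eta1m - n%:R * eta2m := erefl.
  clearbody mu.
  apply: (fact mu (n%:R * eta2m)).
  + clear - muE h1' h2; lra.
  + clear - k2 p1; lra.
  + clear - k1 p2; lra.
  + exact: lexx.
  + clear - l2; lra.
  + clear - muE l1; lra.
  + clear - muE; lra.
  + right; exact: (conj erefl c2).
  + left; split; [clear - muE; lra|exact: c1].
- move=> c1 c2; rewrite le_min => /andP[l1 l2] mu.
  have k1 := p_pos _ c1; have k2 := m_pos _ c2.
  have [_ h1] := p_eta _ c1; have [_ h2] := m_eta _ c2.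
  have muE : mu = lam - (n%:R * eta2p + n%:R * eta2m) by rewrite /mu mulrDr; exact: erefl.
  clearbody mu.
  apply: (fact mu (n%:R * eta2m)).
  + clear - muE h1 h2 hlam'; lra.
  + clear - k2 p1; lra.
  + clear - k1 m1; lra.
  + exact: lexx.
  + clear - l1; lra.
  + clear - muE; lra.
  + clear - muE l2; lra.
  + right; exact: (conj erefl c2).
  + right; split; [clear - muE; lra|exact: c1].
Qed.
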